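(* Let $g=(g_{ij})$ be a smooth symmetric (possibly degenerate) bilinear form defined near a point $p\in\mathbb{R}^n$ such that flat coordinates for $g$ exist near $p$, and let $P=(P^{ij})$ be a smooth skew-symmetric contravariant tensor field defined near $p$ of rank $n$ at $p$. Then there exists a local coordinate system near $p$ in which both $g$ and $P$ have constant components if and only if the following conditions hold (near $p$): (1) $P^{ij}$ generates a Poisson structure, that is, for all $i,j,k$ $$\sum_s\left(P^{sk}\frac{\partial P^{ij}}{\partial x^s}+P^{si}\frac{\partial P^{jk}}{\partial x^s}+P^{sj}\frac{\partial P^{ki}}{\partial x^s}\right)=0;$$ (2) for all $i,j,k$ $$\sum_{a,b}g_{ai}g_{bj}\frac{\partial P^{ab}}{\partial x^k}+\sum_s\left(P_i^{\ s}\,\Gamma_{ks,j}+P^s_{\ j}\,\Gamma_{ks,i}\right)=0,$$ where $P_i^{\ s}=\sum_cg_{ic}P^{cs}$, $P^s_{\ j}=\sum_cg_{jc}P^{sc}$, and $$\Gamma_{ij,s}=\tfrac12\left(\frac{\partial g_{js}}{\partial x^i}+\frac{\partial g_{is}}{\partial x^j}-\frac{\partial g_{ij}}{\partial x^s}\right).$$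
   Context: All indices run from $1$ to $n$. A local coordinate system is flat for $g$ if the components of $g$ in it are constant. Under a coordinate change $x\to y$, $g$ transforms covariantly, $\tilde g_{ij}=\sum_{r,s}g_{rs}\frac{\partial x^r}{\partial y^i}\frac{\partial x^s}{\partial y^j}$, and $P$ contravariantly, $\tilde P^{ij}=\sum_{r,s}P^{rs}\frac{\partial y^i}{\partial x^r}\frac{\partial y^j}{\partial x^s}$. *)

(* Defs.v *)
From HB Require Import structures.
From mathcomp Require Import all_boot all_order all_algebra.
From mathcomp Require Import all_classical all_reals all_analysis.

Set Implicit Arguments.
Unset Strict Implicit.
Unset Printing Implicit Defensive.

Import Order.TTheory GRing.Theory Num.Theory.
Import numFieldNormedType.Exports.

Local Open Scope classical_set_scope.
Local Open Scope ring_scope.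

(* Points of R^n are row vectors. *)
Definition partial (R : realType) (n : nat) (i : 'I_n) (f : 'rV[R]_n -> R)
    : 'rV[R]_n -> R :=
  fun x => 'D_(delta_mx 0 i) f x.

(* [partials [:: i1; ...; ik] f] is d_{i1} (... (d_{ik} f)). *)
Definition partials (R : realType) (n : nat) (s : seq 'I_n)
    (f : 'rV[R]_n -> R) : 'rV[R]_n -> R :=
  foldr (@partial R n) f s.

(* Infinite differentiability on U, which is meant to be open: Frechet
   differentiability gives both the existence of the next partial derivatives
   and the continuity of the present one. *)
Definition smooth_on (R : realType) (n : nat) (U : set 'rV[R]_n)
    (f : 'rV[R]_n -> R) : Prop :=
  forall (s : seq 'I_n) (x : 'rV[R]_n), U x -> differentiable (partials s f) x.

Definition smooth_map_on (R : realType) (n : nat) (U : set 'rV[R]_n)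
    (phi : 'rV[R]_n -> 'rV[R]_n) : Prop :=
  forall i : 'I_n, smooth_on U (fun x => phi x 0 i).

Definition smooth_tensor_on (R : realType) (n : nat) (U : set 'rV[R]_n)
    (T : 'rV[R]_n -> 'M[R]_n) : Prop :=
  forall i j : 'I_n, smooth_on U (fun x => T x i j).

(* A coordinate system y = to_coord x on the open set [cdom], i.e. a smooth
   diffeomorphism of [cdom] onto the open set [crange], with inverse
   x = of_coord y. The values of the maps elsewhere are irrelevant. *)
Record coord_system (R : realType) (n : nat) := CoordSystem {
  cdom : set 'rV[R]_n;
  crange : set 'rV[R]_n;
  to_coord : 'rV[R]_n -> 'rV[R]_n;
  of_coord : 'rV[R]_n -> 'rV[R]_n;
  cdom_open : open cdom;
  crange_open : open crange;
  to_coord_range : forall x, cdom x -> crange (to_coord x);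
  of_coord_dom : forall y, crange y -> cdom (of_coord y);
  to_coordK : forall x, cdom x -> of_coord (to_coord x) = x;
  of_coordK : forall y, crange y -> to_coord (of_coord y) = y;
  to_coord_smooth : smooth_map_on cdom to_coord;
  of_coord_smooth : smooth_map_on crange of_coord
}.

(* A coordinate system around p, inside the domain W of the tensor fields. *)
Definition coord_near (R : realType) (n : nat) (W : set 'rV[R]_n)
    (p : 'rV[R]_n) (c : coord_system R n) : Prop :=
  cdom c p /\ cdom c `<=` W.

(* Components, at the point with coordinates y, of a covariant (resp.
   contravariant) 2-tensor given by its components in the coordinates x. *)
Definition cov_components (R : realType) (n : nat) (c : coord_system R n)
    (g : 'rV[R]_n -> 'M[R]_n) (y : 'rV[R]_n) : 'M[R]_n :=
  \matrix_(i, j) \sum_(r < n) \sum_(s < n)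
    g (of_coord c y) r s
    * partial i (fun z => of_coord c z 0 r) y
    * partial j (fun z => of_coord c z 0 s) y.

Definition contra_components (R : realType) (n : nat) (c : coord_system R n)
    (P : 'rV[R]_n -> 'M[R]_n) (y : 'rV[R]_n) : 'M[R]_n :=
  \matrix_(i, j) \sum_(r < n) \sum_(s < n)
    P (of_coord c y) r s
    * partial r (fun x => to_coord c x 0 i) (of_coord c y)
    * partial s (fun x => to_coord c x 0 j) (of_coord c y).

Definition cov_constant_in (R : realType) (n : nat) (c : coord_system R n)
    (g : 'rV[R]_n -> 'M[R]_n) : Prop :=
  exists G : 'M[R]_n, forall y, crange c y -> cov_components c g y = G.

Definition contra_constant_in (R : realType) (n : nat) (c : coord_system R n)
    (P : 'rV[R]_n -> 'M[R]_n) : Prop :=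
  exists Q : 'M[R]_n, forall y, crange c y -> contra_components c P y = Q.

Definition poisson_at (R : realType) (n : nat)
    (P : 'rV[R]_n -> 'M[R]_n) (x : 'rV[R]_n) : Prop :=
  forall i j k : 'I_n,
    \sum_(s < n) (P x s k * partial s (fun z => P z i j) x
                  + P x s i * partial s (fun z => P z j k) x
                  + P x s j * partial s (fun z => P z k i) x) = 0.

(* Gamma_{ij,s} *)
Definition christoffel1 (R : realType) (n : nat)
    (g : 'rV[R]_n -> 'M[R]_n) (i j s : 'I_n) (x : 'rV[R]_n) : R :=
  2^-1 * (partial i (fun z => g z j s) x
          + partial j (fun z => g z i s) x
          - partial s (fun z => g z i j) x).

(* P_i^s *)
Definition lower_fst (R : realType) (n : nat)
    (g P : 'rV[R]_n -> 'M[R]_n) (i s : 'I_n) (x : 'rV[R]_n) : R :=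
  \sum_(c < n) g x i c * P x c s.

(* P^s_j *)
Definition lower_snd (R : realType) (n : nat)
    (g P : 'rV[R]_n -> 'M[R]_n) (s j : 'I_n) (x : 'rV[R]_n) : R :=
  \sum_(c < n) g x j c * P x s c.

Definition compatible_at (R : realType) (n : nat)
    (g P : 'rV[R]_n -> 'M[R]_n) (x : 'rV[R]_n) : Prop :=
  forall i j k : 'I_n,
    \sum_(a < n) \sum_(b < n)
      g x a i * g x b j * partial k (fun z => P z a b) x
    + \sum_(s < n) (lower_fst g P i s x * christoffel1 g k s j x
                    + lower_snd g P s j x * christoffel1 g k s i x) = 0.

(* Main.v *)
(* In flat coordinates y of g, with g = \sum G_ab dy^a dy^b, condition (2) says that
   G (d_k Q) G = 0 for all k, where Q^ab = {y^a, y^b}. After a linear change of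
   coordinates G is supported on its leading block of size r = rank g, and this means
   that the brackets {y^a, y^b} with a, b < r are constant. Condition (1) is the Jacobi
   identity, and P is nondegenerate; so by the Caratheodory-Jacobi-Lie theorem
   y^1, ..., y^r can be completed to coordinates all of whose brackets are constant,
   and the components of g only involve y^1, ..., y^r, which have not changed. For the
   completion, the Hamiltonian fields of y^1, ..., y^r commute and are independent,
   hence they can be straightened simultaneously. Conversely, both conditions are
   tensorial and hold trivially in coordinates where g and P are constant. *)
Require Import Defs.
From HB Require Import structures.
From mathcomp Require Import all_boot all_order all_algebra.
From mathcomp Require Import all_classical all_reals all_analysis.
From mathcomp Require Import ring lra.

Set Implicit Arguments.
Unset Strict Implicit.
Unset Printing Implicit Defensive.

Import Order.TTheory GRing.Theory Num.Theory.
Import numFieldNormedType.Exports.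

Local Open Scope classical_set_scope.
Local Open Scope ring_scope.

(** * Calculus on row vectors *)

Section RowVectors.
Variables (R : realType) (n : nat).
Implicit Types (x y z : 'rV[R]_n) (e : R).

Local Notation "''e_' i" := (delta_mx 0 i : 'rV[R]_n) (at level 8, i at level 2).

Lemma rV_coord_le x i : `|x 0 i| <= `|x|.
Proof.
by rewrite [leRHS]/Num.Def.normr/= mx_normrE (le_bigmax _ _ (0, i)).
Qed.

Lemma rV_norm_le x e : 0 <= e -> (forall i, `|x 0 i| <= e) -> `|x| <= e.
Proof.
move=> e0 H; rewrite [leLHS]/Num.Def.normr/= mx_normrE (bigmax_le _ e0)//=.
by move=> -[i j] _ /=; rewrite ord1.
Qed.

Lemma rV_norm_delta i : `|'e_i| <= 1 :> R.
Proof.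
apply: rV_norm_le => // j; rewrite mxE /=.
by case: eqP => _; rewrite ?normr1 ?normr0.
Qed.

Definition box x y : set 'rV[R]_n :=
  [set z | forall i, exists2 u : R, 0 <= u <= 1 & z 0 i = x 0 i + u * (y 0 i - x 0 i)].

Lemma box_dist x y z : box x y z -> `|z - x| <= `|y - x|.
Proof.
move=> bz; apply: rV_norm_le => // i; have [u /andP[u0 u1] zi] := bz i.
rewrite !mxE zi addrC addKr normrM ger0_norm//.
by rewrite (le_trans (ler_piMl _ _))//; have := rV_coord_le (y - x) i; rewrite !mxE.
Qed.

Lemma box_ball c e x y z : ball c e x -> ball c e y -> box x y z -> ball c e z.
Proof.
move=> [e0 cx] [_ cy] bz; split=> // a i; rewrite ord1.
have [u /andP[u0 u1] ->] := bz i.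
move: (cx 0 i) (cy 0 i); rewrite -!ball_normE /= !ltr_norml => /andP[h1 h2] /andP[h3 h4].
have [xy|yx] := leP (x 0 i) (y 0 i).
  have ? : 0 <= u * (y 0 i - x 0 i) by rewrite mulr_ge0 ?subr_ge0.
  have ? : 0 <= (1 - u) * (y 0 i - x 0 i) by rewrite mulr_ge0 ?subr_ge0.
  by apply/andP; split; lra.
have ? : 0 <= u * (x 0 i - y 0 i) by rewrite mulr_ge0 ?subr_ge0 ?(ltW yx).
have ? : 0 <= (1 - u) * (x 0 i - y 0 i) by rewrite mulr_ge0 ?subr_ge0 ?(ltW yx).
by apply/andP; split; lra.
Qed.

End RowVectors.

Section LineDerivatives.
Variables (R : realType) (V : normedModType R).

Lemma is_derive_line (f : V -> R) x v d s :
  is_derive (s *: v + x) v f d <-> is_derive s 1 (fun h : R => f (h *: v + x)) d.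
Proof.
have E (h : R) : h *: v + (s *: v + x) = (h *: (1:R) + s) *: v + x.
  by rewrite addrA -scalerDl /GRing.scale /= mulr1.
have E2 : ((fun h : R => h^-1 *: ((f \o shift (s *: v + x)) (h *: v) - f (s *: v + x)))
  = (fun h : R => h^-1 *: (((fun h : R => f (h *: v + x)) \o shift s) (h *: (1:R)) - f (s *: v + x)))).
  by rewrite funeqE => h /=; rewrite E.
split=> -[D1 D2]; split; rewrite /derivable /derive.
- by rewrite -E2.
- by rewrite -E2.
- by rewrite E2.
- by rewrite E2.
Qed.

Lemma is_derive_continuous (f : R -> R) (x d : R) : is_derive x 1 f d -> {for x, continuous f}.
Proof. by move=> [/derivable1_diffP D _]; exact: differentiable_continuous. Qed.

Lemma line_mvt (f : V -> R) (df : V -> R) x v (s : R) :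
  (forall u : R, 0 <= u <= 1 -> is_derive ((u * s) *: v + x) v f (df ((u * s) *: v + x))) ->
  exists2 u : R, 0 <= u <= 1 & f (s *: v + x) - f x = df ((u * s) *: v + x) * s.
Proof.
move=> H.
pose g (u : R) := f ((u * s) *: v + x).
have dg (u : R) : 0 <= u <= 1 -> is_derive u 1 g (df ((u * s) *: v + x) * s).
  move=> /H/is_derive_line D.
  pose h0 := (fun h : R => f (h *: v + x)).
  have -> : g = h0 \o (fun u => u * s) by [].
  have D' : is_derive (u * s : R) 1 h0 (df ((u * s) *: v + x)) by [].
  have Ds : is_derive u (1:R) (fun u : R => u * s) s.
    rewrite (_ : (fun u : R => u * s) = (id : R -> R) * cst s)//.
    by apply: is_derive_eq; rewrite scaler0 add0r /GRing.scale /= mulr1.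
  apply: is_derive1_comp.
have [|||c c01] := @MVT_segment R g (fun u => df ((u * s) *: v + x) * s) 0 1.
- by [].
- by move=> u; rewrite in_itv /= => /andP[u0 u1]; apply: dg; rewrite !ltW.
- apply: derivable_within_continuous => u; rewrite in_itv /= => u01.
  by have [] := dg _ u01.
- rewrite /g mul1r mul0r scale0r add0r subr0 mulr1 => E.
  by exists c => //; move: c01; rewrite in_itv.
Qed.

End LineDerivatives.

Lemma cvg_sumr (R : realType) (T : Type) (F : set_system T) {FF : Filter F} (I : Type)
    (r : seq I) (Q : pred I) (f : I -> T -> R) (a : I -> R) :
    (forall i, Q i -> f i x @[x --> F] --> a i) ->
  \sum_(i <- r | Q i) f i x @[x --> F] --> \sum_(i <- r | Q i) a i.
Proof.
by move=> H; apply: cvg_big => //; exact: add_continuous.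
Qed.

Lemma continuous_sumr (R : realType) (T : topologicalType) (x : T) (I : Type)
    (r : seq I) (Q : pred I) (f : I -> T -> R) :
    (forall i, Q i -> {for x, continuous (f i)}) ->
  {for x, continuous (fun y => \sum_(i <- r | Q i) f i y)}.
Proof. by move=> H; apply: cvg_sumr. Qed.

Section MeanValue.
Variables (R : realType) (n : nat).
Implicit Types (x y z : 'rV[R]_n) (f : 'rV[R]_n -> R) (df : 'I_n -> 'rV[R]_n -> R).

Local Notation "''e_' i" := (delta_mx 0 i : 'rV[R]_n) (at level 8, i at level 2).

(* The path from [x] to [y] along the edges of the box, changing one coordinate
   at a time. *)
Lemma box_mvt f df x y :
    (forall z i, box x y z -> is_derive z 'e_i f (df i z)) ->
  exists xi : 'I_n -> 'rV[R]_n, (forall i, box x y (xi i)) /\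
    f y - f x = \sum_i df i (xi i) * (y 0 i - x 0 i).
Proof.
move=> H; pose z k : 'rV[R]_n := \row_j (if (j < k)%N then y 0 j else x 0 j).
have zS (i : 'I_n) u : 0 <= u <= 1 -> box x y ((u * (y 0 i - x 0 i)) *: 'e_i + z i).
  move=> u01 j; rewrite !mxE; have [->|ji] := eqVneq j i.
    by exists u => //; rewrite ltnn/= mulr1 addrC.
  rewrite mulr0 add0r; case: ifP => _; first by exists 1; rewrite ?ler01 ?lexx//; ring.
  by exists 0; rewrite ?ler01 ?lexx//; ring.
have zE (i : 'I_n) : z i.+1 = (y 0 i - x 0 i) *: 'e_i + z i.
  apply/rowP => j; rewrite !mxE ltnS leq_eqVlt; have [->|ji] := eqVneq j i.
    by rewrite eqxx ltnn/= mulr1 subrK.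
  by rewrite (inj_eq val_inj) (negPf ji)/= mulr0 add0r.
have E (i : 'I_n) : exists w, box x y w /\ f (z i.+1) - f (z i) = df i w * (y 0 i - x 0 i).
  have [u u01 D] := @line_mvt R _ f (df i) (z i) 'e_i (y 0 i - x 0 i)
    (fun u u01 => H _ i (zS i u u01)).
  by eexists; split; [exact: zS u01|rewrite zE D].
have [xi xiP] := choice E; exists xi; split=> [i|]; first by have [] := xiP i.
under eq_bigr => i _ do rewrite -(xiP i).2.
rewrite -(big_mkord xpredT (fun i => f (z i.+1) - f (z i))) telescope_sumr//.
congr (f _ - f _); apply/rowP => j; rewrite !mxE ?ltn_ord//.
Qed.

Lemma C1_differentiable f df x :
    (\forall z \near x, forall i, is_derive z 'e_i f (df i z)) ->
    (forall i, {for x, continuous (df i)}) ->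
  differentiable f x.
Proof.
move=> /nbhs_ballP[r /= r0 fder] dfc.
pose L (v : 'rV[R]_n) : R := \sum_i df i x * v 0 i.
have Llin : linear L.
  move=> a u v; rewrite /L /GRing.scale/= mulr_sumr -big_split/=.
  by apply: eq_bigr => i _; rewrite !mxE; ring.
pose Lm := GRing.isLinear.Build _ _ _ _ _ Llin.
pose LL : {linear 'rV[R]_n -> R} := HB.pack L Lm.
have Lc : continuous LL.
  move=> v; apply: (@continuous_sumr _ _ v _ _ _ (fun i (v : 'rV[R]_n) => df i x * v 0 i)).
  by move=> i _; apply: (@continuousM _ _ (cst (df i x)) (fun v : 'rV[R]_n => v 0 i));
    [exact: cst_continuous|exact: coord_continuous].
suff o : f \o shift x = cst (f x) + (L : 'rV[R]_n -> R) +o_ (0 : 'rV[R]_n) id.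
  by apply/diff_locallyP; rewrite (diff_unique Lc o).
apply/eqaddoP => e e0.
have n1 : 0 < n%:R + 1 :> R by rewrite ltr_wpDl.
have en : 0 < e / (n%:R + 1) by rewrite divr_gt0.
have : \forall z \near x, forall i, `|df i x - df i z| <= e / (n%:R + 1).
  have dfn i : \forall z \near x, `|df i x - df i z| <= e / (n%:R + 1).
    by have /cvgrPdist_le/(_ _ en) := dfc i.
  exact: (filter_forall _ dfn).
move=> /nbhs_ballP[r' /= r'0 dfn].
apply/nbhs_ballP; exists (Num.min r r'); first by rewrite /= lt_min r0.
move=> h; rewrite -ball_normE /= sub0r normrN lt_min => /andP[hr hr'].
have bx z : box x (h + x) z -> `|x - z| <= `|h|.
  by move=> /box_dist; rewrite distrC addrK.
have [xi [xib E]] : exists xi : 'I_n -> 'rV[R]_n, (forall i, box x (h + x) (xi i)) /\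
    f (h + x) - (f x + L h) = \sum_i (df i (xi i) - df i x) * h 0 i.
  have [z i /bx zb|xi [xib E]] := @box_mvt f df x (h + x).
    by apply: fder; rewrite -ball_normE /=; exact: le_lt_trans zb hr.
  exists xi; split=> //; rewrite opprD addrA E -sumrB; apply: eq_bigr => i _.
  by rewrite !mxE addrK; ring.
rewrite -[X in `|X| <= _]/(f (h + x) - (f x + L h)) E; apply: (le_trans (ler_norm_sum _ _ _)).
apply: (@le_trans _ _ (\sum_(i < n) e / (n%:R + 1) * `|h|)).
  apply: ler_sum => i _; rewrite normrM ler_pM//; last exact: rV_coord_le.
  rewrite distrC dfn// -ball_normE /=; exact: le_lt_trans (bx _ (xib i)) hr'.
rewrite sumr_const card_ord -[X in X <= _]mulr_natr mulrAC /= ler_wpM2r//.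
by rewrite -mulrA ler_piMr// ?(ltW e0)// mulrC ler_pdivrMr// mul1r lerDl.
Qed.

End MeanValue.

Section ChainRule.
Variables (R : realType) (m : nat) (V : normedModType R).

Local Notation "''e_' i" := (delta_mx 0 i : 'rV[R]_m) (at level 8, i at level 2).

Lemma is_derive_chain (f : 'rV[R]_m -> R) (phi : V -> 'rV[R]_m) x v (df dphi : 'I_m -> R) :
    differentiable f (phi x) -> (forall i, is_derive (phi x) 'e_i f (df i)) ->
    (forall i, is_derive x v (fun y => phi y 0 i) (dphi i)) ->
  is_derive x v (fun y => f (phi y)) (\sum_i df i * dphi i).
Proof.
move=> fd fdf pd.
have x0 : x = (0 : R) *: v + x by rewrite scale0r add0r.
rewrite x0; apply/is_derive_line.
pose g (h : R) := phi (h *: v + x).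
have gd : forall i, is_derive (0 : R) (1:R) (fun h => g h 0 i) (dphi i).
  by move=> i; have := pd i; rewrite {1}x0 => /is_derive_line.
have gder : derivable g (0:R) (1:R).
  by apply/derivable_mxP => a i; rewrite ord1; have [] := gd i.
have g0 : g 0 = phi x by rewrite /g -x0.
have gdiff : differentiable g (0:R) by apply/derivable1_diffP.
have fd' : differentiable f (g 0) by rewrite g0.
have D : differentiable (f \o g) (0:R) by exact: differentiable_comp.
split; first exact/diff_derivable.
have gv : 'd g (0:R) (1:R) = \sum_i dphi i *: 'e_i.
  rewrite -deriveE// derive_mx//; apply/rowP => i.
  rewrite !mxE summxE (bigD1 i)//= big1 => [|j ji].
    by rewrite !mxE !eqxx mulr1 addr0; have [_ ->] := gd i.
  by rewrite !mxE eq_sym (negPf ji) mulr0.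
rewrite -[LHS]/('D_1 (f \o g) (0:R)) deriveE// diff_comp//= gv g0.
rewrite linear_sum; apply: eq_bigr => i _.
by rewrite linearZ /= mulrC -deriveE//; have [_ ->] := fdf i.
Qed.

End ChainRule.

(** * Functions of class C^k depending on a parameter *)

Lemma pair_continuous (T U V : topologicalType) (f : T -> U) (g : T -> V) x :
  {for x, continuous f} -> {for x, continuous g} -> {for x, continuous (fun z => (f z, g z))}.
Proof. by move=> cf cg; apply: cvg_pair. Qed.

Lemma rV_continuous (R : realType) (T : topologicalType) (n : nat) (f : T -> 'rV[R]_n) x :
  (forall i, {for x, continuous (fun t => f t 0 i)}) -> {for x, continuous f}.
Proof.
move=> H; apply/cvgrPdist_le => e e0.
have fn i : \forall z \near x, `|f x 0 i - f z 0 i| <= e.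
  by have /cvgrPdist_le/(_ _ e0) := H i.
apply: filterS (filter_forall _ fn) => z zP.
by apply: rV_norm_le => [|i]; [exact: ltW|rewrite !mxE; exact: zP].
Qed.

Section Ck.
Variables (R : realType).

Local Notation "''e_' i" := (delta_mx 0 i) (at level 8, i at level 2).

(* [Ck k B u] says that u(t, y) is C^k in y on the set B, its partial derivatives
   of order at most k being jointly continuous in the parameter t and in y. *)
Fixpoint Ck n (k : nat) (B : set 'rV[R]_n) (u : R -> 'rV[R]_n -> R) : Prop :=
  (forall t y, B y -> {for (t, y), continuous (fun z : R * 'rV[R]_n => u z.1 z.2)}) /\
  (if k is k'.+1 then exists du : 'I_n -> R -> 'rV[R]_n -> R,
     (forall j, Ck k' B (du j)) /\
     (forall j t y, B y -> is_derive y 'e_j (u t) (du j t y))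
   else True).

Section Basic.
Variable (n : nat).
Implicit Types (k : nat) (B : set 'rV[R]_n) (u v : R -> 'rV[R]_n -> R).

Lemma Ck_continuous k B u t y : Ck k B u -> B y ->
  {for (t, y), continuous (fun z : R * 'rV[R]_n => u z.1 z.2)}.
Proof. by case: k => [|k] [c _]; exact: c. Qed.

Lemma Ck_continuous_at k B u t y : Ck k B u -> B y -> {for y, continuous (u t)}.
Proof.
move=> Hu By.
apply: (@continuous_comp _ _ _ (fun z => (t, z)) (fun z : R * 'rV[R]_n => u z.1 z.2)).
  by apply: pair_continuous; [exact: cst_continuous|exact: cvg_id].
exact: (Ck_continuous Hu By).
Qed.

Lemma Ck_S k B u : Ck k.+1 B u -> Ck k B u.
Proof.
elim: k u => [u [c _]|k IH u [c [du [duk dud]]]]; first by split.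
by split=> //; exists du; split=> // j; exact: IH.
Qed.

Lemma Ck_le k l B u : (l <= k)%N -> Ck k B u -> Ck l B u.
Proof.
by move=> /subnKC <-; elim: (k - l)%N => [|d IH]; rewrite ?addn0// addnS => /Ck_S.
Qed.

Lemma Ck_eq k B u v : open B -> (forall t y, B y -> u t y = v t y) -> Ck k B u -> Ck k B v.
Proof.
move=> oB uv; have Bn y : B y -> nbhs y B by move=> By; exact: (open_nbhs_nbhs (conj oB By)).
have cv t y : B y -> {for (t, y), continuous (fun z : R * 'rV[R]_n => u z.1 z.2)} ->
    {for (t, y), continuous (fun z : R * 'rV[R]_n => v z.1 z.2)}.
  move=> By c0; rewrite /prop_for /continuous_at /= -(uv t y By).
  apply: cvg_trans c0; apply: near_eq_cvg.
  have : (fun z : R * 'rV[R]_n => z.2) @ (t, y) --> y by exact: cvg_snd.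
  move=> /(_ _ (Bn _ By)) Bn2; near=> z; rewrite uv//; near: z; exact: Bn2.
case: k => [|k] [c D]; (split=> [t y By|]; first exact: cv (c t y By)) => //.
case: D => du [duk dud]; exists du; split=> // j t y By.
apply: near_eq_is_derive (dud j t y By).
by apply: filterS (Bn _ By) => z; exact: uv.
Unshelve. all: by end_near. Qed.

Lemma Ck_cst k B c : Ck k B (fun _ _ => c).
Proof.
elim: k c => [|k IH] c; (split=> [t y _|]; first exact: cst_continuous) => //.
exists (fun _ _ _ => 0); split=> // j t y _; exact: is_derive_cst.
Qed.

Lemma coord_is_derive (y : 'rV[R]_n) i j : is_derive y 'e_j (fun y => y 0 i) (i == j)%:R.
Proof.
split; first exact: diff_derivable (differentiable_coord y 0 i).
rewrite /derive; apply: lim_near_cst => //.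
near=> h; rewrite /= !mxE eqxx /= addrK /GRing.scale/= mulKf//.
near: h; exact: nbhs_dnbhs_neq.
Unshelve. all: by end_near. Qed.

Lemma Ck_coord k B i : Ck k B (fun _ y => y 0 i).
Proof.
have c t y : {for (t, y), continuous (fun z : R * 'rV[R]_n => z.2 0 i)}.
  apply: (@continuous_comp _ _ _ (fun z : R * 'rV[R]_n => z.2) (fun v : 'rV[R]_n => v 0 i)).
    exact: cvg_snd.
  exact: coord_continuous.
case: k => [|k]; split=> //.
exists (fun j _ _ => (i == j)%:R); split=> [j|j t y _]; first exact: Ck_cst.
exact: coord_is_derive.
Qed.

Lemma CkD k B u v : Ck k B u -> Ck k B v -> Ck k B (fun t y => u t y + v t y).
Proof.
elim: k u v => [|k IH] u v [cu Du] [cv Dv]; (split=> [t y By|//];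
  first exact: (continuousD (cu t y By) (cv t y By))).
case: Du => du [duk dud]; case: Dv => dv [dvk dvd].
exists (fun j t y => du j t y + dv j t y); split=> [j|j t y By]; first exact: IH (duk j) (dvk j).
by have := dud j t y By; have := dvd j t y By => ? ?; exact: is_deriveD.
Qed.

Lemma CkM k B u v : Ck k B u -> Ck k B v -> Ck k B (fun t y => u t y * v t y).
Proof.
elim: k u v => [|k IH] u v Hu Hv; have [cu Du] := Hu; have [cv Dv] := Hv;
  (split=> [t y By|//]; first exact: (continuousM (cu t y By) (cv t y By))).
case: Du => du [duk dud]; case: Dv => dv [dvk dvd].
exists (fun j t y => u t y * dv j t y + v t y * du j t y); split=> [j|j t y By].
  by apply: CkD; [exact: IH (Ck_S Hu) (dvk j)|exact: IH (Ck_S Hv) (duk j)].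
by have := dud j t y By; have := dvd j t y By => ? ?; exact: is_deriveM.
Qed.

Lemma CkN k B u : Ck k B u -> Ck k B (fun t y => - u t y).
Proof.
move=> /(CkM (Ck_cst k B (-1))).
by under eq_fun do under eq_fun do rewrite mulN1r.
Qed.

Lemma Ck_sum k B (I : Type) (r : seq I) (Q : pred I) (u : I -> R -> 'rV[R]_n -> R) :
  (forall i, Q i -> Ck k B (u i)) -> Ck k B (fun t y => \sum_(i <- r | Q i) u i t y).
Proof.
move=> H; elim: r => [|i r IH].
  by under eq_fun do under eq_fun do rewrite big_nil; exact: Ck_cst.
under eq_fun do under eq_fun do rewrite big_cons.
by case Qi : (Q i) => //; apply: CkD IH; exact: H.
Qed.

Lemma Ck_prod k B (I : Type) (r : seq I) (Q : pred I) (u : I -> R -> 'rV[R]_n -> R) :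
  (forall i, Q i -> Ck k B (u i)) -> Ck k B (fun t y => \prod_(i <- r | Q i) u i t y).
Proof.
move=> H; elim: r => [|i r IH].
  by under eq_fun do under eq_fun do rewrite big_nil; exact: Ck_cst.
under eq_fun do under eq_fun do rewrite big_cons.
by case Qi : (Q i) => //; apply: CkM IH; exact: H.
Qed.

Lemma Ck_det k B m (A : R -> 'rV[R]_n -> 'M[R]_m) :
  (forall i j, Ck k B (fun t y => A t y i j)) -> Ck k B (fun t y => \det (A t y)).
Proof.
move=> H; rewrite /determinant; apply: Ck_sum => s _.
by apply: CkM; [exact: Ck_cst|apply: Ck_prod => i _; exact: H].
Qed.

Lemma CkV k B u : (forall t y, B y -> u t y != 0) -> Ck k B u -> Ck k B (fun t y => (u t y)^-1).
Proof.
move=> u0; elim: k => [|k IH] H; have [cu Du] := H;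
  (split=> [t y By|//]; first exact: (continuousV (u0 t y By) (cu t y By))).
case: Du => du [duk dud].
exists (fun j t y => - ((u t y)^-1 * (u t y)^-1) * du j t y); split=> [j|j t y By].
  by apply: CkM (duk j); apply: CkN; exact: CkM (IH (Ck_S H)) (IH (Ck_S H)).
have [d1 d2] := dud j t y By; split; first exact: derivableV (u0 t y By) d1.
by rewrite deriveV ?u0// d2 /GRing.scale/= -exprVn expr2.
Qed.

Lemma Ck_reparam k B u (a : R -> R) : continuous a -> Ck k B u -> Ck k B (fun t => u (a t)).
Proof.
move=> ca; elim: k u => [|k IH] u [c D].
all: have c' t y (By : B y) : {for (t, y), continuous (fun z : R * 'rV[R]_n => u (a z.1) z.2)} by
  apply: (@continuous_comp _ _ _ (fun z : R * 'rV[R]_n => (a z.1, z.2))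
           (fun z : R * 'rV[R]_n => u z.1 z.2)); [apply: pair_continuous;
    [apply: (@continuous_comp _ _ _ fst a); [exact: cvg_fst|exact: ca]|exact: cvg_snd]|exact: c].
- by split.
- split=> //; case: D => du [duk dud]; exists (fun j t => du j (a t)).
  by split=> [j|j t y]; [exact: IH (duk j)|exact: dud].
Qed.

Lemma Ck1_differentiable B u t y : open B -> Ck 1 B u -> B y -> differentiable (u t) y.
Proof.
move=> oB [_ [du [duk dud]]] By; apply: (@C1_differentiable _ _ _ (fun j => du j t)).
  by have := open_nbhs_nbhs (conj oB By); apply: filterS => z Bz j; exact: dud.
by move=> j; exact: (@Ck_continuous_at 0 B (du j) t y (duk j) By).
Qed.

End Basic.

Lemma Ck_comp n m k (B : set 'rV[R]_n) (V : set 'rV[R]_m) (f : 'rV[R]_m -> R)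
    (phi : R -> 'rV[R]_n -> 'rV[R]_m) :
    open V -> (forall t y, B y -> V (phi t y)) ->
    Ck k V (fun _ => f) -> (forall i, Ck k B (fun t y => phi t y 0 i)) ->
  Ck k B (fun t y => f (phi t y)).
Proof.
move=> oV BV; elim: k f => [|k IH] f Hf Hphi.
all: have c' t y (By : B y) : {for (t, y), continuous (fun z : R * 'rV[R]_n => f (phi z.1 z.2))} by
  apply: (@continuous_comp _ _ _ (fun z : R * 'rV[R]_n => phi z.1 z.2) f);
  [apply: rV_continuous => i; exact: (Ck_continuous (Hphi i) By)
  |exact: (@Ck_continuous_at _ _ _ (fun _ => f) t _ Hf (BV t y By))].
- by split.
split=> //; have [_ [df [dfk dfd]]] := Hf.
have /choice[dphi dphiP] : forall i, exists dp : 'I_n -> R -> 'rV[R]_n -> R,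
    (forall j, Ck k B (dp j)) /\
    (forall j t y, B y -> is_derive y 'e_j (fun y => phi t y 0 i) (dp j t y)).
  by move=> i; have [_ ?] := Hphi i.
exists (fun j t y => \sum_i df i 0 (phi t y) * dphi i j t y); split=> [j|j t y By].
  apply: Ck_sum => i _; apply: CkM; last by have [] := dphiP i.
  apply: IH => [|l]; last exact: Ck_S.
  by apply: (@Ck_reparam _ _ _ _ (fun=> 0)) (dfk i); exact: cst_continuous.
apply: is_derive_chain.
- by apply: (@Ck1_differentiable _ V (fun _ => f) 0) => //; [exact: Ck_le Hf|exact: BV].
- by move=> i; apply: dfd; exact: BV.
- by move=> i; have [_ /(_ j t y By)] := dphiP i.
Qed.

End Ck.

Section Smooth.
Variables (R : realType) (n : nat).
Implicit Types (k : nat) (B : set 'rV[R]_n) (u v : R -> 'rV[R]_n -> R).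
Implicit Types (f g : 'rV[R]_n -> R).

Local Notation "''e_' i" := (delta_mx 0 i) (at level 8, i at level 2).

Lemma Ck_is_derive k B u j t y : Ck k.+1 B u -> B y ->
  is_derive y 'e_j (u t) (partial j (u t) y).
Proof.
move=> [_ [du [duk dud]]] By; have [d1 d2] := dud j t y By.
exact: DeriveDef.
Qed.

Lemma Ck_partial k B u j : open B -> Ck k.+1 B u -> Ck k B (fun t => partial j (u t)).
Proof.
move=> oB [_ [du [duk dud]]]; apply: Ck_eq oB _ (duk j) => t y By.
by have [_ <-] := dud j t y By.
Qed.

Lemma CkSP k B u du : (forall t y, B y -> {for (t, y), continuous (fun z => u z.1 z.2)}) ->
    (forall j, Ck k B (du j)) ->
    (forall j t y, B y -> is_derive y 'e_j (u t) (du j t y)) -> Ck k.+1 B u.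
Proof. by move=> c duk dud; split=> //; exists du. Qed.

Lemma smooth_on_partial B f j : smooth_on B f -> smooth_on B (partial j f).
Proof. by move=> H s x Bx; have := H (rcons s j) x Bx; rewrite /partials foldr_rcons. Qed.

Lemma smooth_Ck B f k : smooth_on B f -> Ck k B (fun _ => f).
Proof.
elim: k f => [|k IH] f H.
all: have c t y (By : B y) : {for (t, y), continuous (fun z : R * 'rV[R]_n => f z.2)} by
  apply: (@continuous_comp _ _ _ snd f); [exact: cvg_snd|
    exact: differentiable_continuous (H [::] y By)].
- by split.
- apply: (@CkSP _ _ _ (fun j _ => partial j f)) => // [j|j t y By].
    by apply: IH; exact: smooth_on_partial.
  by apply: DeriveDef => //; exact: diff_derivable (H [::] y By).
Qed.

Lemma Ck_smooth B f : open B -> (forall k, Ck k B (fun _ => f)) -> smooth_on B f.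
Proof.
move=> oB H s x Bx.
suff K k : Ck (size s + k) B (fun _ => f) -> Ck k B (fun _ => partials s f).
  by apply: (@Ck1_differentiable _ _ B (fun _ => partials s f) 0 x) => //; exact: K.
elim/last_ind: s f {H} => [|s j IH] f //.
rewrite size_rcons addSn /partials foldr_rcons => /(Ck_partial j oB); exact: IH.
Qed.

Lemma smooth_is_derive B f j y : smooth_on B f -> B y ->
  is_derive y 'e_j f (partial j f y).
Proof. by move=> H By; apply: (@Ck_is_derive 0 B (fun _ => f) j 0) => //; exact: smooth_Ck. Qed.

Lemma smooth_differentiable B f y : smooth_on B f -> B y -> differentiable f y.
Proof. by move=> H; exact: (H [::]). Qed.

Lemma smooth_continuous B f y : smooth_on B f -> B y -> {for y, continuous f}.
Proof. by move=> H By; exact: differentiable_continuous (H [::] y By). Qed.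

Lemma smooth_sub B B' f : B' `<=` B -> smooth_on B f -> smooth_on B' f.
Proof. by move=> BB H s x /BB; exact: H. Qed.

Lemma smooth_cst B c : open B -> smooth_on B (fun _ => c).
Proof. by move=> oB; apply: Ck_smooth => // k; exact: Ck_cst. Qed.

Lemma smooth_coord B i : open B -> smooth_on B (fun y => y 0 i).
Proof. by move=> oB; apply: Ck_smooth => // k; exact: Ck_coord. Qed.

Lemma smoothM B f g : open B -> smooth_on B f -> smooth_on B g ->
  smooth_on B (fun y => f y * g y).
Proof.
by move=> oB Hf Hg; apply: Ck_smooth => // k; apply: CkM; exact: smooth_Ck.
Qed.

Lemma smooth_sum B (I : Type) (r : seq I) (Q : pred I) (f : I -> 'rV[R]_n -> R) :
  open B -> (forall i, Q i -> smooth_on B (f i)) ->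
  smooth_on B (fun y => \sum_(i <- r | Q i) f i y).
Proof.
move=> oB H; apply: Ck_smooth => // k.
by apply: (@Ck_sum _ _ _ _ _ _ _ (fun i _ => f i)) => i Qi; exact: smooth_Ck (H i Qi).
Qed.

End Smooth.

Section Schwarz.
Variables (R : realType).

Lemma is_derive_translate (V : normedModType R) (f : V -> R) (a x v : V) (d : R) :
  is_derive (a + x) v f d -> is_derive x v (fun z => f (a + z)) d.
Proof.
move=> [d1 d2].
have E : (fun h : R => h^-1 *: ((f \o shift (a + x)) (h *: v) - f (a + x))) =
  (fun h : R => h^-1 *: (((fun z => f (a + z)) \o shift x) (h *: v) - f (a + x))).
  by rewrite funeqE => h /=; rewrite addrCA.
by split; rewrite /derivable /derive -E.
Qed.

Lemma second_difference (V : normedModType R) (f df ddf : V -> R) x v w (h : R) :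
    (forall a b : R, 0 <= a <= 1 -> 0 <= b <= 1 ->
      is_derive ((b * h) *: w + ((a * h) *: v + x)) v f (df ((b * h) *: w + ((a * h) *: v + x)))) ->
    (forall a b : R, 0 <= a <= 1 -> 0 <= b <= 1 ->
      is_derive ((b * h) *: w + ((a * h) *: v + x)) w df (ddf ((b * h) *: w + ((a * h) *: v + x)))) ->
  exists a b : R, [/\ 0 <= a <= 1, 0 <= b <= 1 &
    f (h *: w + (h *: v + x)) - f (h *: v + x) - (f (h *: w + x) - f x) =
    ddf ((b * h) *: w + ((a * h) *: v + x)) * h * h].
Proof.
move=> H1 H2.
have i0 : 0 <= (0 : R) <= 1 by rewrite lexx ler01.
have i1 : 0 <= (1 : R) <= 1 by rewrite lexx ler01.
have [u u01|a a01 ->] := @line_mvt R V (fun z => f (h *: w + z) - f z)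
    (fun z => df (h *: w + z) - df z) x v h.
  have ? : is_derive ((u * h) *: v + x) v (fun z => f (h *: w + z)) (df (h *: w + ((u * h) *: v + x))).
    by apply: is_derive_translate; have := H1 u 1 u01 i1; rewrite mul1r.
  have ? : is_derive ((u * h) *: v + x) v f (df ((u * h) *: v + x)).
    by have := H1 u 0 u01 i0; rewrite mul0r scale0r add0r.
  exact: is_deriveB.
have [b b01|b b01 ->] := @line_mvt R V df ddf ((a * h) *: v + x) w h; first exact: H2.
by exists a, b.
Qed.

Lemma dist_half_le (a1 a2 a3 e : R) :
  `|a1 - a3| <= e / 2 -> `|a2 - a3| <= e / 2 -> `|a1 - a2| <= e.
Proof. by rewrite !ler_norml => /andP[? ?] /andP[? ?]; apply/andP; split; lra. Qed.

Lemma smooth_partialC n (B : set 'rV[R]_n) (f : 'rV[R]_n -> R) i j x : open B ->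
  smooth_on B f -> B x -> partial i (partial j f) x = partial j (partial i f) x.
Proof.
move=> oB fs Bx; apply/eqP; rewrite -subr_eq0 -normr_le0; apply/ler_addgt0Pl => e e0.
have e2 : 0 < e / 2 by rewrite divr_gt0.
have [F FE] : exists F : 'I_n -> 'I_n -> 'rV[R]_n -> R, forall a b, F a b = partial a (partial b f).
  by exists (fun a b => partial a (partial b f)).
rewrite -!FE.
have Fc a b : \forall z \near x, `|F a b x - F a b z| <= e / 2.
  have /cvgrPdist_le/(_ _ e2) // : {for x, continuous (F a b)}.
  by rewrite FE; apply: (smooth_continuous (B := B)) => //; do 2 apply: smooth_on_partial.
have /nbhs_ballP[r /= r0 rP] : \forall z \near x,
    [/\ B z, `|F i j x - F i j z| <= e / 2 & `|F j i x - F j i z| <= e / 2].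
  have nB : nbhs x B := open_nbhs_nbhs (conj oB Bx).
  by apply: filterS3 nB (Fc i j) (Fc j i) => z ? ? ?; split.
have [h [h0 hr]] : exists h : R, 0 < h /\ h + h < r by exists (r / 3); split; lra.
have near_pt (p q : 'I_n) (a b : R) : 0 <= a <= 1 -> 0 <= b <= 1 ->
    ball x r ((b * h) *: delta_mx 0 q + ((a * h) *: delta_mx 0 p + x)).
  have ch (c : R) s : 0 <= c <= 1 -> `|c * h| * `|delta_mx 0 s : 'rV[R]_n| <= h.
    move=> /andP[c0 c1]; apply: le_trans (ler_wpM2l (normr_ge0 _) (rV_norm_delta R s)) _.
    have ch0 : 0 <= c * h by apply: mulr_ge0 => //; exact: ltW.
    by rewrite mulr1 (ger0_norm ch0) -[leRHS]mul1r ler_pM2r.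
  move=> a01 b01; rewrite -ball_normE /= distrC addrA addrK.
  apply: (@le_lt_trans _ _ (h + h)); last exact: hr.
  by apply: (le_trans (ler_normD _ _)); apply: lerD; rewrite normrZ; exact: ch.
have D (p q : 'I_n) : exists a b : R, [/\ 0 <= a <= 1, 0 <= b <= 1 &
    f (h *: delta_mx 0 q + (h *: delta_mx 0 p + x)) - f (h *: delta_mx 0 p + x)
      - (f (h *: delta_mx 0 q + x) - f x) =
    F q p ((b * h) *: delta_mx 0 q + ((a * h) *: delta_mx 0 p + x)) * h * h].
  apply: (@second_difference _ f (partial p f)) => a b a01 b01.
    by apply: (smooth_is_derive (B := B)) => //; have [] := rP _ (near_pt p q a b a01 b01).
  rewrite FE; apply: (smooth_is_derive (B := B)); first exact: smooth_on_partial.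
  by have [] := rP _ (near_pt p q a b a01 b01).
have [a [b [a01 b01 E1]]] := D i j; have [c [d [c01 d01 E2]]] := D j i.
have [_ _ K1] := rP _ (near_pt i j a b a01 b01).
have [_ K2 _] := rP _ (near_pt j i c d c01 d01).
have E : F j i ((b * h) *: delta_mx 0 j + ((a * h) *: delta_mx 0 i + x)) =
         F i j ((d * h) *: delta_mx 0 i + ((c * h) *: delta_mx 0 j + x)).
  apply: (mulIf (lt0r_neq0 h0)); apply: (mulIf (lt0r_neq0 h0)).
  have swap (a1 a2 a3 a4 : R) : a1 - a2 - (a3 - a4) = a1 - a3 - (a2 - a4) by ring.
  apply: etrans (esym E1) (etrans _ E2).
  by rewrite (addrCA (h *: delta_mx 0 j)) swap.
rewrite [e + 0]addr0; apply: (@dist_half_le (F i j x) (F j i x) _ e K2).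
by rewrite -E.
Qed.

End Schwarz.

(** * Ordinary differential equations *)

Section Calculus1.
Variable R : realType.

Lemma continuous_antiderivative (f : R -> R) : continuous f ->
  exists F : R -> R, F 0 = 0 /\ forall t : R, 0 <= t <= 1 -> is_derive t (1:R) F (f t).
Proof.
move=> cf.
have fi : (@lebesgue_measure R).-integrable `[(-1 : R), (2 : R)] (EFin \o f).
  by apply: continuous_compact_integrable; [exact: segment_compact|exact: continuous_subspaceT].
pose F := fun x : R => (\int[@lebesgue_measure R]_(t in `[(-1 : R), x]) f t)%R.
exists (fun x => F x - F 0); split; first by rewrite subrr.
move=> t /andP[t0 t1].
have t2 : t < 2 by lra.
have tm1 : -1 < t by lra.
have [d1 d2] := continuous_FTC1_closed t2 fi tm1 (cf t).
have ? : is_derive t (1:R) F (f t) by split=> //; rewrite -derive1E.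
by apply: is_derive_eq; rewrite subr0.
Qed.

Definition clamp (t : R) : R := Num.max 0 (Num.min t 1).

Lemma clamp_itv t : 0 <= clamp t <= 1.
Proof. by rewrite /clamp; apply/andP; rewrite le_max lexx ge_max ler01 ge_min lexx orbT. Qed.

Lemma clamp_id t : 0 <= t <= 1 -> clamp t = t.
Proof. by move=> /andP[t0 t1]; rewrite /clamp min_l// max_r. Qed.

Lemma clampK t : clamp (clamp t) = clamp t.
Proof. by rewrite clamp_id// clamp_itv. Qed.

Lemma clamp_continuous : continuous clamp.
Proof.
have -> : clamp = (fun=> 0 : R) \max (id \min (fun=> 1 : R)) by [].
apply: max_fun_continuous; first exact: cst_continuous.
by apply: min_fun_continuous; [move=> t; exact: cvg_id|exact: cst_continuous].
Qed.

Lemma increment_bound (f df : R -> R) (M : R) : continuous f -> 0 <= M ->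
    (forall t : R, 0 < t < 1 -> is_derive t (1:R) f (df t)) ->
    (forall t : R, 0 < t < 1 -> `|df t| <= M) ->
  forall t : R, 0 <= t <= 1 -> `|f t - f 0| <= M.
Proof.
move=> cf M0 fd dfM t /andP[t0 t1]; have [->|tn0] := eqVneq t 0.
  by rewrite subrr normr0.
have {tn0}t0 : 0 < t by rewrite lt_neqAle eq_sym tn0.
have [|||c] := @MVT R f df 0 t; [by []| | |].
- by move=> x; rewrite in_itv /= => /andP[x0 xt]; apply: fd; rewrite x0 (lt_le_trans xt).
- exact: continuous_subspaceT.
rewrite in_itv /= => /andP[c0 ct] ->; rewrite subr0 normrM -[leRHS]mulr1.
by apply: ler_pM => //; [apply: dfM; rewrite c0 (lt_le_trans ct)|rewrite gtr0_norm].
Qed.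

Lemma continuous_bounded01 (f : R -> R) : continuous f ->
  exists M : R, forall t, 0 <= t <= 1 -> f t <= M.
Proof.
move=> cf; have [|c _ cM] := @EVT_max R f 0 1 ler01; first exact: continuous_subspaceT.
by exists (f c) => t t01; apply: cM; rewrite in_itv.
Qed.

Lemma geometric_limit (x : nat -> R) (C : R) :
    (forall k, `|x k.+1 - x k| <= C / 2 ^+ k) ->
  exists l, forall k, `|x k - l| <= 2 * C / 2 ^+ k.
Proof.
move=> H.
have p2 k : 0 < 2 ^+ k :> R by rewrite exprn_gt0.
have C0 : 0 <= C by have := le_trans (normr_ge0 _) (H 0%N); rewrite expr0 divr1.
pose a k := x k - 2 * C / 2 ^+ k; pose b k := x k + 2 * C / 2 ^+ k.
have half k : 2 * C / 2 ^+ k.+1 = C / 2 ^+ k.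
  by rewrite exprS invfM mulrACA divff// mul1r.
have two k : 2 * C / 2 ^+ k = C / 2 ^+ k + C / 2 ^+ k by rewrite -mulrA mulr2n mulrDl !mul1r.
have Ha : {homo a : m n / (m <= n)%N >-> m <= n}.
  apply: homo_leq => [//|y z t|k]; first exact: le_trans.
  rewrite /a half two; have := H k; rewrite ler_norml => /andP[? ?]; lra.
have Hb : {homo b : m n / (m <= n)%N >-> n <= m}.
  apply: (@homo_leq _ _ (fun y z => z <= y)) => [//|y z t h1 h2|k]; first exact: le_trans h2 h1.
  rewrite /b half two; have := H k; rewrite ler_norml => /andP[? ?]; lra.
have ab m k : a m <= b k.
  have ab' l : a l <= b l.
    have h : 0 <= 2 * C / 2 ^+ l by rewrite divr_ge0 ?mulr_ge0 ?(ltW (p2 l)).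
    by rewrite /a /b lerD2l (le_trans _ h)// oppr_le0.
  apply: (le_trans (Ha _ _ (leq_maxl m k))); apply: (le_trans (ab' _)).
  exact: Hb (leq_maxr m k).
have hs : has_sup (range a).
  by split; [exists (a 0%N); exists 0%N|exists (b 0%N) => _ [m _ <-]; exact: ab].
exists (sup (range a)) => k.
have : a k <= sup (range a) by apply: sup_upper_bound => //; exists k.
have : sup (range a) <= b k.
  by apply: ge_sup; [exists (a 0%N); exists 0%N|move=> _ [m _ <-]; exact: ab].
by rewrite /a /b ler_norml => ? ?; apply/andP; split; lra.
Qed.

Lemma geometric_small (C e : R) : 0 <= C -> 0 < e -> exists k, 2 * C / 2 ^+ k <= e.
Proof.
move=> C0 e0; have := @near_infty_natSinv_expn_lt R (PosNum (divr_gt0 e0 (ltr_wpDl C0 ltr01))).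
move=> [k _ kP]; exists k.+1; have /= /ltW := kP _ (leqnn k).
rewrite div1r => h; rewrite exprS invfM mulrACA divff// mul1r.
apply: (le_trans (ler_wpM2l C0 h)); rewrite mulrCA ler_piMr ?(ltW e0)//.
by rewrite ler_pdivrMr ?mul1r ?ltr_wpDl// lerDl.
Qed.

End Calculus1.

Section ODE.
Variables (R : realType) (n : nat).
Implicit Types (w : R -> 'rV[R]_n) (G : R -> 'rV[R]_n -> 'rV[R]_n).

(* A solution of w' = G(t, w) on [0, 1], extended by constants. *)
Definition ode_sol G w : Prop :=
  [/\ continuous w, forall t, w t = w (clamp t) &
      forall t : R, 0 < t < 1 -> forall i, is_derive t (1:R) (fun s => w s 0 i) (G t (w t) 0 i)].

Lemma coord_path_continuous w i : continuous w -> continuous (fun t => w t 0 i).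
Proof.
move=> cw t; apply: (@continuous_comp _ _ _ w (fun v : 'rV[R]_n => v 0 i)).
  exact: cw.
exact: coord_continuous.
Qed.

(* The constant 3/4 < 1 replaces the usual exponential: all the fields integrated
   below are scaled so as to be 1/2-Lipschitz on the unit time interval. *)
Lemma gronwall w (D : R -> 'I_n -> R) (eta e : R) : 0 <= eta -> 0 <= e ->
    continuous w -> (forall t, w t = w (clamp t)) ->
    (forall t : R, 0 < t < 1 -> forall i, is_derive t (1:R) (fun s => w s 0 i) (D t i)) ->
    (forall t : R, 0 < t < 1 -> forall i, `|D t i| <= 3 / 4 * `|w t| + e) ->
    `|w 0| <= eta ->
  forall t, `|w t| <= 4 * (eta + e).
Proof.
move=> eta0 e0 cw wc wd Db w0.
have cn : continuous (fun t => `|w t|).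
  by move=> t; apply: (@continuous_comp _ _ _ w Num.norm); [exact: cw|exact: norm_continuous].
have [|c] := @EVT_max R (fun t => `|w t|) 0 1 ler01; first exact: continuous_subspaceT.
rewrite in_itv /= => c01 cM.
have cM' t : 0 <= t <= 1 -> `|w t| <= `|w c| by move=> t01; apply: cM; rewrite in_itv.
suff H : `|w c| <= 4 * (eta + e) by move=> t; rewrite wc (le_trans (cM' _ (clamp_itv t))).
have M0 : 0 <= 3 / 4 * `|w c| + e by rewrite addr_ge0// mulr_ge0// divr_ge0.
have inc i : `|w c 0 i - w 0 0 i| <= 3 / 4 * `|w c| + e.
  apply: (@increment_bound _ (fun t => w t 0 i) (D ^~ i)) => //.
  - exact: coord_path_continuous.
  - by move=> t t01; exact: wd.
  - move=> t t01; apply: (le_trans (Db t t01 i)); rewrite lerD2r ler_wpM2l// ?divr_ge0//.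
    by apply: cM'; case/andP: t01 => ? ?; rewrite !ltW.
have : `|w c| <= eta + (3 / 4 * `|w c| + e).
  apply: rV_norm_le => [|i]; first by rewrite addr_ge0.
  rewrite -[w c 0 i](subrK (w 0 0 i)) addrC; apply: (le_trans (ler_normD _ _)).
  by apply: lerD (inc i); exact: le_trans (rV_coord_le _ _) w0.
lra.
Qed.

Lemma gronwall_sub w1 w2 (D1 D2 : R -> 'I_n -> R) (eta e : R) : 0 <= eta -> 0 <= e ->
    continuous w1 -> (forall t, w1 t = w1 (clamp t)) ->
    continuous w2 -> (forall t, w2 t = w2 (clamp t)) ->
    (forall t : R, 0 < t < 1 -> forall i, is_derive t (1:R) (fun s => w1 s 0 i) (D1 t i)) ->
    (forall t : R, 0 < t < 1 -> forall i, is_derive t (1:R) (fun s => w2 s 0 i) (D2 t i)) ->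
    (forall t : R, 0 < t < 1 -> forall i,
       `|D1 t i - D2 t i| <= 3 / 4 * `|w1 t - w2 t| + e) ->
    `|w1 0 - w2 0| <= eta ->
  forall t, `|w1 t - w2 t| <= 4 * (eta + e).
Proof.
move=> eta0 e0 c1 k1 c2 k2 d1 d2 Db w0.
apply: (@gronwall (fun t => w1 t - w2 t) (fun t i => D1 t i - D2 t i)) => //.
- by move=> t; apply: continuousB; [exact: c1|exact: c2].
- by move=> t; rewrite k1 k2.
- move=> t t01 i; have ? := d1 t t01 i; have ? := d2 t t01 i.
  by under eq_fun do rewrite !mxE; exact: is_deriveB.
Qed.

Lemma picard_step (x0 : 'rV[R]_n) (g : R -> 'rV[R]_n) : continuous g ->
  exists w, [/\ continuous w, forall t, w t = w (clamp t), w 0 = x0 &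
    forall t : R, 0 < t < 1 -> forall i, is_derive t (1:R) (fun s => w s 0 i) (g t 0 i)].
Proof.
move=> cg.
have /choice[F FP] : forall i : 'I_n, exists F : R -> R, F 0 = 0 /\
    forall t : R, 0 <= t <= 1 -> is_derive t (1:R) F (g t 0 i).
  by move=> i; apply: (@continuous_antiderivative _ (fun t => g t 0 i)); exact: coord_path_continuous.
exists (fun t => \row_i (x0 0 i + F i (clamp t))); split=> [t|t||t t01 i].
- apply: rV_continuous => i; rewrite /prop_for; under eq_fun do rewrite mxE.
  apply: (@continuousD _ _ _ (fun=> x0 0 i) (fun t => F i (clamp t))).
    exact: cst_continuous.
  apply: continuous_comp; first exact: clamp_continuous.
  by have [_ /(_ _ (clamp_itv t))/is_derive_continuous] := FP i.
- by rewrite clampK.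
- by apply/rowP => i; rewrite mxE clamp_id ?lexx ?ler01//; have [-> _] := FP i; rewrite addr0.
- under eq_fun do rewrite mxE.
  have t01' : 0 <= t <= 1 by case/andP: t01 => ? ?; rewrite !ltW.
  have [_ /(_ t t01') ?] := FP i.
  have D : is_derive t (1:R) (fun s => x0 0 i + F i s) (g t 0 i).
    rewrite -[g t 0 i]add0r; exact: (@is_deriveD _ _ _ (cst (x0 0 i)) (F i)).
  apply: near_eq_is_derive D.
  have : nbhs t [set` `]0, 1[%R] by apply: near_in_itvoo; rewrite in_itv.
  apply: filterS => s /=; rewrite in_itv /= => /andP[s0 s1].
  by rewrite clamp_id// !ltW.
Qed.

Lemma ode_exists G (x0 : 'rV[R]_n) :
    (forall w, continuous w -> continuous (fun t => G t (w t))) ->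
    (forall (t : R) x y i, 0 < t < 1 -> `|G t x 0 i - G t y 0 i| <= 2^-1 * `|x - y|) ->
  exists w, ode_sol G w /\ w 0 = x0.
Proof.
move=> cG lG.
pose step_spec w w' := continuous w -> [/\ continuous w', forall t, w' t = w' (clamp t),
  w' 0 = x0 & forall t : R, 0 < t < 1 -> forall i,
    is_derive t (1:R) (fun s => w' s 0 i) (G t (w t) 0 i)].
have /choice[S SP] : forall w, exists w', step_spec w w'.
  move=> w; have [cw|ncw] := pselect (continuous w); last by exists w.
  by have [w' ?] := picard_step x0 (cG _ cw); exists w'.
have Sc w : continuous w -> continuous (S w) by move=> /SP[].
have contr w1 w2 e : continuous w1 -> continuous w2 -> 0 <= e ->
    (forall t, `|w1 t - w2 t| <= e) -> forall t, `|S w1 t - S w2 t| <= e / 2.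
  move=> c1 c2 e0 He t; have [k1 k2 k3 k4] := SP _ c1; have [l1 l2 l3 l4] := SP _ c2.
  rewrite k2 l2; apply: rV_norm_le => [|i]; first by rewrite divr_ge0.
  rewrite !mxE; have := @increment_bound R (fun t => S w1 t 0 i - S w2 t 0 i)
    (fun t => G t (w1 t) 0 i - G t (w2 t) 0 i) (e / 2).
  rewrite k3 l3 subrr => /(_ _ _ _ _ _ (clamp_itv t)); rewrite subr0; apply.
  - by move=> s; apply: continuousB; exact: coord_path_continuous.
  - by rewrite divr_ge0.
  - by move=> s s01; have ? := k4 s s01 i; have ? := l4 s s01 i; exact: is_deriveB.
  - move=> s s01; apply: (le_trans (lG _ _ _ _ s01)).
    by rewrite mulrC ler_wpM2r// invr_ge0.
pose u k := iter k S (fun=> x0).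
have cu k : continuous (u k) by elim: k => [|k IH]; [exact: cst_continuous|exact: Sc].
have [C [C0 CP]] : exists C : R, 0 <= C /\ forall t, `|u 1%N t - u 0%N t| <= C.
  have [|M MP] := @continuous_bounded01 R (fun t => `|u 1%N t - x0|).
    move=> t; apply: (@continuous_comp _ _ _ (fun t => u 1%N t - x0) Num.norm).
      by apply: (@continuousB _ _ _ (u 1%N) (fun=> x0)); [exact: (cu 1%N)|exact: cst_continuous].
    exact: norm_continuous.
  have H t : `|u 1%N t - u 0%N t| <= M.
    by have [_ k2 _ _] := SP _ (cu 0%N); rewrite [u 1%N]/= k2; apply: MP; exact: clamp_itv.
  by exists M; split=> //; exact: le_trans (normr_ge0 _) (H 0).
have p2 k : 0 < 2 ^+ k :> R by rewrite exprn_gt0.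
have dist k t : `|u k.+1 t - u k t| <= C / 2 ^+ k.
  elim: k t => [|k IH] t; first by rewrite expr0 divr1.
  rewrite exprSr invfM mulrA; apply: (contr (u k.+1) (u k)) => //.
  by rewrite divr_ge0// ltW.
have /choice[ul ulP] : forall t, exists y : 'rV[R]_n, forall k, `|u k t - y| <= 2 * C / 2 ^+ k.
  move=> t.
  have /choice[l lP] : forall i, exists l, forall k, `|u k t 0 i - l| <= 2 * C / 2 ^+ k.
    move=> i; apply: geometric_limit => k; apply: le_trans (dist k t).
    by have := rV_coord_le (u k.+1 t - u k t) i; rewrite !mxE.
  exists (\row_i l i) => k; apply: rV_norm_le => [|i]; last by rewrite !mxE lP.
  by rewrite divr_ge0 ?mulr_ge0 ?(ltW (p2 k)).
have small (e : R) : 0 < e -> exists k, 2 * C / 2 ^+ k <= e by exact: geometric_small.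
have cul : continuous ul.
  move=> t; apply/cvgrPdist_le => e e0.
  have e4 : 0 < e / 4 by rewrite divr_gt0.
  have [k kP] := small _ e4; have /cvgrPdist_le/(_ _ e4) := cu k t.
  apply: filterS => s hs.
  have -> : ul t - ul s = - (u k t - ul t) + ((u k t - u k s) + (u k s - ul s)).
    by rewrite opprB !addrA !subrK.
  apply: (le_trans (ler_normD _ _)); rewrite normrN.
  have := ler_normD (u k t - u k s) (u k s - ul s).
  have := le_trans (ulP t k) kP; have := le_trans (ulP s k) kP; lra.
have fixp t : S ul t = ul t.
  apply/eqP; rewrite -subr_eq0 -normr_le0; apply/ler_addgt0Pl => e e0; rewrite addr0.
  have [k kP] := small _ (divr_gt0 e0 (ltr0n _ 2)).
  have e2 : 0 <= 2 * C / 2 ^+ k by rewrite divr_ge0 ?mulr_ge0 ?(ltW (p2 k)).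
  have h1 := @contr (u k) ul _ (cu k) cul e2 (fun t => ulP t k) t.
  have h2 := ulP t k.+1.
  have -> : S ul t - ul t = - (u k.+1 t - S ul t) + (u k.+1 t - ul t).
    by rewrite opprB !addrA subrK.
  apply: (le_trans (ler_normD _ _)); rewrite normrN.
  have half : 2 * C / 2 ^+ k.+1 = (2 * C / 2 ^+ k) / 2 by rewrite exprSr invfM mulrA.
  move: h1 h2; rewrite half -[S (u k) t]/(u k.+1 t); lra.
have [k1 k2 k3 k4] := SP _ cul; exists (S ul); split=> //; split=> // t t01 i.
by rewrite fixp; exact: k4.
Qed.

End ODE.

Section UniformlySmall.
Variables (R : realType) (H : Type) (F : set_system H).
Context {FF : Filter F}.
Implicit Types Z Y : H -> R -> R.

Definition unif_small Z : Prop :=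
  forall e : R, 0 < e -> \forall h \near F, forall t, 0 <= t <= 1 -> `|Z h t| <= e.

Definition unif_bounded Y : Prop :=
  exists M : R, \forall h \near F, forall t, 0 <= t <= 1 -> `|Y h t| <= M.

Lemma unif_smallD Z1 Z2 : unif_small Z1 -> unif_small Z2 ->
  unif_small (fun h t => Z1 h t + Z2 h t).
Proof.
move=> s1 s2 e e0; have e2 : 0 < e / 2 by rewrite divr_gt0.
apply: filterS2 (s1 _ e2) (s2 _ e2) => h h1 h2 t t01.
by rewrite (splitr e) (le_trans (ler_normD _ _))// lerD ?h1 ?h2.
Qed.

Lemma unif_small0 : unif_small (fun _ _ => 0).
Proof. by move=> e e0; apply: nearW => h t _; rewrite normr0 ltW. Qed.

Lemma unif_small_sum (I : Type) (r : seq I) (Q : pred I) (Z : I -> H -> R -> R) :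
  (forall i, Q i -> unif_small (Z i)) -> unif_small (fun h t => \sum_(i <- r | Q i) Z i h t).
Proof.
move=> s; elim: r => [|i r IH].
  by under eq_fun do under eq_fun do rewrite big_nil; exact: unif_small0.
under eq_fun do under eq_fun do rewrite big_cons.
by case Qi : (Q i) => //; apply: unif_smallD IH; exact: s.
Qed.

Lemma unif_smallM Z Y : unif_small Z -> unif_bounded Y -> unif_small (fun h t => Z h t * Y h t).
Proof.
move=> s [M bM] e e0.
have M0 : 0 < `|M| + 1 by rewrite ltr_wpDl.
apply: filterS2 (s _ (divr_gt0 e0 M0)) bM => h h1 h2 t t01.
rewrite normrM; apply: (@le_trans _ _ (e / (`|M| + 1) * `|M|)).
  by apply: ler_pM => //; [exact: h1|rewrite (le_trans (h2 t t01))// ler_norm].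
by rewrite -mulrA ler_piMr// ?(ltW e0)// mulrC ler_pdivrMr// mul1r lerDl.
Qed.

Lemma unif_bounded_fixed (y : R -> R) : continuous y -> unif_bounded (fun _ => y).
Proof.
move=> cy; have [|M MP] := @continuous_bounded01 R (fun t => `|y t|).
  by move=> t; apply: (@continuous_comp _ _ _ y Num.norm); [exact: cy|exact: norm_continuous].
by exists M; apply: nearW => h; exact: MP.
Qed.

Lemma unif_small_bounded Y (y : R -> R) : unif_small (fun h t => Y h t - y t) -> continuous y ->
  unif_bounded Y.
Proof.
move=> s /unif_bounded_fixed[M MP]; exists (1 + M).
apply: filterS2 (s _ ltr01) MP => h h1 h2 t t01.
by rewrite -[Y h t](subrK (y t)) (le_trans (ler_normD _ _))// lerD ?h1 ?h2.
Qed.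

Lemma perturbation_le n (d : H -> R -> 'rV[R]_n) (D : 'I_n -> H -> R -> R) :
    (forall e : R, 0 < e -> \forall h \near F, [/\ continuous (d h),
      forall t, d h t = d h (clamp t),
      forall t : R, 0 < t < 1 -> forall i, is_derive t (1:R) (fun s => d h s 0 i) (D i h t) &
      forall t : R, 0 < t < 1 -> forall i, `|D i h t| <= 3 / 4 * `|d h t| + e ]) ->
    (forall e : R, 0 < e -> \forall h \near F, `|d h 0| <= e) ->
  forall e : R, 0 < e -> \forall h \near F, forall t, `|d h t| <= e.
Proof.
move=> dP d0 e e0; have e8 : 0 < e / 8 by rewrite divr_gt0.
apply: filterS2 (dP _ e8) (d0 _ e8) => h [h1 h2 h3 h4] h6 t.
have -> : e = 4 * (e / 8 + e / 8) by lra.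
by apply: (@gronwall _ _ (d h) (fun t i => D i h t)) => //; exact: ltW.
Qed.

Lemma perturbation n (d : H -> R -> 'rV[R]_n) (D Z : 'I_n -> H -> R -> R) :
    (\forall h \near F, [/\ continuous (d h), forall t, d h t = d h (clamp t),
      forall t : R, 0 < t < 1 -> forall i, is_derive t (1:R) (fun s => d h s 0 i) (D i h t) &
      forall t : R, 0 < t < 1 -> forall i, `|D i h t| <= 3 / 4 * `|d h t| + `|Z i h t| ]) ->
    (forall i, unif_small (Z i)) ->
    (forall e : R, 0 < e -> \forall h \near F, `|d h 0| <= e) ->
  forall e : R, 0 < e -> \forall h \near F, forall t, `|d h t| <= e.
Proof.
move=> dP s d0; apply: (perturbation_le (D := D)) => // e e0.
have s' : \forall h \near F, forall i, forall t, 0 <= t <= 1 -> `|Z i h t| <= e.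
  by apply: filter_forall => i; exact: s.
apply: filterS2 dP s' => h [h1 h2 h3 h4] h5; split=> // t t01 i.
apply: (le_trans (h4 t t01 i)); rewrite lerD2l; apply: h5.
by case/andP: t01 => ? ?; rewrite !ltW.
Qed.

End UniformlySmall.

Lemma dot_le (R : realType) n (a : 'I_n -> R) (x : 'rV[R]_n) (c : R) :
  \sum_l `|a l| <= c -> `|\sum_l a l * x 0 l| <= c * `|x|.
Proof.
move=> ac; apply: (le_trans (ler_norm_sum _ _ _)).
apply: (@le_trans _ _ (\sum_l `|a l| * `|x|)).
  by apply: ler_sum => l _; rewrite normrM ler_wpM2l// rV_coord_le.
by rewrite -mulr_suml ler_wpM2r.
Qed.

Section Families.
Variables (R : realType) (q : nat).
Implicit Types (B : set 'rV[R]_q) (u : R -> 'rV[R]_q -> R).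

Local Notation "''e_' i" := (delta_mx 0 i) (at level 8, i at level 2).

Lemma tube u (y0 : 'rV[R]_q) : (forall t, {for (t, y0), continuous (fun z : R * 'rV[R]_q => u z.1 z.2)}) ->
  unif_small (nbhs y0) (fun y t => u t y - u t y0).
Proof.
move=> c e e0.
have : compact (`[0, 1]%classic : set R) by exact: segment_compact.
move=> /compact_near_coveringP K.
have : \forall y \near y0, `[0, 1]%classic `<=` (fun t => `|u t y - u t y0| <= e).
  apply: (K _ (nbhs y0) (fun y t => `|u t y - u t y0| <= e)) => t _; have e2 : 0 < e / 2 by rewrite divr_gt0.
  have /cvgrPdist_le/(_ _ e2) ct := c t.
  have ct0 : \forall s \near t, `|u t y0 - u s y0| <= e / 2.
    have : (fun s : R => (s, y0)) @ t --> (t, y0).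
      by apply: pair_continuous; [exact: cvg_id|exact: cst_continuous].
    by move=> /(_ _ ct).
  have ct0' : \forall z \near (t, y0), `|u t y0 - u z.1 y0| <= e / 2.
    have : (fst : R * 'rV[R]_q -> R) @ (t, y0) --> t by exact: cvg_fst.
    by move=> /(_ _ ct0).
  apply: filterS2 ct ct0' => -[s y] /= h1 h2.
  rewrite distrC; apply: dist_half_le; last by rewrite distrC; exact: h1.
  by rewrite distrC.
by apply: filterS => y h t t01; apply: h; rewrite /= in_itv.
Qed.

Lemma joint_continuity n (w : R -> 'rV[R]_q -> 'rV[R]_n) (y0 : 'rV[R]_q) :
    continuous (w ^~ y0) ->
    (forall e : R, 0 < e -> \forall y \near y0, forall t, `|w t y - w t y0| <= e) ->
  forall t i, {for (t, y0), continuous (fun z : R * 'rV[R]_q => w z.1 z.2 0 i)}.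
Proof.
move=> cw eq t i; apply/cvgrPdist_le => e e0.
have e2 : 0 < e / 2 by rewrite divr_gt0.
have h1 : \forall z \near (t, y0), forall s, `|w s z.2 - w s y0| <= e / 2.
  have : (snd : R * 'rV[R]_q -> _) @ (t, y0) --> y0 by exact: cvg_snd.
  by move=> /(_ _ (eq _ e2)).
have h2 : \forall z \near (t, y0), `|w t y0 - w z.1 y0| <= e / 2.
  have : (fst : R * 'rV[R]_q -> R) @ (t, y0) --> t by exact: cvg_fst.
  by have /cvgrPdist_le/(_ _ e2) h := cw t; move=> /(_ _ h).
apply: filterS2 h1 h2 => -[s y] /= h1 h2.
apply: (@dist_half_le _ _ _ (w s y0 0 i)).
  by apply: le_trans h2; have := rV_coord_le (w t y0 - w s y0) i; rewrite !mxE.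
by apply: le_trans (h1 s); have := rV_coord_le (w s y - w s y0) i; rewrite !mxE.
Qed.

Lemma line_cvg j (y0 : 'rV[R]_q) : (fun h : R => h *: 'e_j + y0) @ 0^' --> y0.
Proof.
have : (fun h : R => h *: ('e_j : 'rV[R]_q) + y0) @ (0 : R) --> y0.
  have : {for (0:R), continuous (fun h : R => h *: ('e_j : 'rV[R]_q) + y0)}.
    apply: (@continuousD _ _ _ (fun h : R => h *: ('e_j : 'rV[R]_q)) (fun=> y0)).
      exact: scalel_continuous.
    exact: cst_continuous.
  by rewrite /prop_for /continuous_at scale0r add0r.
by apply: cvg_trans; apply: cvg_app; exact: nbhs_dnbhs.
Qed.

Lemma quotient_unif_small B u j y0 : open B -> Ck 1 B u -> B y0 ->
  unif_small (0 : R)^' (fun h t => h^-1 * (u t (h *: 'e_j + y0) - u t y0) - partial j (u t) y0).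
Proof.
move=> oB Hu By0 e e0.
have Hp := Ck_partial j oB Hu.
have cp t : {for (t, y0), continuous (fun z : R * 'rV[R]_q => partial j (u z.1) z.2)}.
  exact: (Ck_continuous Hp By0).
have nB : nbhs y0 B := open_nbhs_nbhs (conj oB By0).
have /nbhs_ballP[r /= r0 rP] : \forall y \near y0,
    (forall t, 0 <= t <= 1 -> `|partial j (u t) y - partial j (u t) y0| <= e) /\ B y.
  exact: filterI (@tube (fun t => partial j (u t)) y0 cp e e0) nB.
near=> h => t t01.
have h0 : h != 0 by near: h; exact: nbhs_dnbhs_neq.
have hr : `|h| < r by near: h; exact: dnbhs0_lt.
have inb (a : R) : 0 <= a <= 1 -> ball y0 r ((a * h) *: 'e_j + y0).
  move=> /andP[a0 a1]; rewrite -ball_normE /= distrC addrK normrZ.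
  apply: le_lt_trans hr; rewrite -[leRHS]mulr1; apply: ler_pM => //; last exact: rV_norm_delta.
  by rewrite normrM ger0_norm// ler_piMl.
have [a a01|a a01 E] := @line_mvt R _ (u t) (partial j (u t)) y0 'e_j h.
  by apply: (Ck_is_derive j t Hu); have [] := rP _ (inb a a01).
rewrite E mulrCA mulVf// mulr1.
by have [/(_ t t01)] := rP _ (inb a a01).
Unshelve. all: by end_near. Qed.

(* For a family w of solutions, v will be a solution of the linearized equation and
   the hypothesis a Gronwall estimate. *)
Lemma family_is_derive n (w : R -> 'rV[R]_q -> 'rV[R]_n) (v : R -> 'rV[R]_n) j y0 :
    (forall e : R, 0 < e -> \forall h \near (0 : R)^',
       forall t, `|h^-1 *: (w t (h *: 'e_j + y0) - w t y0) - v t| <= e) ->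
  forall t i, is_derive y0 'e_j (fun y => w t y 0 i) (v t 0 i).
Proof.
move=> H t i.
have c : (fun h : R => h^-1 *: (((fun y => w t y 0 i) \o shift y0) (h *: 'e_j) - w t y0 0 i))
    @ 0^' --> v t 0 i.
  apply/cvgrPdist_le => e e0; apply: filterS (H e e0) => h /(_ t) h1.
  rewrite distrC; apply: le_trans h1.
  by have := rV_coord_le (h^-1 *: (w t (h *: 'e_j + y0) - w t y0) - v t) i; rewrite !mxE.
by split; [apply/cvg_ex; exists (v t 0 i)|exact: cvg_lim c].
Qed.

Lemma Ck_continuous_time k B u y : Ck k B u -> B y -> continuous (u ^~ y).
Proof.
move=> Hu By t; apply: (@continuous_comp _ _ _ (fun t => (t, y)) (fun z : R * 'rV[R]_q => u z.1 z.2)).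
  by apply: pair_continuous; [exact: cvg_id|exact: cst_continuous].
exact: (Ck_continuous Hu By).
Qed.

End Families.

Lemma sum_combo (R : realType) n (f1 f2 f3 f4 f5 f6 : 'I_n -> R) (h b1 b2 b3 b4 : R) :
    (forall l, h * (f1 l - f2 l) - f3 l - f4 l = f5 l + f6 l) -> h * (b1 - b2) - b3 = b4 ->
  h * ((\sum_l f1 l + b1) - (\sum_l f2 l + b2)) - (\sum_l f3 l + (\sum_l f4 l + b3)) =
  \sum_l f5 l + (\sum_l f6 l + b4).
Proof.
move=> H <-; rewrite [RHS]addrA -big_split/=.
under [X in _ = X + _]eq_bigr do rewrite -H.
by rewrite !sumrB -mulr_sumr sumrB; ring.
Qed.

Section LinearFamilies.
Variables (R : realType) (q n : nat) (B : set 'rV[R]_q).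
Hypothesis oB : open B.
Implicit Types (A : 'I_n -> 'I_n -> R -> 'rV[R]_q -> R) (b : 'I_n -> R -> 'rV[R]_q -> R).
Implicit Types (w : R -> 'rV[R]_q -> 'rV[R]_n).

Local Notation "''e_' i" := (delta_mx 0 i) (at level 8, i at level 2).

Definition lin_rhs A b (y : 'rV[R]_q) (t : R) (x : 'rV[R]_n) : 'rV[R]_n :=
  \row_i (\sum_l A i l t y * x 0 l + b i t y).

Lemma lin_exists A b y x0 : B y ->
    (forall i l, Ck 0 B (A i l)) -> (forall i, Ck 0 B (b i)) ->
    (forall (t : R) i, 0 < t < 1 -> \sum_l `|A i l t y| <= 2^-1) ->
  exists w : R -> 'rV[R]_n, ode_sol (lin_rhs A b y) w /\ w 0 = x0.
Proof.
move=> By HA Hb A2; apply: ode_exists => [w cw t|t x z i t01].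
  apply: rV_continuous => i; rewrite /prop_for; under eq_fun do rewrite mxE.
  apply: (@continuousD _ _ _ (fun t => \sum_l A i l t y * w t 0 l) (fun t => b i t y)).
    apply: continuous_sumr => l _.
    apply: (@continuousM _ _ (fun t => A i l t y) (fun t => w t 0 l)).
      exact: (Ck_continuous_time (HA i l) By).
    exact: coord_path_continuous.
  exact: (Ck_continuous_time (Hb i) By).
rewrite !mxE opprD addrACA subrr addr0 -sumrB.
rewrite (eq_bigr (fun l => A i l t y * (x - z) 0 l)); first exact: dot_le (A2 t i t01).
by move=> l _; rewrite !mxE mulrBr.
Qed.

Lemma lin_continuous A b w y0 : B y0 ->
    (forall i l, Ck 0 B (A i l)) -> (forall i, Ck 0 B (b i)) ->
    (forall (t : R) y i, B y -> 0 < t < 1 -> \sum_l `|A i l t y| <= 2^-1) ->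
    (forall i, Ck 0 B (fun _ y => w 0 y 0 i)) ->
    (forall y, B y -> ode_sol (lin_rhs A b y) (w ^~ y)) ->
  forall e : R, 0 < e -> \forall y \near y0, forall t, `|w t y - w t y0| <= e.
Proof.
move=> By0 HA Hb A2 H0 Hw.
have [c0 k0 d0] := Hw y0 By0.
pose Z i y t := \sum_l (A i l t y - A i l t y0) * w t y0 0 l + (b i t y - b i t y0).
apply: (@perturbation _ _ (nbhs y0) _ n (fun y t => w t y - w t y0)
  (fun i y t => lin_rhs A b y t (w t y) 0 i - lin_rhs A b y0 t (w t y0) 0 i) Z).
- have nB : nbhs y0 B := open_nbhs_nbhs (conj oB By0).
  apply: filterS nB => y By; have [c k d] := Hw y By; split.
  + by move=> t; apply: (@continuousB _ _ _ (w ^~ y) (w ^~ y0)); [exact: c|exact: c0].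
  + by move=> t; rewrite k k0.
  + move=> t t01 i; have ? := d t t01 i; have ? := d0 t t01 i.
    by under eq_fun do rewrite !mxE; exact: is_deriveB.
  + move=> t t01 i; rewrite !mxE.
    have -> : \sum_l A i l t y * w t y 0 l + b i t y - (\sum_l A i l t y0 * w t y0 0 l + b i t y0)
      = \sum_l A i l t y * (w t y - w t y0) 0 l + Z i y t.
      have := @sum_combo _ n (fun l => A i l t y * w t y 0 l) (fun l => A i l t y0 * w t y0 0 l)
        (fun=> 0) (fun=> 0) (fun l => A i l t y * (w t y - w t y0) 0 l)
        (fun l => (A i l t y - A i l t y0) * w t y0 0 l) 1 (b i t y) (b i t y0) 0
        (b i t y - b i t y0).
      rewrite !big1_eq !mul1r !add0r !subr0; apply=> // l.
      by rewrite !mxE; ring.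
    apply: (le_trans (ler_normD _ _)); rewrite lerD2r.
    apply: (le_trans (dot_le _ (A2 t y i By t01))); rewrite ler_wpM2r//; lra.
- move=> i; apply: unif_smallD; last first.
    by apply: (@tube _ _ (b i)) => t; exact: (Ck_continuous (Hb i) By0).
  apply: unif_small_sum => l _; apply: unif_smallM.
    by apply: (@tube _ _ (A i l)) => t; exact: (Ck_continuous (HA i l) By0).
  by apply: (@unif_bounded_fixed _ _ _ _ (fun t => w t y0 0 l)); exact: coord_path_continuous.
- move=> e e0.
  have fn i : \forall y \near y0, `|w 0 y0 0 i - w 0 y 0 i| <= e.
    have : {for y0, continuous (fun y => w 0 y 0 i)}.
      exact: (@Ck_continuous_at _ _ _ _ (fun _ y => w 0 y 0 i) 0 _ (H0 i) By0).
    by move=> /cvgrPdist_le/(_ _ e0).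
  apply: filterS (filter_forall _ fn) => y h; apply: rV_norm_le => [|i]; first exact: ltW.
  by rewrite !mxE distrC.
Qed.

Lemma lin_Ck0 A b w :
    (forall i l, Ck 0 B (A i l)) -> (forall i, Ck 0 B (b i)) ->
    (forall (t : R) y i, B y -> 0 < t < 1 -> \sum_l `|A i l t y| <= 2^-1) ->
    (forall i, Ck 0 B (fun _ y => w 0 y 0 i)) ->
    (forall y, B y -> ode_sol (lin_rhs A b y) (w ^~ y)) ->
  forall i, Ck 0 B (fun t y => w t y 0 i).
Proof.
move=> HA Hb A2 H0 Hw i; split=> // t y By.
apply: joint_continuity; first by have [] := Hw y By.
exact: (lin_continuous By HA Hb A2 H0 Hw).
Qed.

Lemma lin_is_derive A b w j y0 (v : R -> 'rV[R]_n) : B y0 ->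
    (forall i l, Ck 1 B (A i l)) -> (forall i, Ck 1 B (b i)) ->
    (forall (t : R) y i, B y -> 0 < t < 1 -> \sum_l `|A i l t y| <= 2^-1) ->
    (forall i, Ck 1 B (fun _ y => w 0 y 0 i)) ->
    (forall y, B y -> ode_sol (lin_rhs A b y) (w ^~ y)) ->
    ode_sol (lin_rhs A (fun i t y => \sum_l partial j (A i l t) y * w t y 0 l + partial j (b i t) y) y0) v ->
    (forall i, v 0 0 i = partial j (fun y => w 0 y 0 i) y0) ->
  forall t i, is_derive y0 'e_j (fun y => w t y 0 i) (v t 0 i).
Proof.
move=> By0 HA Hb A2 H0 Hw [cv kv dv] v0.
have HA0 i l : Ck 0 B (A i l) := Ck_S (HA i l).
have Hb0 i : Ck 0 B (b i) := Ck_S (Hb i).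
have H00 i : Ck 0 B (fun _ y => w 0 y 0 i) := Ck_S (H0 i).
have wc := lin_continuous By0 HA0 Hb0 A2 H00 Hw.
have [c0 k0 d0] := Hw y0 By0.
pose yh (h : R) := h *: ('e_j : 'rV[R]_q) + y0.
have yhc : yh @ (0 : R)^' --> y0 by exact: line_cvg.
pose c i t := \sum_l partial j (A i l t) y0 * w t y0 0 l + partial j (b i t) y0.
pose Z i (h t : R) := \sum_l ((h^-1 * (A i l t (yh h) - A i l t y0) - partial j (A i l t) y0) * w t (yh h) 0 l
    + (w t (yh h) 0 l - w t y0 0 l) * partial j (A i l t) y0)
  + (h^-1 * (b i t (yh h) - b i t y0) - partial j (b i t) y0).
apply: family_is_derive.
apply: (@perturbation _ _ (0 : R)^' _ n (fun h t => h^-1 *: (w t (yh h) - w t y0) - v t)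
  (fun i h t => h^-1 * (lin_rhs A b (yh h) t (w t (yh h)) 0 i - lin_rhs A b y0 t (w t y0) 0 i)
    - (\sum_l A i l t y0 * v t 0 l + c i t)) Z).
- have nB : nbhs y0 B := open_nbhs_nbhs (conj oB By0).
  have : \forall h \near (0 : R)^', B (yh h) by exact: yhc nB.
  apply: filterS => h By; have [c1 k1 d1] := Hw (yh h) By; split.
  + move=> t; apply: (@continuousB _ _ _ (fun t => h^-1 *: (w t (yh h) - w t y0)) v); last exact: cv.
    apply: (@continuous_comp _ _ _ (fun t => w t (yh h) - w t y0) (fun x => h^-1 *: x)).
      2: exact: scaler_continuous.
    by apply: (@continuousB _ _ _ (w ^~ (yh h)) (w ^~ y0)); [exact: c1|exact: c0].
  + by move=> t; rewrite k1 k0 kv.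
  + move=> t t01 i; have D1 := d1 t t01 i; have D2 := d0 t t01 i; have D3 := dv t t01 i.
    have -> : (fun s => (h^-1 *: (w s (yh h) - w s y0) - v s) 0 i) =
      (fun s => h^-1 *: (w s (yh h) 0 i - w s y0 0 i) - v s 0 i).
      by apply/funext => s; rewrite !mxE.
    have D4 : is_derive t (1:R) (fun s => h^-1 *: (w s (yh h) 0 i - w s y0 0 i))
      (h^-1 *: (lin_rhs A b (yh h) t (w t (yh h)) 0 i - lin_rhs A b y0 t (w t y0) 0 i)).
      exact: is_deriveZ.
    by apply: is_derive_eq; rewrite [X in _ - X]mxE.
  + move=> t t01 i; rewrite !mxE.
    have -> : h^-1 * ((\sum_l A i l t (yh h) * w t (yh h) 0 l + b i t (yh h)) -
        (\sum_l A i l t y0 * w t y0 0 l + b i t y0)) - (\sum_l A i l t y0 * v t 0 l + c i t)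
      = \sum_l A i l t y0 * (h^-1 *: (w t (yh h) - w t y0) - v t) 0 l + Z i h t.
      by apply: sum_combo => // l; rewrite !mxE; ring.
    apply: (le_trans (ler_normD _ _)); rewrite lerD2r.
    apply: (le_trans (dot_le _ (A2 t y0 i By0 t01))); rewrite ler_wpM2r//; lra.
- have ws l : unif_small (0 : R)^' (fun h t => w t (yh h) 0 l - w t y0 0 l).
    move=> e e0; have Q : \forall h \near (0 : R)^', forall t, `|w t (yh h) - w t y0| <= e.
      exact: yhc _ (wc e e0).
    apply: filterS Q => h hw t _.
    by apply: le_trans (hw t); have := rV_coord_le (w t (yh h) - w t y0) l; rewrite !mxE.
  move=> i; apply: unif_smallD; last exact: (quotient_unif_small j oB (Hb i) By0).
  apply: unif_small_sum => l _; apply: unif_smallD; apply: unif_smallM.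
  + exact: (quotient_unif_small j oB (HA i l) By0).
  + apply: unif_small_bounded (ws l) _; exact: coord_path_continuous.
  + exact: ws.
  + apply: (@unif_bounded_fixed _ _ _ _ (fun t => partial j (A i l t) y0)).
    exact: (Ck_continuous_time (Ck_partial j oB (HA i l)) By0).
- move=> e e0.
  have fn i : \forall h \near (0:R)^', forall t : R, 0 <= t <= 1 ->
      `|h^-1 * (w 0 (yh h) 0 i - w 0 y0 0 i) - partial j (fun y => w 0 y 0 i) y0| <= e.
    exact: (quotient_unif_small j oB (H0 i) By0 e0).
  apply: filterS (filter_forall _ fn) => h hw; apply: rV_norm_le => [|i]; first exact: ltW.
  by rewrite !mxE v0; apply: (hw i 0); rewrite lexx ler01.
Qed.

Theorem lin_Ck k A b w :
    (forall i l, Ck k B (A i l)) -> (forall i, Ck k B (b i)) ->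
    (forall (t : R) y i, B y -> 0 < t < 1 -> \sum_l `|A i l t y| <= 2^-1) ->
    (forall i, Ck k B (fun _ y => w 0 y 0 i)) ->
    (forall y, B y -> ode_sol (lin_rhs A b y) (w ^~ y)) ->
  forall i, Ck k B (fun t y => w t y 0 i).
Proof.
move=> + + A2; elim: k b w => [|k IH] b w HA Hb H0 Hw.
  exact: lin_Ck0 HA Hb A2 H0 Hw.
have HAk i l : Ck k B (A i l) := Ck_S (HA i l).
have wk := IH b w HAk (fun i => Ck_S (Hb i)) (fun i => Ck_S (H0 i)) Hw.
pose c j i t y := \sum_l partial j (A i l t) y * w t y 0 l + partial j (b i t) y.
have ck j i : Ck k B (c j i).
  apply: CkD; last exact: Ck_partial.
  by apply: Ck_sum => l _; apply: CkM; [exact: Ck_partial|exact: wk].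
have /choice[v vP] : forall jy : 'I_q * 'rV[R]_q, exists v, B jy.2 ->
    ode_sol (lin_rhs A (c jy.1) jy.2) v /\
    v 0 = \row_i partial jy.1 (fun y => w 0 y 0 i) jy.2.
  move=> [j y] /=; have [By|nB] := pselect (B y); last by exists (fun=> 0).
  have [|||v vP] := @lin_exists A (c j) y (\row_i partial j (fun y => w 0 y 0 i) y) By.
  - by move=> i l; exact: Ck_le (HAk i l).
  - by move=> i; exact: Ck_le (ck j i).
  - by move=> t i; exact: A2.
  - by exists v.
have vk j i : Ck k B (fun t y => v (j, y) t 0 i).
  apply: (IH (c j) (fun t y => v (j, y) t)) => //.
    move=> l; apply: (@Ck_eq _ _ _ _ (fun _ y => partial j (fun y => w 0 y 0 l) y)) => //.
      by move=> _ y By; have [_ ->] := vP (j, y) By; rewrite mxE.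
    exact: (Ck_partial j oB (H0 l)).
  by move=> y By; have [] := vP (j, y) By.
move=> i; apply: (@CkSP _ _ _ _ _ (fun j t y => v (j, y) t 0 i)) => // [t y By|j t y By].
  exact: (Ck_continuous (wk i) By).
have [sv v0] := vP (j, y) By.
apply: (@lin_is_derive A b w j y) => //.
- by move=> i' l; exact: Ck_le (HA i' l).
- by move=> i'; exact: Ck_le (Hb i').
- by move=> i'; exact: Ck_le (H0 i').
- by move=> i'; rewrite v0 mxE.
Qed.

End LinearFamilies.

(** * Flows depending smoothly on parameters *)

Lemma is_derive_sumr (R : realType) (V : normedModType R) (I : Type) (r : seq I) (f : I -> V -> R)
    (df : I -> R) x v : (forall i, is_derive x v (f i) (df i)) ->
  is_derive x v (fun y => \sum_(i <- r) f i y) (\sum_(i <- r) df i).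
Proof.
move=> H; elim: r => [|i r IH].
  by rewrite big_nil; under eq_fun do rewrite big_nil; exact: is_derive_cst.
rewrite big_cons; under eq_fun do rewrite big_cons.
by have ? := H i; exact: (@is_deriveD _ _ _ (f i) (fun y => \sum_(i <- r) f i y)).
Qed.

Lemma is_derive_mull (R : realType) (V : normedModType R) (f : V -> R) (c d : R) x v :
  is_derive x v f d -> is_derive x v (fun y => c * f y) (c * d).
Proof. by move=> H; exact: (@is_deriveZ _ _ _ f). Qed.

Lemma ler_sum_const (R : realType) (n : nat) (f : 'I_n -> R) (c : R) :
  (forall i, f i <= c) -> \sum_i f i <= n%:R * c.
Proof.
move=> H; apply: (@le_trans _ _ (\sum_(i < n) c)); first exact: ler_sum.
by rewrite sumr_const card_ord mulr_natl.
Qed.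

Lemma max_lip (R : realType) (a b c : R) : `|Num.max c a - Num.max c b| <= `|a - b|.
Proof.
by case: (leP c a) => ?; case: (leP c b) => ?; rewrite ler_norml;
  case: (ler0P (a - b)) => ?; apply/andP; split; lra.
Qed.

Lemma min_lip (R : realType) (a b c : R) : `|Num.min a c - Num.min b c| <= `|a - b|.
Proof.
by case: (leP a c) => ?; case: (leP b c) => ?; rewrite ler_norml;
  case: (ler0P (a - b)) => ?; apply/andP; split; lra.
Qed.

Lemma lip1_continuous (R : realType) (V W : normedModType R) (f : V -> W) :
  (forall x z, `|f x - f z| <= `|x - z|) -> continuous f.
Proof.
move=> lf x; apply/cvgrPdist_le => e e0; apply/nbhs_ballP; exists e => //= z.
by rewrite -ball_normE /= => /ltW; apply: le_trans; exact: lf.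
Qed.

(* The solutions psi(t, y) of psi' = \sum_a y_a X_a(psi), psi(0, y) = p + y *m M. The
   parameter y ranges over a ball so small that the field is 1/2-Lipschitz on V. *)
Section FlowFamily.
Variables (R : realType) (q n : nat) (X : 'I_q -> 'rV[R]_n -> 'rV[R]_n).
Variables (p : 'rV[R]_n) (r0 K delta : R) (M : 'M[R]_(q, n)).

Local Notation "''e_' i" := (delta_mx 0 i) (at level 8, i at level 2).
Local Notation V := (ball p r0).
Local Notation B := (ball (0 : 'rV[R]_q) delta).
Local Notation dX a i l := (partial l (fun x => X a x 0 i)).

Hypotheses (r0_gt0 : 0 < r0) (K_ge0 : 0 <= K) (delta_gt0 : 0 < delta).
Hypothesis X_smooth : forall a i, smooth_on V (fun x => X a x 0 i).
Hypothesis X_le : forall a i x, V x -> `|X a x 0 i| <= K.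
Hypothesis dX_le : forall a i l x, V x -> `|dX a i l x| <= K.
Hypothesis M_le : forall a i, `|M a i| <= K.
Hypothesis delta1 : n%:R * (q%:R * (delta * K)) <= 2^-1.
Hypothesis delta2 : q%:R * (delta * K) + q%:R * (delta * K) <= r0 / 2.

Implicit Types (y : 'rV[R]_q) (x z : 'rV[R]_n).

Let oV : open V. Proof. exact: ball_open. Qed.
Let oB : open B. Proof. exact: ball_open. Qed.
Let dK_ge0 : 0 <= q%:R * (delta * K).
Proof. by rewrite mulr_ge0// mulr_ge0// ltW. Qed.

Lemma par_le y a : B y -> `|y 0 a| <= delta.
Proof.
by rewrite -ball_normE /= sub0r normrN => /ltW; apply: le_trans; exact: rV_coord_le.
Qed.

Definition fld (y : 'rV[R]_q) (x : 'rV[R]_n) : 'rV[R]_n := \row_i \sum_a y 0 a * X a x 0 i.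

Definition dfld (y : 'rV[R]_q) i l (x : 'rV[R]_n) : R := \sum_a y 0 a * dX a i l x.

Lemma fld_is_derive y i l x : V x -> is_derive x 'e_l (fun x => fld y x 0 i) (dfld y i l x).
Proof.
move=> Vx; under eq_fun do rewrite mxE; apply: is_derive_sumr => a.
by apply: is_derive_mull; exact: (smooth_is_derive l (X_smooth a i) Vx).
Qed.

Lemma fld_le y x i : B y -> V x -> `|fld y x 0 i| <= q%:R * (delta * K).
Proof.
move=> By Vx; rewrite mxE; apply: (le_trans (ler_norm_sum _ _ _)).
by apply: ler_sum_const => a; rewrite normrM ler_pM// ?par_le// X_le.
Qed.

Lemma dfld_sum_le y i (xi : 'I_n -> 'rV[R]_n) : B y -> (forall l, V (xi l)) ->
  \sum_l `|dfld y i l (xi l)| <= 2^-1.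
Proof.
move=> By Vxi; apply: le_trans delta1; apply: ler_sum_const => l.
apply: (le_trans (ler_norm_sum _ _ _)).
by apply: ler_sum_const => a; rewrite normrM ler_pM// ?par_le// dX_le.
Qed.

Lemma fld_mvt y x z i : V x -> V z -> exists xi : 'I_n -> 'rV[R]_n,
  [/\ forall l, V (xi l), forall l, `|xi l - z| <= `|x - z| &
   fld y x 0 i - fld y z 0 i = \sum_l dfld y i l (xi l) * (x - z) 0 l].
Proof.
move=> Vx Vz.
have [w l bw|xi [xib E]] := @box_mvt _ _ (fun x => fld y x 0 i) (dfld y i) z x.
  by apply: fld_is_derive; exact: box_ball bw.
exists xi; split=> [l|l|]; [exact: box_ball (xib l)|exact: box_dist (xib l)|].
by rewrite E; apply: eq_bigr => l _; rewrite !mxE.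
Qed.

Lemma fld_lip y x z i : B y -> V x -> V z -> `|fld y x 0 i - fld y z 0 i| <= 2^-1 * `|x - z|.
Proof.
move=> By Vx Vz; have [xi [xiV _ ->]] := fld_mvt y i Vx Vz.
by apply: dot_le; exact: dfld_sum_le.
Qed.

(* Projection onto a closed cube, which makes the field globally Lipschitz; the
   solution never leaves the cube, so that it solves the original equation. *)
Definition cube_clamp (x : 'rV[R]_n) : 'rV[R]_n :=
  \row_i (p 0 i + Num.max (- (r0 / 2)) (Num.min (x 0 i - p 0 i) (r0 / 2))).

Lemma cube_clamp_in x : V (cube_clamp x).
Proof.
have r2 : 0 < r0 / 2 by rewrite divr_gt0.
rewrite -ball_normE /= distrC; apply: (@le_lt_trans _ _ (r0 / 2)); last by lra.
apply: rV_norm_le => [|i]; first exact: ltW.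
rewrite !mxE addrC addKr ler_norml; apply/andP; split; first by rewrite le_max lexx.
by rewrite ge_max; apply/andP; split; [lra|rewrite ge_min lexx orbT].
Qed.

Lemma cube_clamp_id x : `|x - p| <= r0 / 2 -> cube_clamp x = x.
Proof.
move=> xp; apply/rowP => i; rewrite mxE.
have := le_trans (rV_coord_le (x - p) i) xp; rewrite !mxE ler_norml => /andP[h1 h2].
by rewrite min_l// max_r// addrC subrK.
Qed.

Lemma cube_clamp_lip x z : `|cube_clamp x - cube_clamp z| <= `|x - z|.
Proof.
apply: rV_norm_le => // i; apply: le_trans (rV_coord_le _ i); rewrite !mxE.
have -> : forall a b c : R, (a + b) - (a + c) = b - c by move=> a b c; ring.
have -> : x 0 i - z 0 i = (x 0 i - p 0 i) - (z 0 i - p 0 i) by ring.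
exact: le_trans (max_lip _ _ _) (min_lip _ _ _).
Qed.

Lemma cube_clamp_continuous : continuous cube_clamp.
Proof.
by apply: lip1_continuous; exact: cube_clamp_lip.
Qed.

Lemma fld_continuous y i x : V x -> {for x, continuous (fun x => fld y x 0 i)}.
Proof.
move=> Vx; rewrite /prop_for; under eq_fun do rewrite mxE.
apply: continuous_sumr => a _.
apply: (@continuousM _ _ (fun=> y 0 a) (fun x => X a x 0 i)); first exact: cst_continuous.
exact: (smooth_continuous (X_smooth a i)).
Qed.

Lemma flow_exists : exists psi : R -> 'rV[R]_q -> 'rV[R]_n, forall y : 'rV[R]_q, B y ->
  [/\ ode_sol (fun _ => fld y) (psi ^~ y), psi 0 y = p + y *m M & forall t, V (psi t y)].
Proof.
have E (y : 'rV[R]_q) : exists w : R -> 'rV[R]_n, B y ->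
    [/\ ode_sol (fun _ => fld y) w, w 0 = p + y *m M & forall t, V (w t)].
  have [By|nB] := pselect (B y); last by exists (fun=> 0).
  have [w cw t|t x z i t01|w [[cw kw dw] w0]] :=
    @ode_exists R n (fun _ x => fld y (cube_clamp x)) (p + y *m M).
  - apply: rV_continuous => i.
    apply: (@continuous_comp _ _ _ (fun t => cube_clamp (w t)) (fun x => fld y x 0 i)).
      by apply: continuous_comp; [exact: cw|exact: cube_clamp_continuous].
    by apply: fld_continuous; exact: cube_clamp_in.
  - apply: (le_trans (fld_lip i By (cube_clamp_in x) (cube_clamp_in z))).
    by rewrite ler_wpM2l ?invr_ge0// cube_clamp_lip.
  - have close t : `|w t - p| <= r0 / 2.
      have r2 : 0 <= r0 / 2 by rewrite divr_ge0// ltW.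
      apply: rV_norm_le => // i; rewrite !mxE kw.
      rewrite -[w (clamp t) 0 i](subrK (w 0 0 i)) w0 !mxE -addrA.
      have -> : p 0 i + \sum_j y 0 j * M j i - p 0 i = \sum_j y 0 j * M j i by ring.
      apply: (le_trans (ler_normD _ _)); apply: le_trans delta2; apply: lerD.
        have -> : p 0 i + \sum_j y 0 j * M j i = w 0 0 i by rewrite w0 !mxE.
        apply: (@increment_bound _ (fun t => w t 0 i) (fun t => fld y (cube_clamp (w t)) 0 i)).
        + exact: coord_path_continuous.
        + exact: dK_ge0.
        + by move=> s s01; exact: dw.
        + by move=> s _; apply: fld_le => //; exact: cube_clamp_in.
        + exact: clamp_itv.
      apply: (le_trans (ler_norm_sum _ _ _)).
      by apply: ler_sum_const => a; rewrite normrM ler_pM// par_le.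
    have cid t : cube_clamp (w t) = w t by exact: cube_clamp_id.
    exists w; split=> // [|t]; last by rewrite -cid; exact: cube_clamp_in.
    by split=> // t t01 i; rewrite -[w in fld y (w t)]/w -(cid t); exact: dw.
by have [psi psiP] := choice E; exists (fun t y => psi y t).
Qed.

Variable psi : R -> 'rV[R]_q -> 'rV[R]_n.
Hypothesis psi_sol : forall y : 'rV[R]_q, B y -> ode_sol (fun _ => fld y) (psi ^~ y).
Hypothesis psi0 : forall y : 'rV[R]_q, B y -> psi 0 y = p + y *m M.
Hypothesis psiV : forall y t, B y -> V (psi t y).

Lemma init_Ck k i : Ck k B (fun _ y => (p + y *m M) 0 i).
Proof.
under eq_fun do under eq_fun do rewrite !mxE.
apply: CkD; first exact: Ck_cst.
by apply: Ck_sum => a _; apply: CkM; [exact: Ck_coord|exact: Ck_cst].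
Qed.

Lemma init_is_derive i j y : is_derive y 'e_j (fun y => (p + y *m M) 0 i) (M j i).
Proof.
under eq_fun do rewrite !mxE.
have D a : is_derive y 'e_j (fun y : 'rV[R]_q => y 0 a * M a i) (M a i * (a == j)%:R).
  under eq_fun do rewrite mulrC.
  by apply: is_derive_mull; exact: coord_is_derive.
have := is_derive_sumr (index_enum 'I_q) D.
rewrite (bigD1 j)//= eqxx mulr1 big1 => [|a aj]; last by rewrite (negPf aj) mulr0.
rewrite addr0 => ?; rewrite -[M j i]add0r.
exact: (@is_deriveD _ _ _ (fun=> p 0 i)).
Qed.

Lemma psi_fld_continuous (y0 : 'rV[R]_q) a i : B y0 -> continuous (fun t => X a (psi t y0) 0 i).
Proof.
move=> By0 t; apply: (@continuous_comp _ _ _ (psi ^~ y0) (fun x => X a x 0 i)).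
  by have [c _ _] := psi_sol By0; exact: c.
exact: (smooth_continuous (X_smooth a i) (psiV t By0)).
Qed.

Lemma psi_continuous (y0 : 'rV[R]_q) : B y0 ->
  forall e : R, 0 < e -> \forall y \near y0, forall t, `|psi t y - psi t y0| <= e.
Proof.
move=> By0; have [c0 k0 d0] := psi_sol By0.
have nB : nbhs y0 B := open_nbhs_nbhs (conj oB By0).
pose Z i y t := \sum_a (y 0 a - y0 0 a) * X a (psi t y0) 0 i.
apply: (@perturbation _ _ (nbhs y0) _ n (fun y t => psi t y - psi t y0)
  (fun i y t => fld y (psi t y) 0 i - fld y0 (psi t y0) 0 i) Z).
- apply: filterS nB => y By; have [c k d] := psi_sol By; split.
  + by move=> t; apply: (@continuousB _ _ _ (psi ^~ y) (psi ^~ y0)); [exact: c|exact: c0].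
  + by move=> t; rewrite k k0.
  + move=> t t01 i; have ? := d t t01 i; have ? := d0 t t01 i.
    by under eq_fun do rewrite !mxE; exact: is_deriveB.
  + move=> t t01 i.
    have -> : fld y (psi t y) 0 i - fld y0 (psi t y0) 0 i =
        (fld y (psi t y) 0 i - fld y (psi t y0) 0 i) + Z i y t.
      rewrite -[LHS](subrKA (fld y (psi t y0) 0 i)); congr (_ + _).
      by rewrite !mxE -sumrB; apply: eq_bigr => a _; rewrite mulrBl.
    apply: (le_trans (ler_normD _ _)); rewrite lerD2r.
    apply: (le_trans (fld_lip i By (psiV t By) (psiV t By0))); rewrite ler_wpM2r//; lra.
- move=> i; apply: unif_small_sum => a _; apply: unif_smallM.
    move=> e e0.
    have : \forall y \near y0, `|y0 0 a - (y : 'rV[R]_q) 0 a| <= e.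
      have : {for y0, continuous (fun y : 'rV[R]_q => y 0 a)} by exact: coord_continuous.
      by move=> /cvgrPdist_le/(_ _ e0).
    by apply: filterS => y h t _; rewrite distrC.
  by apply: (@unif_bounded_fixed _ _ _ _ (fun t => X a (psi t y0) 0 i)); exact: psi_fld_continuous.
- move=> e e0.
  have fn i : \forall y \near y0, `|(p + y0 *m M) 0 i - (p + y *m M) 0 i| <= e.
    have : {for y0, continuous (fun y => (p + y *m M) 0 i)}.
      exact: (@Ck_continuous_at _ _ _ _ (fun _ y => (p + y *m M) 0 i) 0 _ (init_Ck 0 i) By0).
    by move=> /cvgrPdist_le/(_ _ e0).
  apply: filterS2 nB (filter_forall _ fn) => y By h; apply: rV_norm_le => [|i]; first exact: ltW.
  by rewrite !psi0//; have := h i; rewrite distrC !mxE.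
Qed.

Lemma psi_Ck0 i : Ck 0 B (fun t y => psi t y 0 i).
Proof.
split=> // t y By; apply: joint_continuity; first by have [] := psi_sol By.
exact: psi_continuous.
Qed.

Definition psi_A i l t y : R := dfld y i l (psi t y).
Definition psi_b j i t (y : 'rV[R]_q) : R := X j (psi t y) 0 i.

Lemma psi_b_Ck k j i : (forall i, Ck k B (fun t y => psi t y 0 i)) -> Ck k B (psi_b j i).
Proof.
move=> Hpsi; apply: (@Ck_comp _ _ _ _ _ V (fun x => X j x 0 i)) => //.
  by move=> t y /psiV.
exact: smooth_Ck.
Qed.

Lemma psi_A_Ck k i l : (forall i, Ck k B (fun t y => psi t y 0 i)) -> Ck k B (psi_A i l).
Proof.
move=> Hpsi; apply: Ck_sum => a _; apply: CkM; first exact: Ck_coord.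
apply: (@Ck_comp _ _ _ _ _ V (dX a i l)) => //; first by move=> t y /psiV.
by apply: smooth_Ck; exact: smooth_on_partial.
Qed.

Lemma psi_A_le t y i : B y -> \sum_l `|psi_A i l t y| <= 2^-1.
Proof. by move=> By; apply: (@dfld_sum_le y i (fun=> psi t y)) => // l; exact: psiV. Qed.

Lemma dfld_continuous y i l x : V x -> {for x, continuous (dfld y i l)}.
Proof.
move=> Vx; apply: continuous_sumr => a _.
apply: (@continuousM _ _ (fun=> y 0 a) (dX a i l)); first exact: cst_continuous.
by apply: (smooth_continuous (B := V)) => //; exact: smooth_on_partial.
Qed.

Lemma dfld_near_curve (y0 : 'rV[R]_q) i l : B y0 -> forall e : R, 0 < e ->
  exists2 r : R, 0 < r & forall t x, 0 <= t <= 1 -> `|x - psi t y0| < r ->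
    `|dfld y0 i l x - dfld y0 i l (psi t y0)| <= e.
Proof.
move=> By0 e e0.
have c t : {for (t, 0), continuous (fun z : R * 'rV[R]_n => dfld y0 i l (psi z.1 y0 + z.2))}.
  apply: (@continuous_comp _ _ _ (fun z : R * 'rV[R]_n => psi z.1 y0 + z.2) (dfld y0 i l)).
    apply: (@continuousD _ _ _ (fun z : R * 'rV[R]_n => psi z.1 y0) snd); last exact: cvg_snd.
    apply: (@continuous_comp _ _ _ fst (psi ^~ y0)); first exact: cvg_fst.
    by have [c _ _] := psi_sol By0; exact: c.
  by rewrite addr0; apply: dfld_continuous; exact: psiV.
have := @tube _ _ (fun t x => dfld y0 i l (psi t y0 + x)) 0 c e e0.
move=> /nbhs_ballP[r /= r0' rP]; exists r => // t x t01 xr.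
have := rP (x - psi t y0); rewrite -ball_normE /= sub0r normrN => /(_ xr t t01).
by rewrite addr0 (addrC (psi t y0) (x - _)) subrK.
Qed.

Lemma psi_is_derive j (y0 : 'rV[R]_q) v : B y0 -> ode_sol (lin_rhs psi_A (psi_b j) y0) v ->
    (forall i, v 0 0 i = M j i) ->
  forall t i, is_derive y0 'e_j (fun y => psi t y 0 i) (v t 0 i).
Proof.
move=> By0 [cv kv dv] v0.
have nB : nbhs y0 B := open_nbhs_nbhs (conj oB By0).
have [c0 k0 d0] := psi_sol By0.
pose yh (h : R) := h *: ('e_j : 'rV[R]_q) + y0.
have yhc : yh @ (0 : R)^' --> y0 by exact: line_cvg.
apply: family_is_derive.
apply: (@perturbation_le _ _ (0 : R)^' _ n (fun h t => h^-1 *: (psi t (yh h) - psi t y0) - v t)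
  (fun i h t => h^-1 * (fld (yh h) (psi t (yh h)) 0 i - fld y0 (psi t y0) 0 i)
    - (\sum_l psi_A i l t y0 * v t 0 l + psi_b j i t y0))).
- move=> e e0.
  have e2 : 0 < e / 2 by rewrite divr_gt0.
  have cnv : continuous (fun t => `|v t|).
    by move=> t; apply: (@continuous_comp _ _ _ v Num.norm); [exact: cv|exact: norm_continuous].
  have [N NP] := continuous_bounded01 cnv.
  have N1 : 0 < n%:R * (`|N| + 1) + 1 by rewrite ltr_wpDl// mulr_ge0.
  pose e1 := e / 2 / (n%:R * (`|N| + 1) + 1).
  have e10 : 0 < e1 by rewrite divr_gt0.
  have [r r0' rP] : exists2 r : R, 0 < r & forall i l t x, 0 <= t <= 1 -> `|x - psi t y0| < r ->
      `|dfld y0 i l x - dfld y0 i l (psi t y0)| <= e1.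
    have /choice[rr rrP] : forall il : 'I_n * 'I_n, exists r : R, 0 < r /\
        forall t x, 0 <= t <= 1 -> `|x - psi t y0| < r ->
        `|dfld y0 il.1 il.2 x - dfld y0 il.1 il.2 (psi t y0)| <= e1.
      by move=> il; have [r ? ?] := dfld_near_curve il.1 il.2 By0 e10; exists r.
    exists (\big[Num.min/1]_il rr il).
      by apply: (@big_ind R (fun r => 0 < r)) => // [x z x0 z0|il _]; [rewrite lt_min x0|have [] := rrP il].
    move=> i l t x t01 xr; have [_ /(_ t x t01)] := rrP (i, l); apply.
    by apply: lt_le_trans xr _; exact: bigmin_le_cond.
  have r2 : 0 < r / 2 by rewrite divr_gt0.
  have Q1 : \forall h \near (0 : R)^', forall t, `|psi t (yh h) - psi t y0| <= r / 2.
    exact: yhc _ (psi_continuous By0 r2).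
  have bs i : unif_small (nbhs y0) (fun y t => psi_b j i t y - psi_b j i t y0).
    apply: tube => t; apply: (Ck_continuous (psi_b_Ck j i _) By0); exact: psi_Ck0.
  have Q2' : \forall y \near y0, forall i t, 0 <= t <= 1 -> `|psi_b j i t y - psi_b j i t y0| <= e / 2.
    have bs' i : \forall y \near y0, forall t, 0 <= t <= 1 -> `|psi_b j i t y - psi_b j i t y0| <= e / 2.
      exact: bs.
    exact: (filter_forall _ bs').
  have Q2 : \forall h \near (0 : R)^', forall i t, 0 <= t <= 1 ->
      `|psi_b j i t (yh h) - psi_b j i t y0| <= e / 2.
    exact: yhc _ Q2'.
  have Q3 : \forall h \near (0 : R)^', B (yh h) by exact: yhc nB.
  have Q4 : \forall h \near (0 : R)^', h != 0 by exact: nbhs_dnbhs_neq.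
  apply: filterS3 (filterI Q1 Q2) Q3 Q4 => h [h1 h2] By h0; have [c1 k1 d1] := psi_sol By; split.
  + move=> t; apply: (@continuousB _ _ _ (fun t => h^-1 *: (psi t (yh h) - psi t y0)) v); last exact: cv.
    apply: (@continuous_comp _ _ _ (fun t => psi t (yh h) - psi t y0) (fun x => h^-1 *: x)).
      2: exact: scaler_continuous.
    by apply: (@continuousB _ _ _ (psi ^~ (yh h)) (psi ^~ y0)); [exact: c1|exact: c0].
  + by move=> t; rewrite k1 k0 kv.
  + move=> t t01 i; have D1 := d1 t t01 i; have D2 := d0 t t01 i; have D3 := dv t t01 i.
    have -> : (fun s => (h^-1 *: (psi s (yh h) - psi s y0) - v s) 0 i) =
      (fun s => h^-1 *: (psi s (yh h) 0 i - psi s y0 0 i) - v s 0 i).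
      by apply/funext => s; rewrite !mxE.
    have D4 : is_derive t (1:R) (fun s => h^-1 *: (psi s (yh h) 0 i - psi s y0 0 i))
      (h^-1 *: (fld (yh h) (psi t (yh h)) 0 i - fld y0 (psi t y0) 0 i)).
      exact: is_deriveZ.
    by apply: is_derive_eq; rewrite [X in _ - X]mxE.
  + move=> t t01 i.
    have t01' : 0 <= t <= 1 by case/andP: t01 => ? ?; rewrite !ltW.
    have [xi [xiV xid E]] := @fld_mvt y0 _ _ i (psiV t By) (psiV t By0).
    set d := h^-1 *: (psi t (yh h) - psi t y0) - v t.
    have fE : fld (yh h) (psi t (yh h)) 0 i = fld y0 (psi t (yh h)) 0 i + h * psi_b j i t (yh h).
      rewrite !mxE (eq_bigr (fun a => y0 0 a * X a (psi t (yh h)) 0 i +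
          h * (a == j)%:R * X a (psi t (yh h)) 0 i)); last first.
        by move=> a _; rewrite !mxE eqxx /= -mulrDl addrC.
      rewrite big_split/=; congr (_ + _); rewrite (bigD1 j)//= eqxx mulr1 big1 ?addr0// => a aj.
      by rewrite (negPf aj) mulr0 mul0r.
    have -> : h^-1 * (fld (yh h) (psi t (yh h)) 0 i - fld y0 (psi t y0) 0 i)
        - (\sum_l psi_A i l t y0 * v t 0 l + psi_b j i t y0)
      = \sum_l dfld y0 i l (xi l) * d 0 l +
        (\sum_l (dfld y0 i l (xi l) - psi_A i l t y0) * v t 0 l
          + (psi_b j i t (yh h) - psi_b j i t y0)).
      have -> : fld (yh h) (psi t (yh h)) 0 i - fld y0 (psi t y0) 0 i =
          (\sum_l dfld y0 i l (xi l) * (psi t (yh h) - psi t y0) 0 l + h * psi_b j i t (yh h))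
          - (\sum_(l < n) 0 + 0).
        by rewrite fE -E big1_eq addr0 subr0; ring.
      have -> : \sum_l psi_A i l t y0 * v t 0 l + psi_b j i t y0 =
          \sum_(l < n) 0 + (\sum_l psi_A i l t y0 * v t 0 l + psi_b j i t y0).
        by rewrite big1_eq add0r.
      apply: sum_combo => [l|]; last by rewrite subr0 mulKf.
      by rewrite !mxE; ring.
    apply: (le_trans (ler_normD _ _)); apply: lerD.
      apply: (le_trans (dot_le _ (dfld_sum_le i By0 xiV))); rewrite ler_wpM2r//; lra.
    apply: (le_trans (ler_normD _ _)); rewrite (splitr e); apply: lerD; last exact: h2.
    apply: (le_trans (ler_norm_sum _ _ _)).
    apply: (@le_trans _ _ (n%:R * (e1 * (`|N| + 1)))).
      apply: ler_sum_const => l; rewrite normrM; apply: ler_pM => //.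
        apply: rP => //; apply: le_lt_trans (xid l) _; apply: le_lt_trans (h1 t) _.
        by rewrite ltr_pdivrMr// mulrDr mulr1 ltrDl.
      apply: (le_trans (rV_coord_le _ _)); apply: (le_trans (NP t t01')).
      by rewrite (le_trans (ler_norm N))// lerDl.
    rewrite mulrCA /e1 [X in X <= _]mulrAC -[X in X <= _]mulrA; apply: ler_piMr; first exact: ltW.
    by rewrite ler_pdivrMr// mul1r lerDl.
- move=> e e0.
  have fn i : \forall h \near (0:R)^', forall t : R, 0 <= t <= 1 ->
      `|h^-1 * ((p + yh h *m M) 0 i - (p + y0 *m M) 0 i) - partial j (fun y => (p + y *m M) 0 i) y0| <= e.
    exact: (quotient_unif_small j oB (init_Ck 1 i) By0 e0).
  have Q3 : \forall h \near (0 : R)^', B (yh h) by exact: yhc nB.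
  apply: filterS2 Q3 (filter_forall _ fn) => h By hw; apply: rV_norm_le => [|i]; first exact: ltW.
  have i0 : 0 <= (0 : R) <= 1 by rewrite lexx ler01.
  have := hw i 0 i0; rewrite /partial; have [_ ->] := init_is_derive i j y0.
  by rewrite !psi0// !mxE v0.
Qed.

Lemma psi_partial j y : B y ->
  ode_sol (lin_rhs psi_A (psi_b j) y) (fun t => \row_i partial j (fun y => psi t y 0 i) y) /\
  (forall t i, is_derive y 'e_j (fun y => psi t y 0 i) (partial j (fun y => psi t y 0 i) y)).
Proof.
move=> By.
have [i l|i|t i _|v [sv v0]] := @lin_exists _ _ _ B psi_A (psi_b j) y (row j M) By.
- by apply: psi_A_Ck; exact: psi_Ck0.
- by apply: psi_b_Ck; exact: psi_Ck0.
- exact: psi_A_le.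
have D : forall t i, is_derive y 'e_j (fun y => psi t y 0 i) (v t 0 i).
  by apply: psi_is_derive => // i; rewrite v0 mxE.
have E t : \row_i partial j (fun y => psi t y 0 i) y = v t.
  by apply/rowP => i; rewrite mxE /partial; have [_ ->] := D t i.
split; first by under eq_fun do rewrite E.
by move=> t i; rewrite /partial; have [? e] := D t i; exact: DeriveDef.
Qed.

Theorem psi_Ck k i : Ck k B (fun t y => psi t y 0 i).
Proof.
elim: k i => [|k IH] i; first exact: psi_Ck0.
apply: (@CkSP _ _ _ _ _ (fun j t y => partial j (fun y => psi t y 0 i) y)) => [t y By|j|j t y By].
- exact: (Ck_continuous (IH i) By).
- have H := @lin_Ck _ _ _ B oB k psi_A (psi_b j) (fun t y => \row_i partial j (fun y => psi t y 0 i) y).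
  apply: (@Ck_eq _ _ _ _ (fun t y => (\row_i partial j (fun y => psi t y 0 i) y) 0 i)) => //.
    by move=> t y By; rewrite mxE.
  apply: H => [l m|l|t y l By _|l|y By].
  + exact: psi_A_Ck.
  + exact: psi_b_Ck.
  + exact: psi_A_le.
  + apply: (@Ck_eq _ _ _ _ (fun _ _ => M j l)) => [//|_ y By|]; last exact: Ck_cst.
    rewrite mxE /partial.
    rewrite -[RHS](near_eq_derive (f := fun y => (p + y *m M) 0 l)).
      by have [_ ->] := init_is_derive l j y.
    have nB : nbhs y B := open_nbhs_nbhs (conj oB By).
    by apply: filterS nB => z Bz; rewrite psi0.
  + by have [] := psi_partial j By.
- by have [_] := psi_partial j By; exact.
Qed.

End FlowFamily.

Lemma near_bounded (R : realType) (T : topologicalType) (I : finType) (f : I -> T -> R) (p : T) :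
    (forall i, {for p, continuous (f i)}) ->
  exists2 K : R, 0 <= K & \forall z \near p, forall i, `|f i z| <= K.
Proof.
move=> c; exists (\sum_i (`|f i p| + 1)); first by rewrite sumr_ge0// => i _; rewrite addr_ge0.
have fn i : \forall z \near p, `|f i p - f i z| <= 1.
  by have /cvgrPdist_le/(_ _ ltr01) := c i.
apply: filterS (filter_forall _ fn) => z h i.
apply: (@le_trans _ _ (`|f i p| + 1)).
  by rewrite -[f i z](subKr (f i p)) (le_trans (ler_normB _ _))// lerD2l.
by rewrite (bigD1 i)//= lerDl sumr_ge0// => j _; rewrite addr_ge0.
Qed.

Section Flow.
Variables (R : realType) (q n : nat).

Theorem flow_family (X : 'I_q -> 'rV[R]_n -> 'rV[R]_n) (V : set 'rV[R]_n) (p : 'rV[R]_n)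
    (M : 'M[R]_(q, n)) :
    open V -> V p -> (forall a i, smooth_on V (fun x => X a x 0 i)) ->
  exists (delta : R) (psi : R -> 'rV[R]_q -> 'rV[R]_n), 0 < delta /\
    [/\ forall y : 'rV[R]_q, ball (0 : 'rV[R]_q) delta y ->
          [/\ ode_sol (fun _ => fld X y) (psi ^~ y), psi 0 y = p + y *m M & forall t, V (psi t y)],
        forall k i, Ck k (ball (0 : 'rV[R]_q) delta) (fun t y => psi t y 0 i),
        forall j (y : 'rV[R]_q), ball (0 : 'rV[R]_q) delta y ->
          ode_sol (lin_rhs (psi_A X psi) (psi_b X psi j) y)
            (fun t => \row_i partial j (fun y => psi t y 0 i) y) &
        forall t (y : 'rV[R]_q) i, ball (0 : 'rV[R]_q) delta y ->
          \sum_l `|psi_A X psi i l t y| <= 2^-1 ].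
Proof.
move=> oV Vp Xs.
have [K1 K10 n1] := @near_bounded R _ ('I_q * 'I_n)%type (fun ai x => X ai.1 x 0 ai.2) p
  (fun ai => smooth_continuous (Xs ai.1 ai.2) Vp).
have [K2 K20 n2] := @near_bounded R _ ('I_q * 'I_n * 'I_n)%type
  (fun ail => partial ail.2 (fun x => X ail.1.1 x 0 ail.1.2)) p
  (fun ail => smooth_continuous (@smooth_on_partial _ _ _ _ ail.2 (Xs ail.1.1 ail.1.2)) Vp).
have nV : nbhs p V := open_nbhs_nbhs (conj oV Vp).
have /nbhs_ballP[r0 /= r00 rP] : \forall z \near p, V z /\
    ((forall ai : 'I_q * 'I_n, `|X ai.1 z 0 ai.2| <= K1) /\
     (forall ail : 'I_q * 'I_n * 'I_n, `|partial ail.2 (fun x => X ail.1.1 x 0 ail.1.2) z| <= K2)).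
  exact: filterI nV (filterI n1 n2).
pose K := K1 + K2 + `|M|.
have K0 : 0 <= K by rewrite !addr_ge0.
pose S := 2 * (n%:R * (q%:R * K)) + 4 * (q%:R * K) / r0 + 1.
have a0 : 0 <= n%:R * (q%:R * K) by rewrite !mulr_ge0.
have b0 : 0 <= q%:R * K / r0 by rewrite divr_ge0 ?mulr_ge0// ltW.
have S0 : 0 < S by rewrite /S ltr_wpDl// -mulrA addr_ge0// mulr_ge0.
have d0 : 0 < S^-1 by rewrite invr_gt0.
have H1 a i : smooth_on (ball p r0) (fun x => X a x 0 i).
  by apply: smooth_sub (Xs a i) => x /rP[].
have H2 a i x : ball p r0 x -> `|X a x 0 i| <= K.
  by move=> /rP[_ [/(_ (a, i)) h _]]; rewrite (le_trans h)// /K -addrA lerDl addr_ge0.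
have H3 a i l x : ball p r0 x -> `|partial l (fun x => X a x 0 i) x| <= K.
  move=> /rP[_ [_ /(_ (a, i, l)) h]]; rewrite (le_trans h)// /K.
  by rewrite addrAC lerDr addr_ge0.
have H4 a i : `|M a i| <= K.
  have : `|M a i| <= `|M|.
    by rewrite [leRHS]/Num.Def.normr/= mx_normrE (le_bigmax _ _ (a, i)).
  by move=> h; rewrite (le_trans h)// /K lerDr addr_ge0.
have E1 : n%:R * (q%:R * (S^-1 * K)) = (n%:R * (q%:R * K)) / S by ring.
have E2 : q%:R * (S^-1 * K) = (q%:R * K) / S by ring.
have H5 : n%:R * (q%:R * (S^-1 * K)) <= 2^-1.
  rewrite E1 ler_pdivrMr// /S.
  have -> : 2^-1 * (2 * (n%:R * (q%:R * K)) + 4 * (q%:R * K) / r0 + 1) =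
    n%:R * (q%:R * K) + (2 * (q%:R * K / r0) + 2^-1) by field; exact: lt0r_neq0.
  by rewrite lerDl; apply: addr_ge0; [exact: mulr_ge0|rewrite invr_ge0].
have H6 : q%:R * (S^-1 * K) + q%:R * (S^-1 * K) <= r0 / 2.
  rewrite E2 -mulrDl ler_pdivrMr// /S.
  have -> : r0 / 2 * (2 * (n%:R * (q%:R * K)) + 4 * (q%:R * K) / r0 + 1) =
    (q%:R * K + q%:R * K) + r0 * (n%:R * (q%:R * K) + 2^-1) by field; exact: lt0r_neq0.
  by rewrite lerDl; apply: mulr_ge0; [exact: ltW|rewrite addr_ge0// invr_ge0].
have [psi psiP] := @flow_exists R q n X p r0 K S^-1 M r00 K0 d0 H1 H2 H3 H4 H5 H6.
have s1 y (By : ball (0 : 'rV[R]_q) S^-1 y) := let: And3 a _ _ := psiP y By in a.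
have s2 y (By : ball (0 : 'rV[R]_q) S^-1 y) := let: And3 _ a _ := psiP y By in a.
have s3 y t (By : ball (0 : 'rV[R]_q) S^-1 y) := let: And3 _ _ a := psiP y By in a t.
exists S^-1, psi; split=> //; split.
- by move=> y By; split; [exact: s1|exact: s2|move=> t; have /rP[] := s3 y t By].
- by move=> k i; exact: (psi_Ck H1 H3 H5 s1 s2 s3).
- by move=> j y By; have [] := psi_partial H1 H3 H5 s1 s2 s3 j By.
- by move=> t y i By; exact: (psi_A_le H3 H5 s3 t i By).
Qed.

End Flow.

(** * The inverse function theorem *)

Lemma mulmx_norm_le (R : realType) m n (u : 'rV[R]_m) (A : 'M[R]_(m, n)) (c : R) :
  (forall i j, `|A i j| <= c) -> 0 <= c -> `|u *m A| <= m%:R * (`|u| * c).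
Proof.
move=> Ac c0; apply: rV_norm_le => [|j]; first by rewrite !mulr_ge0.
rewrite mxE; apply: (le_trans (ler_norm_sum _ _ _)); apply: ler_sum_const => i.
by rewrite normrM ler_pM// rV_coord_le.
Qed.

Lemma mx_coord_le (R : realType) m n (A : 'M[R]_(m, n)) i j : `|A i j| <= `|A|.
Proof. by rewrite [leRHS]/Num.Def.normr/= mx_normrE (le_bigmax _ _ (i, j)). Qed.

Lemma mx_near (R : realType) (T : topologicalType) m n (A : T -> 'M[R]_(m, n)) (x : T) :
    (forall i j, {for x, continuous (fun z => A z i j)}) ->
  forall e : R, 0 < e -> \forall z \near x, forall i j, `|A x i j - A z i j| <= e.
Proof.
move=> c e e0.
have fn (ij : 'I_m * 'I_n) : \forall z \near x, `|A x ij.1 ij.2 - A z ij.1 ij.2| <= e.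
  by have /cvgrPdist_le/(_ _ e0) := c ij.1 ij.2.
by apply: filterS (filter_forall _ fn) => z h i j; exact: (h (i, j)).
Qed.

Section InverseFunction.
Variables (R : realType) (n : nat).
Implicit Types (x z y : 'rV[R]_n).

Local Notation "''e_' i" := (delta_mx 0 i) (at level 8, i at level 2).

(* Rows are indexed by the direction of differentiation, so that
   f(x + h) is f(x) + h *m J up to o(h). *)
Definition jac (f : 'rV[R]_n -> 'rV[R]_n) x : 'M[R]_n :=
  \matrix_(i, j) partial i (fun x => f x 0 j) x.

Section Local.
Variables (f : 'rV[R]_n -> 'rV[R]_n) (p : 'rV[R]_n) (r eps : R).
Local Notation V := (ball p r).
Local Notation J0 := (jac f p).
Local Notation T := (invmx (jac f p)).
Hypotheses (r_gt0 : 0 < r) (eps_ge0 : 0 <= eps).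
Hypothesis f_smooth : smooth_map_on V f.
Hypothesis J0_unit : J0 \in unitmx.
Hypothesis J_near : forall x i j, V x -> `|J0 i j - jac f x i j| <= eps.
Hypothesis eps_le : n%:R * (n%:R * (eps * `|T|)) <= 2^-1.

Let oV : open V. Proof. exact: ball_open. Qed.

Lemma map_mvt x z : V x -> V z -> exists A : 'M[R]_n,
  f x - f z = (x - z) *m A /\
  forall i j, exists2 xi, V xi /\ `|xi - z| <= `|x - z| & A i j = jac f xi i j.
Proof.
move=> Vx Vz.
have /choice[xi xiP] : forall j, exists xi : 'I_n -> 'rV[R]_n, (forall i, box z x (xi i)) /\
    f x 0 j - f z 0 j = \sum_i partial i (fun x => f x 0 j) (xi i) * (x 0 i - z 0 i).
  move=> j; apply: (@box_mvt _ _ (fun x => f x 0 j) (fun i => partial i (fun x => f x 0 j))) => w i bw.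
  by apply: (smooth_is_derive i (f_smooth j)); exact: box_ball bw.
exists (\matrix_(i, j) jac f (xi j i) i j); split=> [|i j].
  apply/rowP => j; rewrite !mxE; have [_ ->] := xiP j.
  by apply: eq_bigr => i _; rewrite !mxE mulrC.
exists (xi j i); last by rewrite mxE.
have [/(_ i) b _] := xiP j; split; [exact: box_ball b|exact: box_dist b].
Qed.

Lemma near_id_contract (u : 'rV[R]_n) (A : 'M[R]_n) : (forall i j, `|J0 i j - A i j| <= eps) ->
  `|u *m (J0 - A) *m T| <= 2^-1 * `|u|.
Proof.
move=> H.
have h1 : `|u *m (J0 - A)| <= n%:R * (`|u| * eps).
  by apply: mulmx_norm_le => // i j; have := H i j; rewrite !mxE.
have h2 := @mulmx_norm_le R n n (u *m (J0 - A)) T `|T| (@mx_coord_le R n n T) (normr_ge0 _).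
apply: (le_trans h2); apply: (@le_trans _ _ (n%:R * (n%:R * (`|u| * eps) * `|T|))).
  by rewrite ler_wpM2l// ler_wpM2r.
have -> : n%:R * (n%:R * (`|u| * eps) * `|T|) = n%:R * (n%:R * (eps * `|T|)) * `|u| by ring.
by rewrite ler_wpM2r.
Qed.

Lemma map_contract x z : V x -> V z ->
  `|(x - f x *m T) - (z - f z *m T)| <= 2^-1 * `|x - z|.
Proof.
move=> Vx Vz; have [A [E AP]] := map_mvt Vx Vz.
have -> : x - f x *m T - (z - f z *m T) = (x - z) *m (J0 - A) *m T.
  rewrite mulmxBr mulmxBl mulmxK// -E mulmxBl.
  move: (f x *m T) (f z *m T) => a b.
  by apply/rowP => i; rewrite !mxE; ring.
apply: near_id_contract => i j; have [xi [Vxi _] ->] := AP i j.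
exact: J_near.
Qed.

Lemma jac_unit x : V x -> jac f x \in unitmx.
Proof.
move=> Vx; rewrite -row_free_unit; apply: inj_row_free => u u0.
have := @near_id_contract u (jac f x) (fun i j => J_near i j Vx).
rewrite mulmxBr u0 subr0 mulmxK// => h.
apply/eqP; rewrite -normr_le0; have := normr_ge0 u; lra.
Qed.

Let C := 2 * (n%:R * `|T|).

Lemma map_expand x z : V x -> V z -> `|x - z| <= C * `|f x - f z|.
Proof.
move=> Vx Vz; have h := map_contract Vx Vz.
have h2 := @mulmx_norm_le R n n (f x - f z) T `|T| (@mx_coord_le R n n T) (normr_ge0 _).
have E : x - z = (x - f x *m T - (z - f z *m T)) + (f x - f z) *m T.
  rewrite mulmxBl; move: (f x *m T) (f z *m T) => a b.
  by apply/rowP => i; rewrite !mxE; ring.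
have := ler_normD (x - f x *m T - (z - f z *m T)) ((f x - f z) *m T).
rewrite -E => h3.
have -> : C * `|f x - f z| = 2 * (n%:R * (`|f x - f z| * `|T|)) by rewrite /C; ring.
move: h h2 h3; set a := `|x - z|; set b := n%:R * _; lra.
Qed.

Lemma map_inj x z : V x -> V z -> f x = f z -> x = z.
Proof.
move=> Vx Vz e; apply/eqP; rewrite -subr_eq0 -normr_le0.
by have := map_expand Vx Vz; rewrite e subrr normr0 mulr0.
Qed.

Lemma map_surj y : n%:R * (`|y - f p| * `|T|) <= r / 4 -> exists2 x, V x & f x = y.
Proof.
move=> yp.
have half_ball x : `|x - p| <= r / 2 -> V x.
  move=> xp; rewrite -ball_normE /= distrC; apply: (le_lt_trans xp).
  by rewrite ltr_pdivrMr// ltr_pMr// ltr1n.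
have Vp : V p by exact: ballxx.
pose phi x := (x - f x *m T) + y *m T.
have phi_lip x z : V x -> V z -> `|phi x - phi z| <= 2^-1 * `|x - z|.
  by move=> Vx Vz; rewrite /phi opprD addrACA subrr addr0; exact: map_contract.
have phi_in x : `|x - p| <= r / 2 -> `|phi x - p| <= r / 2.
  move=> xp.
  have -> : phi x - p = (phi x - phi p) + (y - f p) *m T.
    rewrite /phi mulmxBl; move: (f x *m T) (f p *m T) (y *m T) => a b c.
    by apply/rowP => i; rewrite !mxE; ring.
  apply: (le_trans (ler_normD _ _)).
  have h1 := phi_lip x p (half_ball _ xp) Vp.
  have h2 := @mulmx_norm_le R n n (y - f p) T `|T| (@mx_coord_le R n n T) (normr_ge0 _).
  lra.
pose u k := iter k phi p.
have u_in k : `|u k - p| <= r / 2.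
  elim: k => [|k IH]; last exact: phi_in.
  by rewrite subrr normr0 divr_ge0// ltW.
have uV k : V (u k) by apply: half_ball.
pose D := `|u 1%N - u 0%N|.
have dist k : `|u k.+1 - u k| <= D / 2 ^+ k.
  elim: k => [|k IH]; first by rewrite expr0 divr1.
  apply: (le_trans (phi_lip _ _ (uV k.+1) (uV k))).
  by rewrite exprS invfM mulrCA ler_wpM2l// invr_ge0.
have /choice[l lP] : forall i, exists l, forall k, `|u k 0 i - l| <= 2 * D / 2 ^+ k.
  move=> i; apply: geometric_limit => k; apply: le_trans (dist k).
  by have := rV_coord_le (u k.+1 - u k) i; rewrite !mxE.
pose x := \row_i l i.
have p2 k : 0 < 2 ^+ k :> R by rewrite exprn_gt0.
have D0 : 0 <= D by rewrite normr_ge0.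
have ux k : `|u k - x| <= 2 * D / 2 ^+ k.
  apply: rV_norm_le => [|i]; last by rewrite !mxE lP.
  by rewrite divr_ge0 ?mulr_ge0 ?(ltW (p2 k)).
have small (e : R) : 0 < e -> exists k, 2 * D / 2 ^+ k <= e by exact: geometric_small.
have xp : `|x - p| <= r / 2.
  apply/ler_addgt0Pl => e e0; have [k kP] := small e e0.
  have -> : x - p = - (u k - x) + (u k - p) by rewrite opprB addrA subrK.
  by apply: (le_trans (ler_normD _ _)); rewrite normrN lerD// (le_trans (ux k)).
have Vx := half_ball _ xp.
have fixp : phi x = x.
  apply/eqP; rewrite -subr_eq0 -normr_le0; apply/ler_addgt0Pl => e e0; rewrite [e + 0]addr0.
  have [k kP] := small _ (divr_gt0 e0 (ltr0n _ 2)).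
  have -> : phi x - x = - (u k.+1 - phi x) + (u k.+1 - x) by rewrite opprB addrA subrK.
  apply: (le_trans (ler_normD _ _)); rewrite normrN (splitr e); apply: lerD.
    apply: (le_trans (phi_lip _ _ (uV k) Vx)); apply: le_trans kP.
    by apply: (le_trans _ (ux k)); rewrite ler_piMl// invf_le1// ler1n.
  apply: (le_trans (ux k.+1)); apply: le_trans kP.
  rewrite ler_wpM2l ?mulr_ge0// lef_pV2 ?posrE// ler_eXn2l ?ltr1n//.
exists x => //.
have : (f x - y) *m T = 0.
  rewrite mulmxBl; move/eqP: fixp; rewrite /phi -subr_eq0 => /eqP E; apply/oppr_inj.
  rewrite oppr0 -{}E; move: (f x *m T) (y *m T) => a c.
  by apply/rowP => i; rewrite !mxE; ring.
move=> /(congr1 (mulmx^~ J0)); rewrite mulmxKV// mul0mx => /eqP.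
by rewrite subr_eq0 => /eqP.
Qed.

End Local.
End InverseFunction.

Lemma continuous_at_dist (R : realType) (T : topologicalType) (f : T -> R) (x : T) :
  (forall e : R, 0 < e -> \forall z \near x, `|f x - f z| <= e) -> {for x, continuous f}.
Proof. by move=> H; apply/cvgrPdist_le. Qed.

Lemma Ck_invmx (R : realType) n m k (B : set 'rV[R]_n) (A : R -> 'rV[R]_n -> 'M[R]_m) i j :
    open B -> (forall t y, B y -> A t y \in unitmx) ->
    (forall i j, Ck k B (fun t y => A t y i j)) -> Ck k B (fun t y => invmx (A t y) i j).
Proof.
move=> oB Au HA.
apply: (@Ck_eq _ _ _ _ (fun t y => (\det (A t y))^-1 * cofactor (A t y) j i)) => //.
  by move=> t y By; rewrite /invmx Au// !mxE.
apply: CkM; first apply: CkV; last 1 first.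
- by apply: CkM; [exact: Ck_cst|apply: Ck_det => a b; under eq_fun do under eq_fun do rewrite !mxE].
- by move=> t y By; have := Au t y By; rewrite unitmxE unitfE.
- exact: Ck_det.
Qed.

Section InverseSmooth.
Variables (R : realType) (n : nat).
Variables (f g : 'rV[R]_n -> 'rV[R]_n) (V V' : set 'rV[R]_n) (C : R).

Local Notation "''e_' i" := (delta_mx 0 i) (at level 8, i at level 2).

Hypotheses (oV : open V) (oV' : open V') (C0 : 0 <= C).
Hypothesis f_smooth : smooth_map_on V f.
Hypothesis J_unit : forall x, V x -> jac f x \in unitmx.
Hypothesis gV : forall y, V' y -> V (g y).
Hypothesis gK : forall y, V' y -> f (g y) = y.
Hypothesis g_lip : forall y z, V' y -> V' z -> `|g y - g z| <= C * `|y - z|.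
Hypothesis f_mvt : forall x z, V x -> V z -> exists A : 'M[R]_n,
  f x - f z = (x - z) *m A /\
  forall i j, exists2 xi, V xi /\ `|xi - z| <= `|x - z| & A i j = jac f xi i j.

Lemma jac_continuous x i j : V x -> {for x, continuous (fun x => jac f x i j)}.
Proof.
move=> Vx; rewrite /prop_for; under eq_fun do rewrite mxE.
apply: (@smooth_continuous _ _ V (partial i (fun x => f x 0 j))) => //.
exact: smooth_on_partial.
Qed.

Lemma inverse_is_derive y0 i j : V' y0 ->
  is_derive y0 'e_j (fun y => g y 0 i) (invmx (jac f (g y0)) j i).
Proof.
move=> V0; set J := jac f (g y0); have Ju : J \in unitmx by exact/J_unit/gV.
have nV' : nbhs y0 V' := open_nbhs_nbhs (conj oV' V0).
pose yh (h : R) := h *: ('e_j : 'rV[R]_n) + y0.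
have yhc : yh @ (0 : R)^' --> y0 by exact: line_cvg.
suff c : (fun h : R => h^-1 *: (((fun y => g y 0 i) \o shift y0) (h *: 'e_j) - g y0 0 i))
    @ (0 : R)^' --> invmx J j i.
  by split; [apply/cvg_ex; exists (invmx J j i)|exact: cvg_lim c].
apply/cvgrPdist_le => e e0.
pose D := n%:R * (n%:R * C * `|invmx J|) + 1.
have D0 : 0 < D by rewrite ltr_wpDl// !mulr_ge0.
have C1 : 0 < C + 1 by rewrite ltr_wpDl.
have e1 : 0 < e / D by rewrite divr_gt0.
have := @mx_near _ _ _ _ (jac f) (g y0) (fun a b => @jac_continuous (g y0) a b (gV V0)) _ e1.
move=> /nbhs_ballP[r /= r0 rP].
have Q1 : \forall h \near (0 : R)^', V' (yh h) by exact: yhc nV'.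
have Q2 : \forall h \near (0 : R)^', h != 0 by exact: nbhs_dnbhs_neq.
have Q3 : \forall h \near (0 : R)^', `|h| < r / (C + 1).
  by apply: dnbhs0_lt; rewrite divr_gt0// ltr_wpDl.
apply: filterS3 Q1 Q2 Q3 => h Vh h0 hr.
have [A [E AP]] := f_mvt (gV Vh) (gV V0).
move: E; rewrite !gK// addrK => E.
have hle : `|yh h - y0| <= `|h|.
  by rewrite addrK normrZ -[leRHS]mulr1 ler_wpM2l// rV_norm_delta.
have gle : `|g (yh h) - g y0| <= C * `|h|.
  by apply: (le_trans (g_lip Vh V0)); rewrite ler_wpM2l.
have JA a b : `|(J - A) a b| <= e / D.
  have [xi [Vxi xid] Aab] := AP a b; rewrite !mxE Aab; have := rP xi; rewrite -ball_normE /= distrC.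
  move=> /(_ _ a b); rewrite !mxE; apply.
  apply: (le_lt_trans xid); apply: (le_lt_trans gle); apply: (@le_lt_trans _ _ ((C + 1) * `|h|)).
    by rewrite ler_wpM2r// lerDl.
  by rewrite mulrC -ltr_pdivlMr.
pose q := h^-1 *: (g (yh h) - g y0).
have qA : q *m A = 'e_j by rewrite -scalemxAl -E scalerA mulVf// scale1r.
have qle : `|q| <= C.
  by rewrite normrZ normfV ler_pdivrMl ?normr_gt0// mulrC.
have qE : q - row j (invmx J) = q *m (J - A) *m invmx J.
  by rewrite mulmxBr mulmxBl mulmxK// qA rowE.
rewrite distrC.
have -> : h^-1 *: (((fun y => g y 0 i) \o shift y0) (h *: 'e_j) - g y0 0 i) - invmx J j i =
    (q - row j (invmx J)) 0 i by rewrite !mxE.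
apply: (le_trans (rV_coord_le _ _)); rewrite qE.
have h2 := @mulmx_norm_le R n n (q *m (J - A)) (invmx J) `|invmx J| (@mx_coord_le R n n _) (normr_ge0 _).
apply: (le_trans h2).
have h3 : `|q *m (J - A)| <= n%:R * (C * (e / D)).
  apply: (le_trans (mulmx_norm_le q JA (ltW e1))).
  by rewrite ler_wpM2l// ler_wpM2r// ltW.
apply: (@le_trans _ _ (n%:R * (n%:R * (C * (e / D)) * `|invmx J|))).
  by rewrite ler_wpM2l// ler_wpM2r.
have -> : n%:R * (n%:R * (C * (e / D)) * `|invmx J|) = e * ((D - 1) / D) by rewrite /D; ring.
by rewrite ler_piMr ?(ltW e0)// ler_pdivrMr// mul1r gerDl oppr_le0.
Qed.

Lemma inverse_smooth : smooth_map_on V' g.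
Proof.
have gc (t : R) i y : V' y -> {for (t, y), continuous (fun z : R * 'rV[R]_n => g z.2 0 i)}.
  move=> Vy; suff gc1 : {for y, continuous (fun y => g y 0 i)}.
    by apply: (@continuous_comp _ _ _ snd (fun y => g y 0 i)); first exact: cvg_snd.
  apply: continuous_at_dist => e e0.
  have C1 : 0 < C + 1 by rewrite ltr_wpDl.
  have nV' : nbhs y V' := open_nbhs_nbhs (conj oV' Vy).
  have nb : \forall z \near y, `|y - z| < e / (C + 1).
    by apply/nbhs_ballP; exists (e / (C + 1)); rewrite /= ?divr_gt0// => z; rewrite -ball_normE.
  apply: filterS2 nV' nb => z Vz yz.
  apply: (@le_trans _ _ `|g y - g z|); first by have := rV_coord_le (g y - g z) i; rewrite !mxE.
  apply: (le_trans (g_lip Vy Vz)); move: yz; rewrite ltr_pdivlMr// => /ltW; apply: le_trans.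
  by rewrite mulrC ler_wpM2l// lerDl.
have gk k i : Ck k V' (fun (_ : R) y => g y 0 i).
  elim: k i => [|k IH] i; first by split=> // t y Vy; exact: gc.
  apply: (@CkSP _ _ _ _ _ (fun j _ y => invmx (jac f (g y)) j i)) => [t y Vy|j|j t y Vy].
  - exact: gc.
  - apply: (@Ck_comp _ _ _ _ _ V (fun x => invmx (jac f x) j i) (fun _ => g)) => //.
    apply: (@Ck_invmx _ _ _ _ _ (fun _ x => jac f x)) => // a b.
    under eq_fun do under eq_fun do rewrite mxE.
    by apply: smooth_Ck; apply: smooth_on_partial; exact: f_smooth.
  - exact: inverse_is_derive.
by move=> i; apply: Ck_smooth.
Qed.

End InverseSmooth.

Theorem inverse_function (R : realType) n (W : set 'rV[R]_n) (p : 'rV[R]_n)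
    (f : 'rV[R]_n -> 'rV[R]_n) :
    open W -> W p -> smooth_map_on W f -> jac f p \in unitmx ->
  exists c : coord_system R n, [/\ coord_near W p c, to_coord c = f &
    forall x, cdom c x -> jac f x \in unitmx].
Proof.
move=> oW Wp fs Ju.
set T := invmx (jac f p).
pose eps := (2 * (n%:R * (n%:R * `|T|)) + 1)^-1.
have S0 : 0 < 2 * (n%:R * (n%:R * `|T|)) + 1 by rewrite ltr_wpDl// !mulr_ge0.
have eps0 : 0 < eps by rewrite invr_gt0.
have epsT : n%:R * (n%:R * (eps * `|T|)) <= 2^-1.
  have -> : n%:R * (n%:R * (eps * `|T|)) = n%:R * (n%:R * `|T|) * eps by ring.
  rewrite /eps ler_pdivrMr// mulrDr mulKf ?pnatr_eq0// lerDl mulr1 invr_ge0//.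
have nW : nbhs p W := open_nbhs_nbhs (conj oW Wp).
have nJ := @mx_near _ _ _ _ (jac f) p (fun i j => jac_continuous fs (i := i) (j := j) Wp) _ eps0.
have /nbhs_ballP[r /= r0 rP] : \forall x \near p, W x /\
    (forall i j, `|jac f p i j - jac f x i j| <= eps) by exact: filterI nW nJ.
have fsV : smooth_map_on (ball p r) f by move=> i; apply: smooth_sub (fs i) => x /rP[].
have Jn x i j : ball p r x -> `|jac f p i j - jac f x i j| <= eps by move=> /rP[_]; exact.
have T1 : 0 < n%:R * `|T| + 1 by rewrite ltr_wpDl// mulr_ge0.
pose s := r / 4 / (n%:R * `|T| + 1).
have s0 : 0 < s by rewrite !divr_gt0.
have surj (y : 'rV[R]_n) : ball (f p) s y -> exists x, ball p r x /\ f x = y.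
  move=> Vy; have ys : `|y - f p| <= s by move: Vy; rewrite -ball_normE /= distrC => /ltW.
  have ys' : n%:R * (`|y - f p| * `|T|) <= r / 4.
    apply: (@le_trans _ _ (s * (n%:R * `|T|))).
      by rewrite mulrCA ler_wpM2r// mulr_ge0.
    rewrite /s -mulrA ler_piMr ?divr_ge0 ?(ltW r0)//.
    by rewrite mulrC ler_pdivrMr// mul1r lerDl.
  by have [x Vx fx] := @map_surj R n f p r eps r0 (ltW eps0) fsV Ju Jn epsT y ys'; exists x.
have /choice[g gP] : forall y : 'rV[R]_n, exists x : 'rV[R]_n, ball (f p) s y -> ball p r x /\ f x = y.
  by move=> y; have [/surj[x ?]|?] := pselect (ball (f p) s y); [exists x|exists 0].
have inj (x z : 'rV[R]_n) := @map_inj R n f p r eps (ltW eps0) fsV Ju Jn epsT x z.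
have oV : open (ball p r) := ball_open p r.
have oV' : open (ball (f p) s) := ball_open (f p) s.
pose dom := [set x | ball p r x /\ ball (f p) s (f x)].
have fc x : ball p r x -> {for x, continuous f}.
  by move=> Vx; apply: rV_continuous => i; exact: (smooth_continuous (fsV i)).
have odom : open dom.
  rewrite openE => x [Vx Vfx].
  have n1 : nbhs x (ball p r) := open_nbhs_nbhs (conj oV Vx).
  have n2 : nbhs (f x) (ball (f p) s) := open_nbhs_nbhs (conj oV' Vfx).
  exact: filterI n1 (fc x Vx _ n2).
have gl (y z : 'rV[R]_n) : ball (f p) s y -> ball (f p) s z ->
    `|g y - g z| <= 2 * (n%:R * `|T|) * `|y - z|.
  move=> Vy Vz; have [Vgy gy] := gP y Vy; have [Vgz gz] := gP z Vz.
  by have := @map_expand R n f p r eps (ltW eps0) fsV Ju Jn epsT _ _ Vgy Vgz; rewrite gy gz.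
have JU (x : 'rV[R]_n) : ball p r x -> jac f x \in unitmx.
  exact: (@jac_unit R n f p r eps (ltW eps0) Ju Jn epsT x).
have gs : smooth_map_on (ball (f p) s) g.
  have C0 : 0 <= 2 * (n%:R * `|T|) by rewrite !mulr_ge0.
  have gV y : ball (f p) s y -> ball p r (g y) by move=> /gP[].
  have gK y : ball (f p) s y -> f (g y) = y by move=> /gP[].
  have mv := @map_mvt R n f p r fsV.
  exact: (@inverse_smooth R n f g (ball p r) (ball (f p) s) _ oV oV' C0 fsV JU gV gK gl mv).
have fsd : smooth_map_on dom f by move=> i; apply: smooth_sub (fsV i) => x [].
have P1 x : dom x -> ball (f p) s (f x) by case.
have P2 y : ball (f p) s y -> dom (g y).
  by move=> Vy; have [a b] := gP y Vy; split=> //; rewrite b.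
have P3 x : dom x -> g (f x) = x.
  by move=> [Vx Vfx]; have [a b] := gP (f x) Vfx; apply: inj.
have P4 y : ball (f p) s y -> f (g y) = y by move=> /gP[].
exists (CoordSystem odom oV' P1 P2 P3 P4 fsd gs); split=> //=.
  split=> [|x /= [/rP[]]//].
  by split; exact: ballxx.
by move=> x [Vx _]; exact: JU.
Qed.

(** * Poisson brackets *)

Section JacobiAlgebra.
Variables (R : comPzRingType) (n : nat).
Implicit Types (f g h : 'I_n -> R) (F G H : 'I_n -> 'I_n -> R).
Variables (P : 'I_n -> 'I_n -> R) (dP : 'I_n -> 'I_n -> 'I_n -> R).
Hypothesis P_skew : forall i j, P i j = - P j i.

Let sharp f s := \sum_k P s k * f k.
Let hess F (u v : 'I_n -> R) := \sum_s \sum_i F s i * u s * v i.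
Let dbr f F g G s :=
  \sum_i \sum_j (dP s i j * f i * g j + P i j * F s i * g j + P i j * f i * G s j).

Let hessC F u v : (forall i j, F i j = F j i) -> hess F u v = hess F v u.
Proof.
move=> Fs; rewrite /hess exchange_big; apply: eq_bigr => i _; apply: eq_bigr => j _.
by rewrite Fs mulrAC.
Qed.

Let dbr_sharp f F g G h :
  \sum_s \sum_k P s k * dbr f F g G s * h k =
  \sum_i \sum_j \sum_k f i * g j * h k * (\sum_s P s k * dP s i j)
  + hess F (sharp h) (sharp g) - hess G (sharp h) (sharp f).
Proof.
have E s : \sum_k P s k * dbr f F g G s * h k =
    \sum_i \sum_j \sum_k f i * g j * h k * (P s k * dP s i j)
    + \sum_i F s i * sharp h s * sharp g i - \sum_j G s j * sharp h s * sharp f j.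
  have -> : \sum_k P s k * dbr f F g G s * h k = dbr f F g G s * sharp h s.
    by rewrite /sharp mulr_sumr; apply: eq_bigr => k _; ring.
  have -> : dbr f F g G s = \sum_i \sum_j dP s i j * f i * g j
      + \sum_i F s i * sharp g i - \sum_j G s j * sharp f j.
    rewrite /dbr; under eq_bigr do rewrite big_split big_split/=.
    rewrite big_split big_split/=; congr (_ + _ + _).
      by apply: eq_bigr => i _; rewrite /sharp mulr_sumr; apply: eq_bigr => j _; ring.
    rewrite exchange_big/= -sumrN; apply: eq_bigr => j _.
    rewrite /sharp mulr_sumr -sumrN; apply: eq_bigr => i _.
    by rewrite (P_skew i j); ring.
  rewrite mulrBl mulrDl; congr (_ + _ - _).
  - rewrite mulr_suml; apply: eq_bigr => i _; rewrite mulr_suml; apply: eq_bigr => j _.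
    by rewrite /sharp mulr_sumr; apply: eq_bigr => k _; ring.
  - by rewrite mulr_suml; apply: eq_bigr => i _; ring.
  - by rewrite mulr_suml; apply: eq_bigr => i _; ring.
under eq_bigr do rewrite E.
rewrite sumrB big_split/=; congr (_ + _ - _).
rewrite exchange_big/=; apply: eq_bigr => i _; rewrite exchange_big/=; apply: eq_bigr => j _.
by rewrite exchange_big/=; apply: eq_bigr => k _; rewrite mulr_sumr.
Qed.

Lemma jacobi_algebra f F g G h H :
    (forall i j, F i j = F j i) -> (forall i j, G i j = G j i) -> (forall i j, H i j = H j i) ->
  \sum_s \sum_k P s k * dbr f F g G s * h k
  + \sum_s \sum_k P s k * dbr g G h H s * f k
  + \sum_s \sum_k P s k * dbr h H f F s * g k =
  \sum_i \sum_j \sum_k f i * g j * h k *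
    (\sum_s (P s k * dP s i j + P s i * dP s j k + P s j * dP s k i)).
Proof.
move=> Fs Gs Hs; rewrite !dbr_sharp.
rewrite (hessC (sharp h) (sharp g) Fs) (hessC (sharp h) (sharp f) Gs) (hessC (sharp f) (sharp g) Hs).
have -> : \sum_i \sum_j \sum_k f i * g j * h k *
    (\sum_s (P s k * dP s i j + P s i * dP s j k + P s j * dP s k i)) =
  \sum_i \sum_j \sum_k f i * g j * h k * (\sum_s P s k * dP s i j)
  + \sum_j \sum_k \sum_i g j * h k * f i * (\sum_s P s i * dP s j k)
  + \sum_k \sum_i \sum_j h k * f i * g j * (\sum_s P s j * dP s k i).
  have -> : \sum_j \sum_k \sum_i g j * h k * f i * (\sum_s P s i * dP s j k) =
    \sum_i \sum_j \sum_k f i * g j * h k * (\sum_s P s i * dP s j k).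
    under eq_bigr do rewrite exchange_big/=.
    rewrite exchange_big/=; apply: eq_bigr => i _; apply: eq_bigr => j _; apply: eq_bigr => k _.
    by congr (_ * _); ring.
  have -> : \sum_k \sum_i \sum_j h k * f i * g j * (\sum_s P s j * dP s k i) =
    \sum_i \sum_j \sum_k f i * g j * h k * (\sum_s P s j * dP s k i).
    rewrite exchange_big/=; apply: eq_bigr => i _; rewrite exchange_big/=.
    apply: eq_bigr => j _; apply: eq_bigr => k _.
    by congr (_ * _); ring.
  rewrite -!big_split/=; apply: eq_bigr => i _; rewrite -!big_split/=; apply: eq_bigr => j _.
  rewrite -!big_split/=; apply: eq_bigr => k _.
  by rewrite !big_split/= !mulrDr.
by ring.
Qed.

End JacobiAlgebra.

Section Bracket.
Variables (R : realType) (n : nat) (U : set 'rV[R]_n) (P : 'rV[R]_n -> 'M[R]_n).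
Hypotheses (oU : open U) (P_smooth : smooth_tensor_on U P).
Hypothesis P_skew : forall x, U x -> (P x)^T = - P x.
Implicit Types (f g h : 'rV[R]_n -> R) (x : 'rV[R]_n).

Local Notation "''e_' i" := (delta_mx 0 i) (at level 8, i at level 2).

Definition br f h x : R := \sum_i \sum_j P x i j * partial i f x * partial j h x.

Lemma is_derive_mul (V : normedModType R) (u v : V -> R) (x w : V) (a b : R) :
  is_derive x w u a -> is_derive x w v b ->
  is_derive x w (fun y => u y * v y) (a * v x + u x * b).
Proof.
move=> Hu Hv; have -> : a * v x + u x * b = u x *: b + v x *: a.
  by rewrite [LHS]addrC [a * _]mulrC.
exact: is_deriveM.
Qed.

Lemma br_smooth f h : smooth_on U f -> smooth_on U h -> smooth_on U (br f h).
Proof.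
move=> fs hs; apply: smooth_sum => // i _; apply: smooth_sum => // j _.
apply: smoothM => //; last exact: smooth_on_partial.
by apply: smoothM => //; exact: smooth_on_partial.
Qed.

Lemma P_skewE x i j : U x -> P x i j = - P x j i.
Proof. by move=> Ux; have /matrixP/(_ j i) := P_skew Ux; rewrite !mxE. Qed.

Lemma br_skew f h x : U x -> br f h x = - br h f x.
Proof.
move=> Ux; rewrite /br exchange_big/= -sumrN; apply: eq_bigr => i _.
rewrite -sumrN; apply: eq_bigr => j _.
by rewrite (P_skewE _ _ Ux) !mulNr mulrAC.
Qed.

Lemma partial_br f h s x : smooth_on U f -> smooth_on U h -> U x ->
  partial s (br f h) x = \sum_i \sum_j (partial s (fun z => P z i j) x * partial i f x * partial j h x
    + P x i j * partial s (partial i f) x * partial j h x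
    + P x i j * partial i f x * partial s (partial j h) x).
Proof.
move=> fs hs Ux.
suff D : is_derive x 'e_s (br f h) (\sum_i \sum_j (partial s (fun z => P z i j) x * partial i f x * partial j h x
    + P x i j * partial s (partial i f) x * partial j h x
    + P x i j * partial i f x * partial s (partial j h) x)).
  by rewrite /partial; case: D => _ ->.
apply: is_derive_sumr => i; apply: is_derive_sumr => j.
rewrite -mulrDl; apply: is_derive_mul; first apply: is_derive_mul.
- exact: (smooth_is_derive s (P_smooth i j)).
- by apply: (smooth_is_derive (B := U)) => //; exact: smooth_on_partial.
- by apply: (smooth_is_derive (B := U)) => //; exact: smooth_on_partial.
Qed.

Lemma br_jacobi f g h x : smooth_on U f -> smooth_on U g -> smooth_on U h -> U x ->
  br (br f g) h x + br (br g h) f x + br (br h f) g x =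
  \sum_i \sum_j \sum_k partial i f x * partial j g x * partial k h x *
    (\sum_s (P x s k * partial s (fun z => P z i j) x + P x s i * partial s (fun z => P z j k) x
      + P x s j * partial s (fun z => P z k i) x)).
Proof.
move=> fs gs hs Ux.
rewrite -(@jacobi_algebra R n (P x) (fun s i j => partial s (fun z => P z i j) x) (fun i j => P_skewE i j Ux)
   (fun i => partial i f x) (fun s i => partial s (partial i f) x)
   (fun i => partial i g x) (fun s i => partial s (partial i g) x)
   (fun i => partial i h x) (fun s i => partial s (partial i h) x)).
- by congr (_ + _ + _); apply: eq_bigr => s _; apply: eq_bigr => k _; rewrite partial_br.
- by move=> i j; exact: (smooth_partialC i j oU fs).
- by move=> i j; exact: (smooth_partialC i j oU gs).
- by move=> i j; exact: (smooth_partialC i j oU hs).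
Qed.

Lemma partial_cst_on f c s x : (forall z, U z -> f z = c) -> U x -> partial s f x = 0.
Proof.
move=> fc Ux; rewrite /partial -(derive_cst c x ('e_s : 'rV[R]_n)).
apply: near_eq_derive; have nU : nbhs x U := open_nbhs_nbhs (conj oU Ux).
exact: filterS nU.
Qed.

Lemma br_cstl f h c x : (forall z, U z -> f z = c) -> U x -> br f h x = 0.
Proof.
move=> fc Ux; rewrite /br big1// => i _; rewrite big1// => j _.
by rewrite (partial_cst_on i fc Ux) mulr0 mul0r.
Qed.

(* By the Jacobi identity the Hamiltonian fields of f and g commute as soon as
   {f, g} is constant. *)
Lemma br_commute f g h c x : (forall z, U z -> poisson_at P z) ->
    smooth_on U f -> smooth_on U g -> smooth_on U h ->
    (forall z, U z -> br f g z = c) -> U x ->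
  br f (br g h) x = br g (br f h) x.
Proof.
move=> Pp fs gs hs fgc Ux; have := br_jacobi fs gs hs Ux.
rewrite (br_cstl _ fgc Ux) add0r.
rewrite [X in _ = X -> _]big1 => [|i _]; last first.
  by rewrite big1// => j _; rewrite big1// => k _; rewrite Pp// mulr0.
have -> : br (br h f) g x = br g (br f h) x.
  rewrite br_skew// -[RHS]opprK; congr (- _); rewrite /br -sumrN; apply: eq_bigr => i _.
  rewrite -sumrN; apply: eq_bigr => j _.
  rewrite -mulrN; congr (_ * _).
  have D := smooth_is_derive j (br_smooth fs hs) Ux.
  rewrite /partial -(deriveN (V := 'rV[R]_n)); last by case: D.
  apply: near_eq_derive; have nU : nbhs x U := open_nbhs_nbhs (conj oU Ux).
  by apply: filterS nU => z; exact: br_skew.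
have E : br (br g h) f x = - br f (br g h) x := br_skew _ _ Ux.
by rewrite E => /addr0_eq; rewrite opprK.
Qed.

End Bracket.

(** * Straightening commuting vector fields *)

Section CoordinateSystems.
Variables (R : realType) (n : nat).

Local Notation "''e_' i" := (delta_mx 0 i) (at level 8, i at level 2).

Lemma partial_chain (U V : set 'rV[R]_n) (f : 'rV[R]_n -> 'rV[R]_n) (g : 'rV[R]_n -> R) i x :
    smooth_map_on U f -> smooth_on V g -> U x -> V (f x) ->
  partial i (fun x => g (f x)) x = \sum_k partial k g (f x) * partial i (fun x => f x 0 k) x.
Proof.
move=> fs gs Ux Vfx.
suff D : is_derive x 'e_i (fun x => g (f x)) (\sum_k partial k g (f x) * partial i (fun x => f x 0 k) x).
  by rewrite {1}/partial; case: D => _ ->.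
apply: is_derive_chain; first exact: (smooth_differentiable gs).
  by move=> k; exact: (smooth_is_derive k gs).
by move=> k; exact: (smooth_is_derive i (fs k)).
Qed.

Lemma partial_id (U : set 'rV[R]_n) (f : 'rV[R]_n -> 'rV[R]_n) i j x : open U -> U x ->
  (forall z, U z -> f z = z) -> partial i (fun x => f x 0 j) x = (i == j)%:R.
Proof.
move=> oU Ux fid; rewrite /partial eq_sym.
have [_ <-] := coord_is_derive x j i.
apply: near_eq_derive; have nU : nbhs x U := open_nbhs_nbhs (conj oU Ux).
by apply: filterS nU => z Uz; rewrite fid.
Qed.

Lemma jac_to_of (c : coord_system R n) x : cdom c x ->
  jac (to_coord c) x *m jac (of_coord c) (to_coord c x) = 1%:M.
Proof.
move=> dx; apply/matrixP => i j; rewrite !mxE.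
rewrite -(partial_id (f := fun x => of_coord c (to_coord c x)) i j (@cdom_open _ _ c) dx); last first.
  by move=> z; exact: to_coordK.
rewrite (@partial_chain (cdom c) (crange c) (to_coord c) (fun y => of_coord c y 0 j)) //.
- by apply: eq_bigr => k _; rewrite !mxE mulrC.
- exact: to_coord_smooth.
- exact: of_coord_smooth.
- exact: to_coord_range.
Qed.

Lemma jac_of_to (c : coord_system R n) x : cdom c x ->
  jac (of_coord c) (to_coord c x) *m jac (to_coord c) x = 1%:M.
Proof. by move=> /jac_to_of/mulmx1C. Qed.

Lemma jac_to_unit (c : coord_system R n) x : cdom c x -> jac (to_coord c) x \in unitmx.
Proof. by move=> /jac_to_of/mulmx1_unit[]. Qed.

Lemma jac_of_unit (c : coord_system R n) x : cdom c x -> jac (of_coord c) (to_coord c x) \in unitmx.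
Proof. by move=> /jac_to_of/mulmx1_unit[]. Qed.

End CoordinateSystems.

Section Straightening.
Variables (R : realType) (n : nat).

Local Notation "''e_' i" := (delta_mx 0 i) (at level 8, i at level 2).

Lemma lin_unique q (A : 'I_n -> 'I_n -> R -> 'rV[R]_q -> R) (b : 'I_n -> R -> 'rV[R]_q -> R) y
    (w1 w2 : R -> 'rV[R]_n) :
    (forall (t : R) i, 0 < t < 1 -> \sum_l `|A i l t y| <= 2^-1) ->
    ode_sol (lin_rhs A b y) w1 -> ode_sol (lin_rhs A b y) w2 -> w1 0 = w2 0 ->
  forall t, w1 t = w2 t.
Proof.
move=> A2 [c1 k1 d1] [c2 k2 d2] e0 t; apply/eqP; rewrite -subr_eq0 -normr_le0.
have -> : 0 = 4 * (0 + 0) :> R by rewrite addr0 mulr0.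
apply: (gronwall_sub _ _ c1 k1 c2 k2 d1 d2) => //; last by rewrite e0 subrr normr0.
move=> s s01 i; rewrite !mxE opprD addrACA subrr !addr0 -sumrB.
rewrite (eq_bigr (fun l => A i l s y * (w1 s - w2 s) 0 l)); last first.
  by move=> l _; rewrite !mxE mulrBr.
apply: (le_trans (dot_le _ (A2 s i s01))); rewrite ler_wpM2r//; lra.
Qed.

(* The coordinates are the inverse of Phi(y) = exp(\sum_(a in Q) y_a X_a)(p + \sum_(a notin Q) y_a M_a).
   Commutation makes t X_a(psi(t, y)) a solution of the linearized equation, so that
   it is the derivative of psi(t, y) with respect to y_a; hence Phi maps d/dy_a to X_a. *)
Theorem straighten (X : 'I_n -> 'rV[R]_n -> 'rV[R]_n) (Q : pred 'I_n) (V : set 'rV[R]_n)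
    (p : 'rV[R]_n) (M : 'M[R]_n) : open V -> V p ->
    (forall a i, smooth_on V (fun x => X a x 0 i)) ->
    (forall a x, ~~ Q a -> X a x = 0) ->
    (forall a b i x, V x ->
      \sum_k X a x 0 k * partial k (fun x => X b x 0 i) x =
      \sum_k X b x 0 k * partial k (fun x => X a x 0 i) x) ->
    M \in unitmx -> (forall a, Q a -> row a M = X a p) ->
  exists (U : set 'rV[R]_n) (u : 'rV[R]_n -> 'rV[R]_n),
    [/\ open U, U p, U `<=` V, smooth_map_on U u & jac u p \in unitmx /\
     forall a j x, Q a -> U x -> \sum_k X a x 0 k * partial k (fun x => u x 0 j) x = (a == j)%:R].
Proof.
move=> oV Vp Xs X0 Xc Mu MX.
pose M' : 'M[R]_n := \matrix_(a, i) (if Q a then 0 else M a i).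
have [delta [psi [d0 [psiP psik psid A2]]]] := flow_family M' oV Vp Xs.
pose B := ball (0 : 'rV[R]_n) delta.
have oB : open B := ball_open _ _.
have B0 : B 0 by exact: ballxx.
have i0 : 0 <= (0 : R) <= 1 by rewrite lexx ler01.
have i1 : 0 <= (1 : R) <= 1 by rewrite lexx ler01.
have dinit a i y : B y -> partial a (fun y => psi 0 y 0 i) y = M' a i.
  move=> By; have [_ <-] := init_is_derive p M' i a y.
  apply: near_eq_derive; have nB : nbhs y B := open_nbhs_nbhs (conj oB By).
  by apply: filterS nB => z /psiP[_ -> _].
have dQ a i y : Q a -> B y -> partial a (fun y => psi 1 y 0 i) y = X a (psi 1 y) 0 i.
  move=> Qa By; have [[cp kp dp] _ pV] := psiP y By.
  have Xpc k : continuous (fun t => X a (psi t y) 0 k).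
    move=> t; apply: (@continuous_comp _ _ _ (psi ^~ y) (fun x => X a x 0 k)); first exact: cp.
    exact: (smooth_continuous (Xs a k) (pV t)).
  have sol2 : ode_sol (lin_rhs (psi_A X psi) (psi_b X psi a) y) (fun t => clamp t *: X a (psi t y)).
    split=> [t|t|t t01 k].
    - apply: rV_continuous => k; rewrite /prop_for; under eq_fun do rewrite mxE.
      by apply: cvgM; [exact: clamp_continuous|exact: Xpc].
    - by rewrite clampK -kp.
    - have t01' : 0 <= t <= 1 by case/andP: t01 => ? ?; rewrite !ltW.
      have D1 : is_derive t (1:R) (fun s => X a (psi s y) 0 k)
          (\sum_l partial l (fun x => X a x 0 k) (psi t y) * fld X y (psi t y) 0 l).
        apply: (@is_derive_chain R n _ (fun x => X a x 0 k) (fun s : R => psi s y) t (1:R)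
          (fun l => partial l (fun x => X a x 0 k) (psi t y)) (fun l => fld X y (psi t y) 0 l)).
          exact: (smooth_differentiable (Xs a k) (pV t)).
          by move=> l; exact: (smooth_is_derive l (Xs a k) (pV t)).
        by move=> l; exact: dp.
      have D2 : is_derive t (1:R) (fun s => s * X a (psi s y) 0 k)
         (1 * X a (psi t y) 0 k + t * (\sum_l partial l (fun x => X a x 0 k) (psi t y) * fld X y (psi t y) 0 l)).
        by apply: is_derive_mul => //; exact: is_derive_id.
      have -> : lin_rhs (psi_A X psi) (psi_b X psi a) y t (clamp t *: X a (psi t y)) 0 k =
         1 * X a (psi t y) 0 k + t * (\sum_l partial l (fun x => X a x 0 k) (psi t y) * fld X y (psi t y) 0 l).
        rewrite mxE mul1r addrC /psi_b; congr (_ + _).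
        rewrite clamp_id// mulr_sumr.
        transitivity (\sum_b t * (y 0 b * (\sum_l X a (psi t y) 0 l * partial l (fun x => X b x 0 k) (psi t y)))).
          rewrite /psi_A /dfld.
          under eq_bigr do rewrite mulr_suml.
          rewrite exchange_big; apply: eq_bigr => b _; rewrite !mulr_sumr.
          by apply: eq_bigr => l _; rewrite !mxE; ring.
        under [RHS]eq_bigr do rewrite mxE !mulr_sumr.
        rewrite exchange_big; apply: eq_bigr => b _.
        rewrite Xc; last exact: pV.
        by rewrite !mulr_sumr; apply: eq_bigr => l _; ring.
      apply: near_eq_is_derive D2.
      have : nbhs t [set` `]0, 1[%R] by apply: near_in_itvoo; rewrite in_itv.
      apply: filterS => s /=; rewrite in_itv /= => /andP[s0 s1].
      by rewrite mxE clamp_id// !ltW.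
  have := lin_unique (fun t i _ => A2 t y i By) (psid a y By) sol2 _ 1.
  rewrite (clamp_id i1) (clamp_id i0) scale1r scale0r.
  have -> : \row_i partial a (fun y => psi 0 y 0 i) y = 0.
    by apply/rowP => k; rewrite !mxE dinit// mxE Qa.
  by move=> /(_ erefl)/rowP/(_ i); rewrite !mxE.
have psi10 t : psi t 0 = p.
  have [[cp kp dp] p0 _] := psiP 0 B0.
  have {}p0 : psi 0 0 = p by rewrite p0 mul0mx addr0.
  rewrite kp -[RHS]p0; apply/rowP => i; apply/eqP; rewrite -subr_eq0 -normr_le0.
  apply: (@increment_bound _ (fun t => psi t 0 0 i) (fun t => fld X 0 (psi t 0) 0 i)) => //.
  - exact: (@coord_path_continuous _ _ _ i cp).
  - by move=> s s01; exact: dp.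
  - by move=> s _; rewrite mxE big1 ?normr0// => a _; rewrite mxE mul0r.
  - exact: clamp_itv.
have jM : jac (psi 1) 0 = M.
  apply/matrixP => a i; rewrite mxE; have [Qa|nQa] := boolP (Q a).
    by rewrite dQ// psi10 -MX// mxE.
  have [cv kv dv] := psid a 0 B0.
  have -> : M a i = M' a i by rewrite mxE (negPf nQa).
  rewrite -(dinit a i 0 B0); apply/eqP; rewrite -subr_eq0 -normr_le0.
  have := @increment_bound _ _ _ 0 (@coord_path_continuous _ _ _ i cv) (lexx 0) (fun t t01 => dv t t01 i) _ 1 i1.
  rewrite !mxE; apply=> t _; rewrite mxE /psi_b X0// mxE addr0.
  rewrite big1 ?normr0// => l _; rewrite /psi_A /dfld big1 ?mul0r// => b _.
  by rewrite mxE mul0r.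
have psis : smooth_map_on B (psi 1).
  move=> i; apply: Ck_smooth => // k.
  apply: (@Ck_reparam _ _ _ _ (fun t y => psi t y 0 i) (fun=> 1)); last exact: psik.
  exact: cst_continuous.
have [c [[c0 cB] cE _]] := inverse_function oB B0 psis (etrans (congr1 (fun A => A \in unitmx) jM) Mu).
have cp1 : to_coord c 0 = p by rewrite cE psi10.
exists (crange c), (of_coord c); split.
- exact: crange_open.
- by rewrite -cp1; exact: to_coord_range.
- move=> x rx; rewrite -(of_coordK rx) cE.
  by have [_ _] := psiP _ (cB _ (of_coord_dom rx)); exact.
- exact: of_coord_smooth.
split; first by rewrite -cp1; exact: jac_of_unit.
move=> a j x Qa rx; have dx := of_coord_dom rx.
have := jac_to_of dx; rewrite of_coordK// => /matrixP/(_ a j); rewrite !mxE => <-.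
apply: eq_bigr => k _; rewrite !mxE cE dQ//; last exact: cB.
by rewrite -cE of_coordK.
Qed.

End Straightening.

(** * The Caratheodory-Jacobi-Lie theorem *)

Section Extension.
Variables (R : realType) (n : nat).

Local Notation "''e_' i" := (delta_mx 0 i) (at level 8, i at level 2).

Definition ham (P : 'rV[R]_n -> 'M[R]_n) (f : 'rV[R]_n -> R) (x : 'rV[R]_n) : 'rV[R]_n :=
  \row_i \sum_k partial k f x * P x k i.

Lemma br_ham P f h x : br P f h x = \sum_j ham P f x 0 j * partial j h x.
Proof.
rewrite /br exchange_big/=; apply: eq_bigr => j _; rewrite mxE mulr_suml.
by apply: eq_bigr => i _; rewrite [P x i j * _]mulrC.
Qed.

Lemma ham_br P f x i : ham P f x 0 i = br P f (fun x => x 0 i) x.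
Proof.
rewrite br_ham (bigD1 i)//= big1 => [|j ji]; rewrite /partial.
  by have [_ ->] := coord_is_derive x i i; rewrite eqxx mulr1 addr0.
by have [_ ->] := coord_is_derive x i j; rewrite eq_sym (negPf ji) mulr0.
Qed.

Section Step.
Variables (U : set 'rV[R]_n) (p : 'rV[R]_n) (P : 'rV[R]_n -> 'M[R]_n).
Hypotheses (oU : open U) (Up : U p) (P_smooth : smooth_tensor_on U P).
Hypothesis P_skew : forall x, U x -> (P x)^T = - P x.
Hypothesis P_rank : \rank (P p) = n.
Hypothesis P_poisson : forall x, U x -> poisson_at P x.

Lemma ham_smooth f i : smooth_on U f -> smooth_on U (fun x => ham P f x 0 i).
Proof.
move=> fs; have -> : (fun x => ham P f x 0 i) = br P f (fun x => x 0 i).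
  by apply/funext => x; exact: ham_br.
by apply: br_smooth => //; exact: smooth_coord.
Qed.

(* In the straightening coordinates u the brackets {f_a, u_j} are constant for a < r,
   hence so are those of any combination of the u_j; we take the combination with
   the same differential at p as f_r, which keeps the Jacobian invertible. *)
Lemma extend_one (f : 'I_n -> 'rV[R]_n -> R) (r : 'I_n) :
    (forall a, smooth_on U (f a)) -> \matrix_(i, a) partial i (f a) p \in unitmx ->
    (forall a b : 'I_n, (a < r)%N -> (b < r)%N -> exists c, forall x, U x -> br P (f a) (f b) x = c) ->
  exists U' h, [/\ open U', U' p, U' `<=` U, smooth_on U' h &
    (forall i, partial i h p = partial i (f r) p) /\
    forall a : 'I_n, (a < r)%N -> exists c, forall x, U' x -> br P (f a) h x = c].
Proof.
move=> fs Ju fc.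
have [X XP] : exists X : 'I_n -> 'rV[R]_n -> 'rV[R]_n, forall (a : 'I_n) x,
    X a x = if (a < r)%N then ham P (f a) x else 0.
  by exists (fun (a : 'I_n) x => if (a < r)%N then ham P (f a) x else 0).
pose J : 'M[R]_n := \matrix_(i, a) partial i (f a) p.
have XE (a : 'I_n) : (a < r)%N -> X a = ham P (f a) by move=> ar; apply/funext => x; rewrite XP ar.
have XN (a : 'I_n) : ~~ (a < r)%N -> X a = (fun=> 0).
  by move=> ar; apply/funext => x; rewrite XP (negPf ar).
have Xs a i : smooth_on U (fun x => X a x 0 i).
  have [ar|ar] := boolP (a < r)%N; first by rewrite XE//; exact: ham_smooth.
  by rewrite XN//; under eq_fun do rewrite mxE; exact: smooth_cst.
have zd k i (x : 'rV[R]_n) : partial k (fun _ : 'rV[R]_n => (0 : 'rV[R]_n) 0 i) x = 0.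
  exact: derive_cst.
have Xc a b i x : U x -> \sum_k X a x 0 k * partial k (fun x => X b x 0 i) x =
    \sum_k X b x 0 k * partial k (fun x => X a x 0 i) x.
  move=> Ux; have [ar|ar] := boolP (a < r)%N; last first.
    rewrite (XN _ ar) [LHS]big1 => [|k _]; last by rewrite mxE mul0r.
    by rewrite [RHS]big1// => k _; rewrite zd mulr0.
  have [br'|br'] := boolP (b < r)%N; last first.
    rewrite (XN _ br') [RHS]big1 => [|k _]; last by rewrite mxE mul0r.
    by rewrite [LHS]big1// => k _; rewrite zd mulr0.
  have [c cP] := fc a b ar br'.
  have E g : (fun x => ham P g x 0 i) = br P g (fun x => x 0 i).
    by apply/funext => z; exact: ham_br.
  have XB (k l : 'I_n) : (k < r)%N -> (l < r)%N -> \sum_m X k x 0 m * partial m (fun x => X l x 0 i) x =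
      br P (f k) (br P (f l) (fun x => x 0 i)) x.
    by move=> kr lr; rewrite -E br_ham (XE k kr) (XE l lr).
  rewrite (XB a b ar br') (XB b a br' ar).
  exact: (br_commute oU P_smooth P_skew P_poisson (fs a) (fs b) (smooth_coord i oU) cP Ux).
have Mu : J^T *m P p \in unitmx.
  by rewrite unitmx_mul unitmx_tr Ju/= -row_free_unit /row_free P_rank.
have MX (a : 'I_n) : (a < r)%N -> row a (J^T *m P p) = X a p.
  move=> ar; rewrite XE//; apply/rowP => i; rewrite !mxE.
  by apply: eq_bigr => k _; rewrite !mxE.
have X0 (a : 'I_n) x : ~~ (a < r)%N -> X a x = 0 by move=> ar; rewrite XN.
have [U' [u [oU' U'p sU us [ju uX]]]] := @straighten R n X (fun a : 'I_n => (a < r)%N) U p _ oU Up Xs X0 Xc Mu MX.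
pose lam := invmx (jac u p) *m col r J.
have hs : smooth_on U' (fun x => \sum_j lam j 0 * u x 0 j).
  by apply: smooth_sum => // j _; apply: smoothM => //; exact: smooth_cst.
have hd k x : U' x -> partial k (fun x => \sum_j lam j 0 * u x 0 j) x =
    \sum_j lam j 0 * partial k (fun x => u x 0 j) x.
  move=> Ux; suff D : is_derive x 'e_k (fun x => \sum_j lam j 0 * u x 0 j)
     (\sum_j lam j 0 * partial k (fun x => u x 0 j) x) by rewrite {1}/partial; case: D => _ ->.
  by apply: is_derive_sumr => j; apply: is_derive_mull; exact: (smooth_is_derive k (us j)).
exists U', (fun x => \sum_j lam j 0 * u x 0 j); split=> //; split=> [i|a ar].
  rewrite hd//.
  have : (jac u p *m lam) i 0 = J i r by rewrite mulKVmx// mxE.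
  rewrite !mxE => <-; apply: eq_bigr => j _.
  by rewrite mulrC; congr (_ * _); rewrite mxE.
exists (lam a 0) => x Ux; rewrite br_ham -XE//.
under eq_bigr do rewrite hd// mulr_sumr.
rewrite exchange_big/= (bigD1 a)//= [X in _ + X]big1 => [|j ja].
  rewrite addr0; under eq_bigr do rewrite mulrCA.
  by rewrite -mulr_sumr uX// eqxx mulr1.
under eq_bigr do rewrite mulrCA.
by rewrite -mulr_sumr uX// eq_sym (negPf ja) mulr0.
Qed.

End Step.

Theorem caratheodory_jacobi_lie (U : set 'rV[R]_n) (p : 'rV[R]_n) (P : 'rV[R]_n -> 'M[R]_n)
    (f : 'I_n -> 'rV[R]_n -> R) (r : nat) : open U -> U p -> smooth_tensor_on U P ->
    (forall x, U x -> (P x)^T = - P x) -> \rank (P p) = n ->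
    (forall x, U x -> poisson_at P x) ->
    (forall a, smooth_on U (f a)) -> \matrix_(i, a) partial i (f a) p \in unitmx ->
    (forall a b : 'I_n, (a < r)%N -> (b < r)%N -> exists c, forall x, U x -> br P (f a) (f b) x = c) ->
  exists (U' : set 'rV[R]_n) (f' : 'I_n -> 'rV[R]_n -> R), [/\ open U', U' p, U' `<=` U, forall a, smooth_on U' (f' a) &
    [/\ forall i a, partial i (f' a) p = partial i (f a) p,
        forall a : 'I_n, (a < r)%N -> f' a = f a &
        forall a b, exists c, forall x, U' x -> br P (f' a) (f' b) x = c]].
Proof.
move=> oU Up Ps Pk Pr Pp fs Ju fc.
suff H d : exists (U' : set 'rV[R]_n) (f' : 'I_n -> 'rV[R]_n -> R),
    [/\ open U', U' p, U' `<=` U, forall a, smooth_on U' (f' a) &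
    [/\ forall i a, partial i (f' a) p = partial i (f a) p,
        forall a : 'I_n, (a < r)%N -> f' a = f a &
        forall a b : 'I_n, (a < r + d)%N -> (b < r + d)%N ->
          exists c, forall x, U' x -> br P (f' a) (f' b) x = c]].
  have [U' [f' [H1 H2 H3 H4 [H5 H6 H7]]]] := H n; exists U', f'; split=> //; split=> // a b.
  by apply: H7; apply: leq_trans (ltn_ord _) (leq_addl _ _).
elim: d => [|d [U1 [f1 [H1 H2 H3 H4 [H5 H6 H7]]]]].
  by exists U, f; split=> //; split=> // a b; rewrite addn0; exact: fc.
have [le|lt] := leqP n (r + d)%N.
  exists U1, f1; split=> //; split=> // a b _ _.
  by apply: H7; exact: leq_trans (ltn_ord _) le.
pose q := Ordinal lt.
have J1 : \matrix_(i, a) partial i (f1 a) p \in unitmx.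
  by move: Ju; congr (_ \in unitmx); apply/matrixP => i a; rewrite !mxE H5.
have P1s : smooth_tensor_on U1 P by move=> i j; apply: smooth_sub (Ps i j).
have P1k x : U1 x -> (P x)^T = - P x by move=> /H3; exact: Pk.
have P1p x : U1 x -> poisson_at P x by move=> /H3; exact: Pp.
have [U2 [h [K1 K2 K3 K4 [K5 K6]]]] := @extend_one U1 p P H1 H2 P1s P1k Pr P1p f1 q H4 J1 H7.
exists U2, (fun a => if a == q then h else f1 a); split=> //.
- by move=> x /K3/H3.
- by move=> a; case: eqP => // _; apply: smooth_sub (H4 a).
have ltq (a : 'I_n) : a != q -> (a < r + d.+1)%N -> (a < r + d)%N.
  move=> aq; rewrite addnS ltnS leq_eqVlt => /orP[/eqP ae|//].
  by move: aq; rewrite -(inj_eq val_inj)/= ae eqxx.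
split.
- by move=> i a; case: eqP => [->|_] //; rewrite K5.
- move=> a ar; case: eqP => [ae|_]; last exact: H6.
  by move: ar; rewrite ae /= ltnNge leq_addr.
- move=> a b ar br'; have [aq|aq] := eqVneq a q; have [bq|bq] := eqVneq b q.
  + exists 0 => x Ux.
    have := br_skew P1k h h (K3 _ Ux) => /eqP.
    by rewrite -addr_eq0 -mulr2n mulrn_eq0/= => /eqP.
  + have [c cP] := K6 b (ltq b bq br'); exists (- c) => x Ux.
    by rewrite (br_skew P1k)//; [rewrite cP|exact: K3].
  + by have [c cP] := K6 a (ltq a aq ar); exists c.
  + have [c cP] := H7 a b (ltq a aq ar) (ltq b bq br'); exists c => x /K3; exact: cP.
Qed.

End Extension.

(** * Flat metrics *)

Lemma congruence_derivative (R : pzRingType) n (Y G H Q D : 'M[R]_n) :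
  Y *m G *m Y^T *m D *m (Y *m G *m Y^T)
  + (Y *m G *m Y^T *m Q *m (H *m G *m Y^T) + Y *m G *m H^T *m Q *m (Y *m G *m Y^T)) =
  Y *m G *m (H^T *m Q *m Y + Y^T *m D *m Y + Y^T *m Q *m H) *m G *m Y^T.
Proof.
rewrite !mulmxDr !mulmxDl !mulmxA.
by rewrite [LHS]addrA [LHS]addrC [LHS]addrA.
Qed.

Lemma mulmx_row_eq (R : pzRingType) m n q r (A A' : 'M[R]_(m, n)) (B : 'M[R]_(n, q))
    (C : 'M[R]_(q, r)) s s' i :
  (forall a, A s a = A' s' a) -> (A *m B *m C) s i = (A' *m B *m C) s' i.
Proof.
move=> H; rewrite !mxE; apply: eq_bigr => b _; rewrite !mxE; congr (_ * _).
by apply: eq_bigr => a _; rewrite H.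
Qed.

Section Tensor.
Variables (R : realType) (n : nat) (U : set 'rV[R]_n) (g P : 'rV[R]_n -> 'M[R]_n).
Variables (y : 'rV[R]_n -> 'rV[R]_n) (G : 'M[R]_n).
Hypotheses (oU : open U) (P_smooth : smooth_tensor_on U P) (y_smooth : smooth_map_on U y).
Hypothesis G_sym : G^T = G.
Hypothesis gE : forall x, U x -> g x = jac y x *m G *m (jac y x)^T.

Local Notation "''e_' i" := (delta_mx 0 i) (at level 8, i at level 2).

Let hess x k : 'M[R]_n := \matrix_(s, a) partial k (partial s (fun z => y z 0 a)) x.
Let dbr x k : 'M[R]_n := \matrix_(a, b) partial k (br P (fun z => y z 0 a) (fun z => y z 0 b)) x.
Let dP x k : 'M[R]_n := \matrix_(a, b) partial k (fun z => P z a b) x.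

Lemma metric_partial x k s j : U x ->
  partial k (fun z => g z s j) x =
  (hess x k *m G *m (jac y x)^T) s j + (hess x k *m G *m (jac y x)^T) j s.
Proof.
move=> Ux.
have D : is_derive x 'e_k (fun z => \sum_b (\sum_a jac y z s a * G a b) * jac y z j b)
    (\sum_b ((\sum_a hess x k s a * G a b) * jac y x j b
      + (\sum_a jac y x s a * G a b) * hess x k j b)).
  have DY i c : is_derive x 'e_k (fun z => jac y z i c) (hess x k i c).
    under eq_fun do rewrite mxE; rewrite mxE.
    by apply: (smooth_is_derive (B := U)) => //; apply: smooth_on_partial; exact: y_smooth.
  apply: is_derive_sumr => b; apply: is_derive_mul => //.
  apply: is_derive_sumr => a; rewrite mulrC; under eq_fun do rewrite mulrC.
  exact: is_derive_mull.
transitivity (\sum_b ((\sum_a hess x k s a * G a b) * jac y x j b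
      + (\sum_a jac y x s a * G a b) * hess x k j b)).
  rewrite {1}/partial; case: D => _ <-; apply: near_eq_derive.
  have nU : nbhs x U := open_nbhs_nbhs (conj oU Ux).
  apply: filterS nU => z Uz; rewrite gE// mxE; apply: eq_bigr => b _.
  by rewrite mxE [in RHS]mulrC mulrC !mxE.
rewrite big_split/=; congr (_ + _).
  by rewrite mxE; apply: eq_bigr => b _; rewrite !mxE; congr (_ * _); apply: eq_bigr => a _; rewrite !mxE.
rewrite mxE.
transitivity (\sum_b \sum_a jac y x s a * G a b * hess x k j b).
  by apply: eq_bigr => b _; rewrite mulr_suml.
rewrite exchange_big/=; apply: eq_bigr => a _.
rewrite [(hess x k *m G) j a]mxE mulr_suml; apply: eq_bigr => b _.
have -> : G b a = G a b by have /matrixP/(_ a b) := G_sym; rewrite mxE.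
by rewrite [(jac y x)^T a s]mxE; ring.
Qed.

Lemma christoffel_flat x k s j : U x ->
  christoffel1 g k s j x = (hess x k *m G *m (jac y x)^T) s j.
Proof.
move=> Ux.
have hs k' s' i : (hess x k' *m G *m (jac y x)^T) s' i = (hess x s' *m G *m (jac y x)^T) k' i.
  apply: mulmx_row_eq => a.
  rewrite [LHS]mxE [RHS]mxE; exact: (smooth_partialC k' s' oU (y_smooth a) Ux).
have [A AE] : exists A : 'I_n -> 'I_n -> 'I_n -> R, forall k s j,
    (hess x k *m G *m (jac y x)^T) s j = A k s j.
  by exists (fun k s j => (hess x k *m G *m (jac y x)^T) s j).
have M k' s' j' : partial k' (fun z => g z s' j') x = A k' s' j' + A k' j' s'.
  by rewrite (metric_partial k' s' j' Ux) !AE.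
have S k' s' i : A k' s' i = A s' k' i by rewrite -!AE; exact: hs.
rewrite /christoffel1 !M AE (S s k j) (S j k s) (S j s k).
by field.
Qed.

Lemma br_partial_mx x k : U x ->
  dbr x k = (hess x k)^T *m P x *m jac y x + (jac y x)^T *m dP x k *m jac y x
            + (jac y x)^T *m P x *m hess x k.
Proof.
move=> Ux; apply/matrixP => a b.
have E (A B C : 'M[R]_n) : (A^T *m B *m C) a b = \sum_i \sum_j B i j * A i a * C j b.
  rewrite mxE exchange_big/=; apply: eq_bigr => j _; rewrite mxE mulr_suml.
  by apply: eq_bigr => i _; rewrite mxE; congr (_ * _); rewrite mulrC.
have D (A B C : 'M[R]_n) : (A + B + C) a b = A a b + B a b + C a b by rewrite mxE [X in X + _]mxE.
rewrite D !E mxE (partial_br P_smooth k (y_smooth a) (y_smooth b) Ux).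
rewrite -!big_split/=; apply: eq_bigr => i _; rewrite -!big_split/=; apply: eq_bigr => j _.
rewrite [X in X + _ = _]addrC [hess x k i a]mxE [hess x k j b]mxE [dP x k i j]mxE.
by rewrite [jac y x i a]mxE [jac y x j b]mxE.
Qed.

(* With Q the matrix of the brackets {y^a, y^b}, condition (2) for the index k reads
   Y G (d_k Q) G Y^T = 0. *)
Theorem compatible_tensor x i j k : U x ->
  \sum_(a < n) \sum_(b < n) g x a i * g x b j * partial k (fun z => P z a b) x
    + \sum_(s < n) (lower_fst g P i s x * christoffel1 g k s j x
                    + lower_snd g P s j x * christoffel1 g k s i x)
  = (jac y x *m G *m dbr x k *m G *m (jac y x)^T) i j.
Proof.
move=> Ux.
have gT : (g x)^T = g x by rewrite gE// !trmx_mul trmxK G_sym mulmxA.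
have gs u v : g x u v = g x v u by have /matrixP/(_ v u) := gT; rewrite mxE.
set A := hess x k *m G *m (jac y x)^T.
have E1 : \sum_(a < n) \sum_(b < n) g x a i * g x b j * partial k (fun z => P z a b) x =
    (g x *m dP x k *m g x) i j.
  rewrite mxE exchange_big/=; apply: eq_bigr => b _; rewrite mxE mulr_suml.
  by apply: eq_bigr => a _; rewrite (gs a i) [dP x k a b]mxE mulrAC.
have E2 : \sum_(s < n) (lower_fst g P i s x * christoffel1 g k s j x
      + lower_snd g P s j x * christoffel1 g k s i x) =
    (g x *m P x *m A) i j + (A^T *m P x *m g x) i j.
  rewrite big_split/=; congr (_ + _).
    by rewrite mxE; apply: eq_bigr => s _; rewrite christoffel_flat// [(g x *m P x) i s]mxE.
  rewrite -mulmxA mxE; apply: eq_bigr => s _; rewrite christoffel_flat// mulrC [A^T i s]mxE.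
  congr (_ * _); rewrite mxE; apply: eq_bigr => c _.
  by rewrite mulrC (gs c j).
have add_e (B1 B2 B3 : 'M[R]_n) : B1 i j + (B2 i j + B3 i j) = (B1 + (B2 + B3)) i j.
  by rewrite [RHS]mxE [(B2 + B3) i j]mxE.
rewrite E1 E2 add_e br_partial_mx//.
have -> : A^T = jac y x *m G *m (hess x k)^T by rewrite !trmx_mul trmxK G_sym mulmxA.
by rewrite /A gE// congruence_derivative.
Qed.

End Tensor.

Section FlatCoordinates.
Variables (R : realType) (n : nat).

Lemma contract_eq0 (Y : 'M[R]_n) (v : 'I_n -> R) : Y \in unitmx ->
  (forall a, \sum_i Y i a * v i = 0) -> forall i, v i = 0.
Proof.
move=> Yu H i; pose r : 'rV[R]_n := \row_i v i.
have r0 : r *m Y = 0.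
  by apply/rowP => a; rewrite !mxE -[RHS](H a); apply: eq_bigr => j _; rewrite mxE mulrC.
have : r = 0 by rewrite -(mulmxK Yu r) r0 mul0mx.
by move=> /rowP/(_ i); rewrite !mxE.
Qed.

Lemma poisson_of_constant (U : set 'rV[R]_n) (P : 'rV[R]_n -> 'M[R]_n) (y : 'rV[R]_n -> 'rV[R]_n)
    (Q : 'M[R]_n) x : open U -> smooth_tensor_on U P -> (forall x, U x -> (P x)^T = - P x) ->
    smooth_map_on U y -> (forall a b x, U x -> br P (fun z => y z 0 a) (fun z => y z 0 b) x = Q a b) ->
    U x -> jac y x \in unitmx ->
  poisson_at P x.
Proof.
move=> oU Ps Pk ys yQ Ux Yu i j k.
move: i; apply: (contract_eq0 Yu) => a; move: j => j0.
transitivity (\sum_i partial i (fun z => y z 0 a) x * (\sum_(s < n) (P x s k * partial s (fun z => P z i j0) x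
                  + P x s i * partial s (fun z => P z j0 k) x
                  + P x s j0 * partial s (fun z => P z k i) x))).
  by apply: eq_bigr => i _; rewrite [jac y x i a]mxE.
move: j0; apply: (contract_eq0 Yu) => b; move: k => k0.
transitivity (\sum_j \sum_i partial i (fun z => y z 0 a) x * partial j (fun z => y z 0 b) x *
    (\sum_(s < n) (P x s k0 * partial s (fun z => P z i j) x
                  + P x s i * partial s (fun z => P z j k0) x
                  + P x s j * partial s (fun z => P z k0 i) x))).
  apply: eq_bigr => j _; rewrite [jac y x j b]mxE mulr_sumr; apply: eq_bigr => i _.
  by rewrite mulrCA mulrA.
move: k0; apply: (contract_eq0 Yu) => c.
have J := br_jacobi oU Ps Pk (ys a) (ys b) (ys c) Ux.
rewrite (br_cstl P oU _ (yQ a b) Ux) (br_cstl P oU _ (yQ b c) Ux) (br_cstl P oU _ (yQ c a) Ux) in J.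
rewrite !addr0 in J; rewrite [RHS]J.
transitivity (\sum_k \sum_j \sum_i partial i (fun z => y z 0 a) x * partial j (fun z => y z 0 b) x *
    partial k (fun z => y z 0 c) x *
    (\sum_(s < n) (P x s k * partial s (fun z => P z i j) x
                  + P x s i * partial s (fun z => P z j k) x
                  + P x s j * partial s (fun z => P z k i) x))).
  apply: eq_bigr => k _; rewrite [jac y x k c]mxE mulr_sumr; apply: eq_bigr => j _.
  by rewrite mulr_sumr; apply: eq_bigr => i _; rewrite mulrA; congr (_ * _); rewrite mulrC.
rewrite exchange_big/=; under eq_bigr do rewrite exchange_big/=.
by rewrite exchange_big.
Qed.

Lemma constant_on_ball (p : 'rV[R]_n) (r : R) (f : 'rV[R]_n -> R) :
    smooth_on (ball p r) f -> (forall i x, ball p r x -> partial i f x = 0) ->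
  forall x, ball p r x -> f x = f p.
Proof.
move=> fs f0 x bx; have bp : ball p r p by apply: ballxx; case: bx.
have [z i bz|xi [xib E]] := @box_mvt _ _ f (fun i => partial i f) p x.
  by apply: (smooth_is_derive i fs); exact: box_ball bz.
apply/eqP; rewrite -subr_eq0 E big1// => i _.
by rewrite f0 ?mul0r//; exact: box_ball (xib i).
Qed.

Lemma cov_componentsE (c : coord_system R n) g y :
  cov_components c g y = jac (of_coord c) y *m g (of_coord c y) *m (jac (of_coord c) y)^T.
Proof.
apply/matrixP => i j; rewrite mxE [RHS]mxE exchange_big; apply: eq_bigr => s _.
rewrite mxE mulr_suml; apply: eq_bigr => r _; rewrite !mxE.
by rewrite [g _ _ _ * _]mulrC.
Qed.

Lemma contra_componentsE (c : coord_system R n) P y i j :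
  contra_components c P y i j =
  br P (fun x => to_coord c x 0 i) (fun x => to_coord c x 0 j) (of_coord c y).
Proof. by rewrite mxE. Qed.

Lemma flat_metric (W : set 'rV[R]_n) p (c : coord_system R n) g G :
    coord_near W p c -> (forall x, W x -> (g x)^T = g x) ->
    (forall y, crange c y -> cov_components c g y = G) ->
  G^T = G /\ forall x, cdom c x -> g x = jac (to_coord c) x *m G *m (jac (to_coord c) x)^T.
Proof.
move=> [cp cW] gs GE.
have E x : cdom c x -> G = jac (of_coord c) (to_coord c x) *m g x *m (jac (of_coord c) (to_coord c x))^T.
  by move=> dx; rewrite -(GE (to_coord c x)) ?cov_componentsE ?to_coordK//; exact: to_coord_range.
split; first by rewrite (E p cp) !trmx_mul trmxK gs ?mulmxA//; exact: cW.
move=> x dx; rewrite (E x dx) !mulmxA jac_to_of// mul1mx -mulmxA -trmx_mul jac_to_of//.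
by rewrite trmx1 mulmx1.
Qed.

(* The rows of G' = pid_mx (\rank G) *m N beyond the rank vanish; as G' is symmetric,
   it is supported on the leading block. *)
Lemma symmetric_normal_form (G : 'M[R]_n) : G^T = G -> exists (E N : 'M[R]_n),
  [/\ E \in unitmx, N \in unitmx, G = E^T *m (pid_mx (\rank G) *m N) *m E &
    (pid_mx (\rank G) *m N)^T = pid_mx (\rank G) *m N].
Proof.
move=> Gs; set E := row_ebase G; set C := col_ebase G; set D : 'M[R]_n := pid_mx (\rank G).
have Eu : E \in unitmx := row_ebase_unit G.
have Cu : C \in unitmx := col_ebase_unit G.
have GE : G = C *m D *m E by rewrite mulmx_ebase.
have Dt : D^T = D by rewrite tr_pid_mx.
have GE' : G = E^T *m D *m C^T by rewrite -{1}Gs {1}GE !trmx_mul Dt mulmxA.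
have Nu : C^T *m invmx E \in unitmx by rewrite unitmx_mul unitmx_tr Cu unitmx_inv.
have F : D *m (C^T *m invmx E) = (invmx E)^T *m G *m invmx E.
  by rewrite GE' !mulmxA -trmx_mul mulmxV// trmx1 mul1mx.
exists E, (C^T *m invmx E); split=> //.
  by rewrite GE' !mulmxA mulmxKV.
by rewrite F !trmx_mul trmxK Gs mulmxA.
Qed.

Lemma pid_block_eq0 (r : nat) (A : 'M[R]_n) :
    (pid_mx r : 'M[R]_n) *m A *m (pid_mx r : 'M[R]_n) = 0 ->
  forall a b : 'I_n, (a < r)%N -> (b < r)%N -> A a b = 0.
Proof.
move=> /matrixP H a b ar br'; have := H a b; rewrite mxE (bigD1 b)//= big1 => [|k kb].
  rewrite mxE (bigD1 a)//= big1 => [|k ka].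
    by rewrite !mxE !eqxx ar br'/= mulr1 mul1r !addr0.
  have ka' : (nat_of_ord a == k) = false by rewrite eq_sym (inj_eq val_inj); exact/negbTE.
  by rewrite [_ a k]mxE ka' mul0r.
have kb' : (nat_of_ord k == b) = false by rewrite (inj_eq val_inj); exact/negbTE.
by rewrite [_ k b]mxE kb' mulr0.
Qed.

End FlatCoordinates.

Theorem theorem3p3 (R : realType) (n : nat) (W : set 'rV[R]_n) (p : 'rV[R]_n)
    (g P : 'rV[R]_n -> 'M[R]_n)
    (W_open : open W) (Wp : W p)
    (g_smooth : smooth_tensor_on W g)
    (g_sym : forall x, W x -> (g x)^T = g x)
    (g_flat : exists c : coord_system R n,
        coord_near W p c /\ cov_constant_in c g)
    (P_smooth : smooth_tensor_on W P)
    (P_skew : forall x, W x -> (P x)^T = - P x)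
    (P_rank : \rank (P p) = n) :
  (exists c : coord_system R n,
      [/\ coord_near W p c, cov_constant_in c g & contra_constant_in c P])
  <->
  (\forall x \near p, poisson_at P x /\ compatible_at g P x).
Proof.
split=> [[c [cn [G GE] [Q QE]]]|near_cond].
  have [cp cW] := cn; have [Gs gE] := flat_metric cn g_sym GE.
  have nU : nbhs p (cdom c) := open_nbhs_nbhs (conj (@cdom_open _ _ c) cp).
  have Ps : smooth_tensor_on (cdom c) P by move=> i j; exact: smooth_sub (P_smooth i j).
  have Pk x : cdom c x -> (P x)^T = - P x by move=> /cW; exact: P_skew.
  have ys := @to_coord_smooth _ _ c.
  have yQ a b x : cdom c x -> br P (fun z => to_coord c z 0 a) (fun z => to_coord c z 0 b) x = Q a b.
    move=> dx; have := QE _ (@to_coord_range _ _ c x dx) => /matrixP/(_ a b).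
    by rewrite contra_componentsE to_coordK.
  apply: filterS nU => x dx; split.
    exact: (poisson_of_constant (@cdom_open _ _ c) Ps Pk ys yQ dx (jac_to_unit dx)).
  move=> i j k; rewrite (compatible_tensor (@cdom_open _ _ c) Ps ys Gs gE i j k dx).
  have -> : \matrix_(a, b) partial k (br P (fun z => to_coord c z 0 a) (fun z => to_coord c z 0 b)) x = 0.
    apply/matrixP => a b; rewrite mxE [RHS]mxE.
    exact: (partial_cst_on (@cdom_open _ _ c) k (yQ a b) dx).
  by rewrite mulmx0 !mul0mx mxE.
have [c [cn [G GE]]] := g_flat.
have [cp cW] := cn; have [Gs gE] := flat_metric cn g_sym GE.
have nU : nbhs p (cdom c) := open_nbhs_nbhs (conj (@cdom_open _ _ c) cp).
have /nbhs_ballP[r0 /= r00 rP] : \forall x \near p,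
    cdom c x /\ (poisson_at P x /\ compatible_at g P x) by exact: filterI nU near_cond.
have [U UE] : exists U, U = ball p r0 by exists (ball p r0).
have oU : open U by rewrite UE; exact: ball_open.
have Up : U p by rewrite UE; exact: ballxx.
have Uc x : U x -> cdom c x by rewrite UE => /rP[].
have UW x : U x -> W x by move=> /Uc; exact: cW.
have Ps : smooth_tensor_on U P by move=> i j; exact: smooth_sub (P_smooth i j).
have Pk x : U x -> (P x)^T = - P x by move=> /UW; exact: P_skew.
have Pp x : U x -> poisson_at P x by rewrite UE => /rP[_ []].
have Pc x : U x -> compatible_at g P x by rewrite UE => /rP[_ []].
have [E [N [Eu Nu GEN Hs]]] := symmetric_normal_form Gs.
set r := \rank G in GEN Hs; pose D : 'M[R]_n := pid_mx r; pose G' := D *m N.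
have [f fE] : exists f : 'rV[R]_n -> 'rV[R]_n, forall x, f x = to_coord c x *m E^T.
  by exists (fun x => to_coord c x *m E^T).
have fEi j x : f x 0 j = \sum_k E j k * to_coord c x 0 k.
  by rewrite fE mxE; apply: eq_bigr => k _; rewrite mxE mulrC.
have ys i : smooth_on U (fun x => to_coord c x 0 i).
  by apply: smooth_sub (@to_coord_smooth _ _ c i) => x /Uc.
have fs : smooth_map_on U f.
  move=> j; have -> : (fun x => f x 0 j) = (fun x => \sum_k E j k * to_coord c x 0 k).
    by apply/funext => x; exact: fEi.
  by apply: smooth_sum => // k _; apply: smoothM => //; exact: smooth_cst.
have fJ x : U x -> jac f x = jac (to_coord c) x *m E^T.
  move=> Ux; apply/matrixP => i j; rewrite [LHS]mxE [RHS]mxE.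
  have -> : (fun x => f x 0 j) = (fun x => \sum_k E j k * to_coord c x 0 k).
    by apply/funext => z; exact: fEi.
  suff Dv : is_derive x (delta_mx 0 i) (fun x => \sum_k E j k * to_coord c x 0 k)
      (\sum_k E j k * partial i (fun x => to_coord c x 0 k) x).
    rewrite {1}/partial; case: Dv => _ ->; apply: eq_bigr => k _.
    by rewrite [jac _ _ _ _]mxE [E^T _ _]mxE mulrC.
  by apply: is_derive_sumr => k; apply: is_derive_mull; exact: (smooth_is_derive i (ys k) Ux).
have fJu x : U x -> jac f x \in unitmx.
  by move=> Ux; rewrite fJ// unitmx_mul unitmx_tr Eu andbT; exact: jac_to_unit (Uc _ Ux).
have gE' x : U x -> g x = jac f x *m G' *m (jac f x)^T.
  move=> Ux; rewrite gE; last exact: Uc.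
  by rewrite fJ// {1}GEN trmx_mul trmxK !mulmxA.
have br0 x k (a b : 'I_n) : U x -> (a < r)%N -> (b < r)%N ->
    partial k (br P (fun z => f z 0 a) (fun z => f z 0 b)) x = 0.
  move=> Ux ar br'.
  set B : 'M[R]_n := \matrix_(a, b) partial k (br P (fun z => f z 0 a) (fun z => f z 0 b)) x.
  have B0 : jac f x *m G' *m B *m G' *m (jac f x)^T = 0.
    apply/matrixP => i j; rewrite [RHS]mxE -(compatible_tensor oU Ps fs Hs gE' i j k Ux).
    exact: Pc.
  have GBG : G' *m B *m G' = 0.
    have := congr1 (fun A => invmx (jac f x) *m A *m invmx (jac f x)^T) B0.
    by rewrite /= mulmx0 mul0mx !mulmxA mulmxK ?unitmx_tr ?fJu// mulVmx ?fJu// mul1mx.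
  have DBD : D *m B *m D = 0.
    have HN : G' = N^T *m D by rewrite -[LHS]Hs trmx_mul tr_pid_mx.
    have := congr1 (fun A => invmx N^T *m A *m invmx N) GBG.
    rewrite /= mulmx0 mul0mx {1}HN !mulmxA mulVmx ?unitmx_tr// mul1mx.
    by rewrite -[D *m B *m D *m N *m _]mulmxA mulmxV// mulmx1.
  by have := pid_block_eq0 DBD ar br'; rewrite mxE.
have brc (a b : 'I_n) : (a < r)%N -> (b < r)%N ->
    exists k, forall x, U x -> br P (fun z => f z 0 a) (fun z => f z 0 b) x = k.
  move=> ar br'; exists (br P (fun z => f z 0 a) (fun z => f z 0 b) p).
  move: oU Ps fs br0; rewrite UE => oB PsB fsB brB x bx.
  apply: (@constant_on_ball _ _ p r0) => //; first exact: br_smooth.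
  by move=> k z bz; exact: brB.
have Jf : \matrix_(i, a) partial i (fun z => f z 0 a) p \in unitmx by exact: fJu Up.
have [U' [f' [oU' U'p sU f's [f'J f'f f'c]]]] :=
  caratheodory_jacobi_lie oU Up Ps Pk P_rank Pp fs Jf brc.
have [h hE] : exists h : 'rV[R]_n -> 'rV[R]_n, forall x a, h x 0 a = f' a x.
  by exists (fun x => \row_a f' a x) => x a; rewrite mxE.
have hE' a : (fun x => h x 0 a) = f' a by apply/funext => x; exact: hE.
have hs : smooth_map_on U' h by move=> a; rewrite hE'.
have hJ : jac h p \in unitmx.
  by move: Jf; congr (_ \in unitmx); apply/matrixP => i a; rewrite !mxE hE' f'J.
have [c' [[c'p c'U] c'h _]] := inverse_function oU' U'p hs hJ.
exists c'; split.
- by split=> // x /c'U/sU/UW.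
- exists G' => y ry; rewrite cov_componentsE.
  have dx := of_coord_dom ry; set x := of_coord c' y.
  have U'x : U' x := c'U _ dx.
  have Ux : U x := sU _ U'x.
  have ZY : jac (of_coord c') y *m jac h x = 1%:M.
    by have := jac_of_to dx; rewrite of_coordK// c'h.
  have FD : jac f x *m D = jac h x *m D.
    apply/matrixP => i a; rewrite [LHS]mxE [RHS]mxE; apply: eq_bigr => k _.
    rewrite [D k a]mxE; have [kr|kr] := boolP (k < r)%N; last by rewrite andbF !mulr0.
    by congr (_ * _); rewrite [LHS]mxE [RHS]mxE hE' f'f.
  have DD : D *m D = D by rewrite pid_mx_id// rank_leq_row.
  have HN : G' = N^T *m D by rewrite -[LHS]Hs trmx_mul tr_pid_mx.
  have G'D : G' = D *m G' *m D by rewrite /G' !mulmxA DD -/G' {2}HN -mulmxA DD.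
  have gh : g x = jac h x *m G' *m (jac h x)^T.
    have DDt (A : 'M[R]_n) : D *m A^T = (A *m D)^T by rewrite trmx_mul tr_pid_mx.
    rewrite gE'// G'D !mulmxA FD -!mulmxA !DDt FD.
    by [].
  rewrite gh !mulmxA ZY mul1mx -mulmxA -trmx_mul ZY trmx1 mulmx1.
  by [].
- have /choice[q qP] : forall ab : 'I_n * 'I_n, exists k, forall x, U' x -> br P (f' ab.1) (f' ab.2) x = k.
    by move=> ab; exact: f'c.
  exists (\matrix_(a, b) q (a, b)) => y ry; apply/matrixP => a b.
  rewrite contra_componentsE mxE c'h !hE'.
  by apply: (qP (a, b)); exact: c'U (of_coord_dom ry).
Qed.
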